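(* Let $X_1,\dots,X_n$ be a random sample of size $n$ from a continuous regular one-parameter exponential family, let $\theta$ be its mean value parameter, and let $\hat\theta$ and $w(\theta)$ be the maximum likelihood estimator and the log-likelihood ratio for $\theta$. Let $\sigma_\theta$ be the standard error of $\hat\theta$, let $r^*(\theta)$ be the modified directed likelihood, and let $r(b(\theta))$ be the median bias corrected directed likelihood, where $b(\theta)$ is the median of $\hat\theta$ under $\theta$ (all defined in the context). Then, as $n\to\infty$, $$r(b(\theta))=r^*(\theta)+O_p(n^{-1})\qquad\text{for }(\theta-\hat\theta)/\sigma_\theta=O_p(1).$$
   Context: Model. The observations $X_i$ are i.i.d. continuous with density $f(x;\bar\eta)=\exp[\bar\eta\, t(x)-\bar\psi(\bar\eta)-d(x)]$, $\bar\eta$ an unknown real parameter. With $y=n^{-1}\sum_{i=1}^n t(X_i)$, $\eta=n\bar\eta$ and $\psi(\eta)=n\bar\psi(\bar\eta)$, the log-likelihood is $\eta y-\psi(\eta)$. The mean value parameter is $\theta=\psi'(\eta)=\mathrm{E}(y)$; its maximum likelihood estimator is $\hat\theta=y$, whose standard error is $\sigma_\theta=\psi^{(2)}(\eta)^{1/2}$ (with $\eta=\eta(\theta)$ the value such that $\psi'(\eta)=\theta$). As a function of $\theta$ and of the sufficient statistic $\hat\theta$, the log-likelihood is $\ell(\theta;\hat\theta)=\eta(\theta)\hat\theta-\psi(\eta(\theta))$, and the log-likelihood ratio is $w(\theta)=2\{\ell(\hat\theta;\hat\theta)-\ell(\theta;\hat\theta)\}$. $\mathrm{P}(\cdot;\theta)$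 denotes probability under $\theta$ and $O_p(\cdot)$ refers to probability under $\mathrm{P}(\cdot;\theta)$ as $n\to\infty$. The model is assumed regular enough for first order likelihood asymptotics to hold. Let $G(y;\theta)=\mathrm{P}(\hat\theta\le y;\theta)$, assumed continuous and non-increasing in $\theta$. The median function $b(\theta)$ is defined by $G(b(\theta);\theta)=1/2$; it is assumed continuous and increasing in $\theta$. Directed likelihood: $r(\theta)=\operatorname{sign}(\hat\theta-\theta)\,w(\theta)^{1/2}$. Median bias corrected directed likelihood: $r(b(\theta))=\operatorname{sign}(\hat\theta-b(\theta))\,w(b(\theta))^{1/2}$. Modified directed likelihood: $$r^*(\theta)=r(\theta)-\frac{1}{r(\theta)}\log\frac{r(\theta)}{u(\theta)},\qquad u(\theta)=\hat j^{-1/2}\{\hat\ell_{;1}-\ell_{;1}(\theta)\},$$ where $\ell_{;1}(\theta)=\partial\ell(\theta;\hat\theta)/\partial\hat\theta$ is the derivative of the log-likelihood with respect to its second argument, $\hat\ell_{;1}$ is $\ell_{;1}(\theta)$ evaluated at $\theta=\hat\theta$ after differentiation, and $\hat j$ is the observed information $-\partial^2\ell(\theta;\hat\theta)/\partial\theta^2$ evaluated at $\theta=\hat\theta$ after differentiation.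
   Formalization: ''Continuous'' is taken to mean that the sufficient statistic t(X_1), not only X_1, has an absolutely continuous distribution; for singular, nearly lattice laws of t(X_1) the O_p(1/n) claim can fail along a subsequence of sample sizes. *)

(* Defs.v *)
From HB Require Import structures.
From mathcomp Require Import all_boot all_order all_algebra.
From mathcomp Require Import all_classical all_reals all_analysis.

Set Implicit Arguments.
Unset Strict Implicit.
Unset Printing Implicit Defensive.

Import Order.TTheory GRing.Theory Num.Theory.
Import numFieldNormedType.Exports.

Local Open Scope classical_set_scope.
Local Open Scope ring_scope.

(* The densities are exp(e * stat x - psibar e - logbase x) with respect to
   Lebesgue measure on the sample space [support], and 0 outside of it (which
   corresponds to logbase = +oo). The values of [stat] and [logbase] outside
   [support] are irrelevant. *)
Record expfam (R : realType) := ExpFam {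
  support : set R ;
  stat : R -> R ;
  logbase : R -> R ;
  measurable_support : measurable support ;
  measurable_stat : measurable_fun setT stat ;
  measurable_logbase : measurable_fun setT logbase }.

Section model.
Context {R : realType} (F : expfam R).
Implicit Types (n : nat) (e th y : R).

Definition laplace e : \bar R :=
  (\int[lebesgue_measure]_(x in support F)
     (expR (e * stat F x - logbase F x))%:E)%E.

Definition nat_space : set R := [set e | (laplace e < +oo)%E].

(* the only choice for which the density below integrates to 1 *)
Definition psibar e : R := ln (fine (laplace e)).

Definition density e (x : R) : R :=
  \1_(support F) x * expR (e * stat F x - psibar e - logbase F x).

(* th = psi'(eta) = psibar'(eta / n), so that this does not depend on n *)
Definition mean_space : set R := derive1 psibar @` nat_space.

(* The family is full with open natural parameter space. *)
Definition regular : Prop := open nat_space.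

(* The statistic [stat] maps the family to continuous distributions: as the
   densities are positive exactly on [support], this says that the law of
   stat(X_1), for one (equivalently, every) member of the family, is absolutely
   continuous with respect to Lebesgue measure. In particular [stat] is not
   almost everywhere constant. *)
Definition continuous_family : Prop :=
  forall A : set R, measurable A -> lebesgue_measure A = 0%E ->
    lebesgue_measure (support F `&` stat F @^-1` A) = 0%E.

Definition psi n (eta : R) : R := n%:R * psibar (eta / n%:R).

(* The canonical parameter of the sample is n times that of one observation,
   whence the domain condition. *)
Definition eta_of n th : R :=
  xget 0 [set eta | nat_space (eta / n%:R) /\ derive1 (psi n) eta = th].

Definition sigma n th : R := Num.sqrt (derive1n 2 (psi n) (eta_of n th)).

Definition loglik n th y : R := eta_of n th * y - psi n (eta_of n th).

Definition lr n th y : R := 2 * (loglik n y y - loglik n th y).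

Definition r n th y : R := Num.sg (y - th) * Num.sqrt (lr n th y).

Definition obs_info n y : R := - derive1n 2 (fun th => loglik n th y) y.

(* the sample space derivative; [loglik_1 n y y] is its value at th = y, taken
   after the differentiation *)
Definition loglik_1 n th y : R := derive1 (loglik n th) y.

Definition u n th y : R :=
  (Num.sqrt (obs_info n y))^-1 * (loglik_1 n y y - loglik_1 n th y).

(* At y = th (a null event) the formula takes the value of the conventions
   0^-1 = 0 and ln 0 = 0. *)
Definition rstar n th y : R :=
  r n th y - (r n th y)^-1 * ln (r n th y / u n th y).

End model.

Section sampling.
Context {R : realType} {d : measure_display} {Omega : measurableType d}.
Implicit Types (P : probability Omega R) (X : nat -> {mfun Omega >-> R}).

Definition has_density P (Y : Omega -> R) (f : R -> R) : Prop :=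
  forall A : set R, measurable A ->
    P (Y @^-1` A) = (\int[lebesgue_measure]_(x in A) (f x)%:E)%E.

(* The product rule on initial segments suffices, since A i may be setT. *)
Definition independent P X : Prop :=
  forall (n : nat) (A : nat -> set R), (forall i, measurable (A i)) ->
    P (\bigcap_(i < n) (X i @^-1` A i)) = (\prod_(i < n) P (X i @^-1` A i))%E.

Definition iid_density P X (f : R -> R) : Prop :=
  independent P X /\ forall i, has_density P (X i) f.

(* Z_n = O_p(a_n). The exceptional events are covered by measurable ones, which
   makes sense for arbitrary Z; when the Z n are measurable this is
   P (`|Z_n| > M * a_n) <= eps. *)
Definition Op P (Z : nat -> Omega -> R) (a : nat -> R) : Prop :=
  forall eps : R, 0 < eps -> exists M : R,
    \forall n \near \oo, exists E : set Omega,
      [/\ measurable E, (P E <= eps%:E)%E &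
          [set w | M * a n < `|Z n w|] `<=` E].

(* the observed value y of the sufficient statistic for X_0, ..., X_(n-1), which
   is the maximum likelihood estimator of the mean value parameter *)
Definition thetahat (F : expfam R) X n (w : Omega) : R :=
  (\sum_(i < n) stat F (X i w)) / n%:R.

Definition G (F : expfam R) (P : R -> probability Omega R) X n (y th : R) : R :=
  fine (P th [set w | thetahat F X n w <= y]).

End sampling.

(* Main.v *)
(* Write K = psibar, let e0 be the canonical parameter of th, v the second and kap
   the third derivative of K at e0. The median of the centred sum
   S_n = n (thetahat - th) is - kap / (6 v) + O(n^(-1/2)): Fourier inversion smoothed
   by Fejer kernels expresses P(S_n > m) - P(S_n < m) through an integral of
   E sin(s (S_n - m)) / s, where frequencies bounded away from 0 are negligible by
   Cramer's condition (the law of the statistic is absolutely continuous), while the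
   low ones contribute - (m + kap / (6 v)) times a Gaussian integral of order
   n^(-1/2), up to O(1/n). Hence the canonical parameter of b(th) is
   e0 - kap / (6 v^2 n) + O(n^(-3/2)).

   If h is the canonical parameter of thetahat and Q(h, b) is twice the
   Kullback-Leibler divergence between h and b over (h - b)^2, then
   r = sqrt n (h - b) sqrt (Q(h, b)) and u = sqrt n (h - e0) sqrt (K''(h)).
   Replacing e0 by the parameter of b(th) adds kap / (6 v^(3/2) sqrt n) + O(1/n)
   to r, and so does - log(r / u) / r = - log(Q(h, e0) / K''(h)) / (2 r). *)
Require Import Defs.
From HB Require Import structures.
From mathcomp Require Import all_boot all_order all_algebra.
From mathcomp Require Import all_classical all_reals all_analysis.
From mathcomp Require Import measurable_realfun ring lra.

Import Order.TTheory GRing.Theory Num.Theory.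
Import numFieldNormedType.Exports.

Set Implicit Arguments.
Unset Strict Implicit.
Unset Printing Implicit Defensive.

Local Open Scope classical_set_scope.
Local Open Scope ring_scope.

(** * Taylor bounds *)

Section calculus.
Context {R : realType}.
Implicit Types (f g F df : R -> R) (x r B M a b t : R) (k : nat).

(** Absolute continuity of the law of the statistic does not make its characteristic function
    integrable, nor any power of it, so unsmoothed inversion is out of reach. Cutting the
    frequencies at n^2 makes the integral finite, and the range from a fixed delta to n^2 then costs
    only O(n^2 q^n) with q < 1. No expansion of the whole distribution function is required:
    comparing P(S_n > m) with P(S_n < m) up to O(1/n) is enough, because the coefficient of m + kap
    / (6 v) has size n^(-1/2), and a sign argument at trial points then locates the median up to
    O(n^(-1/2)).

    On the statistical side randomness enters only through the event that thetahat is within a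
    multiple of the standard error of th, and through the null event thetahat = th. Apart from these
    the claim is a deterministic expansion, uniform in h at distance O(n^(-1/2)) from e0. The
    calculus of orders is therefore carried out over sets of pairs (n, h). *)

Lemma is_derive_continuous f a x : is_derive x 1 f a -> {for x, continuous f}.
Proof.
by move=> [dfx _]; apply/differentiable_continuous/derivable1_diffP.
Qed.

Lemma mvt_norm_bound f df r M a b :
  (forall t, `|t| <= r -> is_derive t 1 f (df t)) ->
  (forall t, `|t| <= r -> `|df t| <= M) ->
  `|a| <= r -> `|b| <= r -> `|f b - f a| <= M * `|b - a|.
Proof.
move=> fd Mdf; wlog ab : a b / a <= b => [wl ar br|].
  have [/wl|/ltW/wl] := leP a b; first exact.
  by rewrite distrC [X in _ * X]distrC; exact.
move=> + +; rewrite 2![`|_| <= r]ler_norml => /andP[ra ar] /andP[rb br].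
have abr t : t \in `[a, b] -> `|t| <= r.
  by rewrite in_itv/= ler_norml => /andP[? ?]; apply/andP; split; lra.
have [||c cab ->] := @MVT_segment R f df a b ab.
- by move=> t tab; apply/fd/abr/subset_itv_oo_cc.
- apply: derivable_within_continuous => t tab.
  by have [] := fd t (abr _ tab).
rewrite normrM ler_wpM2r// Mdf//; exact: abr.
Qed.

(** The mean value inequality on the ball of radius [|t|] supplies the extra factor [|t|]. The
    factor 1 / (k + 1) of an exact integration is given up, so that [B] is unchanged and the lemma
    can be iterated down from the highest derivative. *)
Lemma taylor_step f df r B k :
  (forall t, `|t| <= r -> is_derive t 1 f (df t)) -> f 0 = 0 ->
  (forall t, `|t| <= r -> `|df t| <= B * `|t| ^+ k) ->
  forall t, `|t| <= r -> `|f t| <= B * `|t| ^+ k.+1.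
Proof.
move=> fd f0 Bdf t tr.
have := @mvt_norm_bound f df `|t| (B * `|t| ^+ k) 0 t.
rewrite f0 !subr0 -mulrA -exprSr; apply => //.
- by move=> s st; apply: fd; exact: le_trans tr.
- move=> s st; apply: le_trans (Bdf _ (le_trans st tr)) _.
  have B0 : 0 <= B * `|t| ^+ k by apply: le_trans (Bdf t tr).
  have [t0|t0] := eqVneq t 0.
    by move: st; rewrite t0 normr0 normr_le0 => /eqP ->; rewrite normr0.
  rewrite ler_wpM2l//; last by rewrite lerXn2r// nnegrE.
  by move: B0; rewrite pmulr_lge0// exprn_gt0// normr_gt0.
- by rewrite normr0.
Qed.

Lemma taylor_stepT f df k :
  (forall t, is_derive t 1 f (df t)) -> f 0 = 0 ->
  (forall t, `|df t| <= `|t| ^+ k) -> forall t, `|f t| <= `|t| ^+ k.+1.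
Proof.
move=> fd f0 Bdf t.
have := @taylor_step f df `|t| 1 k _ f0 _ t (lexx _).
by rewrite mul1r; apply => s _; rewrite ?mul1r.
Qed.

Lemma norm_sin_le (t : R) : `|sin t| <= `|t|.
Proof.
apply: (@taylor_stepT sin cos 0); rewrite ?sin0//.
by move=> s; rewrite expr0 ler_norml cos_geN1 cos_le1.
Qed.

Lemma norm_cosB1_le (t : R) : `|cos t - 1| <= t ^+ 2.
Proof.
rewrite -normr_id -real_normK ?num_real// normr_id.
apply: (@taylor_stepT (fun t => cos t - 1) (fun t => - sin t) 1).
- by move=> s; apply: is_derive_eq; rewrite subr0.
- by rewrite /= cos0 subrr.
- by move=> s; rewrite normrN expr1 norm_sin_le.
Qed.

Lemma norm_sinBid_le (t : R) : `|sin t - t| <= `|t| ^+ 3.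
Proof.
apply: (@taylor_stepT (fun t => sin t - t) (fun t => cos t - 1) 2).
- by rewrite /= sin0 subrr.
- by move=> s; rewrite real_normK ?num_real// norm_cosB1_le.
Qed.

Lemma norm_cos_taylor2_le (t : R) : `|cos t - 1 + t ^+ 2 / 2| <= t ^+ 4.
Proof.
have -> : t ^+ 4 = `|t| ^+ 4.
  by rewrite (exprM _ 2 2) [in RHS](exprM _ 2 2) real_normK ?num_real.
apply: (@taylor_stepT (fun t => cos t - 1 + t ^+ 2 / 2) (fun t => t - sin t) 3).
- move=> s; apply: is_derive_eq.
  by rewrite !scaler0 subr0 add0r /GRing.scale/=; field.
- by rewrite /= cos0 expr0n/=; ring.
- by move=> s; rewrite distrC norm_sinBid_le.
Qed.

(** The chain of derivatives ends at [- sin], bounded by 1 instead of [|t|]. The exponent is then 4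
    and not 5, so that a fourth moment controls the expectation of the remainder. *)
Lemma norm_sin_taylor3_le (t : R) : `|sin t - t + t ^+ 3 / 6| <= t ^+ 4.
Proof.
have -> : t ^+ 4 = `|t| ^+ 4.
  by rewrite (exprM _ 2 2) [in RHS](exprM _ 2 2) real_normK ?num_real.
apply: (@taylor_stepT (fun t => sin t - t + t ^+ 3 / 6)
                      (fun t => cos t - 1 + t ^+ 2 / 2) 3).
- by move=> s; apply: is_derive_eq; rewrite !scaler0 add0r /GRing.scale/=; field.
- by rewrite sin0 expr0n/=; ring.
apply: (@taylor_stepT _ (fun t => t - sin t)).
- move=> s; apply: is_derive_eq.
  by rewrite !scaler0 subr0 add0r /GRing.scale/=; field.
- by rewrite /= cos0 expr0n/=; ring.
move=> s; rewrite distrC; move: s.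
apply: (@taylor_stepT _ (fun t => cos t - 1)).
- by rewrite /= sin0 subrr.
apply: (@taylor_stepT _ (fun t => - sin t)).
- by move=> s; apply: is_derive_eq; rewrite subr0.
- by rewrite /= cos0 subrr.
by move=> s; rewrite normrN expr0 ler_norml sin_geN1 sin_le1.
Qed.

Lemma norm_expR_taylor1_le (t : R) : `|t| <= 1 ->
  `|expR t - 1 - t| <= expR 1 * t ^+ 2.
Proof.
move=> t1; have -> : t ^+ 2 = `|t| ^+ 2 by rewrite real_normK ?num_real.
have e3 (s : R) : `|s| <= 1 -> `|expR s| <= expR 1 * `|s| ^+ 0.
  move=> /ler_normlP[_ s1]; rewrite expr0 mulr1 ger0_norm ?expR_ge0//.
  by rewrite ler_expR.
apply: (@taylor_step (fun t => expR t - 1 - t) (fun t => expR t - 1) 1) t1.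
- by move=> s _; apply: is_derive_eq; rewrite ?subr0.
- by rewrite /= expR0 subrr subr0.
apply: (@taylor_step (fun t => expR t - 1) expR 1).
- by move=> s _; apply: is_derive_eq; rewrite ?subr0.
- by rewrite /= expR0 subrr.
- exact: e3.
Qed.

Notation mu := lebesgue_measure.

Lemma integrable_itv_oc f a b : continuous f ->
  mu.-integrable `]a, b] (EFin \o f).
Proof.
move=> cf; have cI : mu.-integrable `[a, b] (EFin \o f).
  apply: continuous_compact_integrable; first exact: segment_compact.
  exact: continuous_subspaceT.
apply: integrableS cI => //; exact: subset_itv_oc_cc.
Qed.

Lemma Rintegral_FTC F f a b : a < b ->
  (forall x, is_derive x 1 F (f x)) -> continuous f ->
  \int[mu]_(x in `]a, b]) f x = F b - F a.
Proof.
move=> ab Ff cf; rewrite Rintegral_itv_obnd_cbnd; last exact: integrable_itv_oc.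
have cF x : {for x, continuous F} by exact: is_derive_continuous (Ff x).
rewrite /Rintegral (@continuous_FTC2 _ f F)//.
- exact: continuous_subspaceT.
- split.
  + by move=> x _; have [] := Ff x.
  + by apply: cvg_at_right_filter; exact: cF.
  + by apply: cvg_at_left_filter; exact: cF.
- by move=> x _; rewrite derive1E; exact: derive_val.
Qed.

End calculus.

(** * Sums of independent variables *)

Section expectation.
Context {R : realType} {d : measure_display} {T : measurableType d}.
Variable P : probability T R.
Implicit Types (f g : T -> R) (M : R).

Lemma bounded_integrable f M : measurable_fun setT f ->
  (forall w, `|f w| <= M) -> P.-integrable setT (EFin \o f).
Proof.
move=> mf fM; apply: measurable_bounded_integrable => //.
- by rewrite -ge0_fin_numE// fin_num_measure.
exists M; split; first exact: num_real.
by move=> x Mx w _; apply: (le_trans (fM w)); exact: ltW.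
Qed.

Lemma le_norm_expectation f g : P.-integrable setT (EFin \o f) ->
  P.-integrable setT (EFin \o g) -> (forall w, `|f w| <= g w) ->
  `|\int[P]_w f w| <= \int[P]_w g w.
Proof.
move=> fi gi fg; apply: (le_trans (le_normr_Rintegral _ fi)) => //.
apply: le_Rintegral => //; exact: integrable_norm.
Qed.

Lemma expectation_cst M : \int[P]_w M = M.
Proof.
rewrite Rintegral_cst// -[RHS]mulr1; congr (_ * _).
exact: (congr1 fine (probability_setT P)).
Qed.

Lemma integrable_cst_prob M : P.-integrable setT (EFin \o cst M).
Proof. exact: (@bounded_integrable _ `|M|). Qed.

Lemma norm_expectation_le f M : measurable_fun setT f ->
  (forall w, `|f w| <= M) -> `|\int[P]_w f w| <= M.
Proof.
move=> mf fM; rewrite -[leRHS]expectation_cst; apply: le_norm_expectation => //.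
- exact: bounded_integrable fM.
- exact: integrable_cst_prob.
Qed.

Lemma integrable_realD f g : P.-integrable setT (EFin \o f) ->
  P.-integrable setT (EFin \o g) ->
  P.-integrable setT (EFin \o (fun w => f w + g w)).
Proof. by move=> fi gi; exact: (integrableD measurableT fi gi). Qed.

Lemma integrable_realZ f M : P.-integrable setT (EFin \o f) ->
  P.-integrable setT (EFin \o (fun w => M * f w)).
Proof. by move=> fi; exact: (integrableZl measurableT M fi). Qed.

Lemma integrable_realB f g : P.-integrable setT (EFin \o f) ->
  P.-integrable setT (EFin \o g) ->
  P.-integrable setT (EFin \o (fun w => f w - g w)).
Proof. by move=> fi gi; exact: (integrableB measurableT fi gi). Qed.

End expectation.

Section independent_pair.
Context {R : realType} {d : measure_display} {T : measurableType d}.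
Context {d1 d2 : measure_display} {T1 : measurableType d1}.
Context {T2 : measurableType d2}.
Variables (P : probability T R) (U : {mfun T >-> T1}) (V : {mfun T >-> T2}).
Hypothesis UV : forall C D, measurable C -> measurable D ->
  P (U @^-1` C `&` V @^-1` D) = (P (U @^-1` C) * P (V @^-1` D))%E.

Let UVm : measurable_fun setT (fun w => (U w, V w)).
Proof. exact: measurable_fun_pair. Qed.

Lemma product_distribution Z : measurable Z ->
  (distribution P U \x distribution P V)%E Z =
  P ((fun w => (U w, V w)) @^-1` Z).
Proof.
move=> mZ; pose m' := pushforward P (fun w => (U w, V w)).
by rewrite (@product_measure_unique _ _ _ _ _ _ _ m').
Qed.

(** The joint law is the product of the two laws by [product_distribution]; Fubini then integrates
    out one variable. *)
Lemma expectation_prod (f : T1 -> R) (g : T2 -> R) (M : R) :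
  measurable_fun setT f -> measurable_fun setT g ->
  (forall x, `|f x| <= M) -> (forall x, `|g x| <= M) ->
  \int[P]_w (f (U w) * g (V w)) = (\int[P]_w f (U w)) * (\int[P]_w g (V w)).
Proof.
move=> mf mg fM gM.
have M0 : 0 <= M by apply: le_trans (fM (U point)).
pose k (z : T1 * T2) : R := f z.1 * g z.2.
have mk : measurable_fun setT k.
  apply: measurable_funM.
    by apply: measurableT_comp => //; exact: measurable_fst.
  by apply: measurableT_comp => //; exact: measurable_snd.
pose h := EFin \o k.
have mh : measurable_fun setT h by exact/measurable_EFinP.
have hM z : `|f z.1 * g z.2| <= M * M.
  by rewrite normrM ler_pM.
have mfU : measurable_fun setT (f \o U) by exact: measurableT_comp.
have mgV : measurable_fun setT (g \o V) by exact: measurableT_comp.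
have fUi := bounded_integrable P mfU (fun w => fM (U w)).
have gVi := bounded_integrable P mgV (fun w => gM (V w)).
have hi : P.-integrable setT (h \o (fun w => (U w, V w))).
  apply: (@bounded_integrable _ _ _ _ _ (M * M)); last by move=> w; exact: hM.
  exact: measurable_funM.
have hi' : (distribution P U \x distribution P V)%E.-integrable setT h.
  apply: measurable_bounded_integrable => //.
  - rewrite [X in (X < _)%E](_ : _ = 1%E) ?ltry//.
    rewrite -(probability_setT P) -[in RHS](preimage_setT (fun w => (U w, V w))).
    exact: product_distribution.
  - exists (M * M); split; first exact: num_real.
    by move=> x Mx z _; apply: (le_trans (hM z)); exact: ltW.
have -> : \int[P]_w (f (U w) * g (V w)) =
    fine (\int[P]_w (h \o (fun w => (U w, V w))) w)%E by [].
rewrite -(integral_pushforward UVm mh hi measurableT).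
have -> : (\int[pushforward P (fun w => (U w, V w))]_z h z =
           \int[distribution P U \x distribution P V]_z h z)%E.
  by apply: eq_measure_integral => Z mZ _; exact/esym/product_distribution.
rewrite -integral12_prod_meas1//.
have -> : fubini_F (distribution P V) h =
    fun x => ((f x)%:E * (\int[P]_w g (V w))%:E)%E.
  apply/funext => x; rewrite /fubini_F /h/=.
  under eq_integral do rewrite EFinM.
  have giD : (distribution P V).-integrable setT (EFin \o g).
    apply: (@bounded_integrable _ _ _ _ _ M) => //.
  transitivity ((f x)%:E * \int[distribution P V]_y (g y)%:E)%E.
    exact: (integralZl measurableT giD (f x)).
  congr (_ * _)%E.
  rewrite (@integral_distribution _ _ _ _ _ P V (EFin \o g))//; last exact/measurable_EFinP.
  by rewrite /Rintegral fineK//; apply: integrable_fin_num.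
have fiD : (distribution P U).-integrable setT (EFin \o f).
  exact: (@bounded_integrable _ _ _ _ _ M).
transitivity (fine (\int[distribution P U]_x (f x)%:E *
                    (\int[P]_w g (V w))%:E)%E).
  by congr fine; exact: (integralZr measurableT fiD (\int[P]_w g (V w))).
rewrite fineM//; last by apply: integrable_fin_num.
by rewrite (@integral_distribution _ _ _ _ _ P U (EFin \o f))//; exact/measurable_EFinP.
Qed.

End independent_pair.

Section partial_sums.
Context {R : realType} {d : measure_display} {Omega : measurableType d}.
Variables (P : probability Omega R) (X : nat -> {mfun Omega >-> R}).
Hypothesis indep : independent P X.
Variable g : R -> R.
Hypothesis mg : measurable_fun setT g.

Definition partial_sum (k : nat) (w : Omega) : R := \sum_(i < k) g (X i w).
Local Notation S := partial_sum.

Lemma measurable_partial_sum k : measurable_fun setT (S k).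
Proof. by apply: measurable_sum => i; exact: measurableT_comp. Qed.

Let future k m (B : nat -> set R) := \bigcap_(i < m) X (k + i)%N @^-1` B i.

Let measurable_future k m B : (forall i, measurable (B i)) ->
  measurable (future k m B).
Proof. by move=> mB; apply: bigcap_measurableType => i _; exact: measurable_funPTI. Qed.

Let futureS k m D B :
  future k m.+1 (fun i => if i is j.+1 then B j else D) =
  X k @^-1` D `&` future k.+1 m B.
Proof.
apply/seteqP; split=> w.
- move=> h; split; first by have := h 0%N isT; rewrite addn0.
  by move=> i /= im; have := h i.+1 im; rewrite addnS addSn.
- move=> [h0 h] [_|i im]; first by rewrite addn0.
  by have := h i im; rewrite addnS addSn.
Qed.

(** The hypothesis [independent] speaks of the single variables only. The induction on [k] turns one
    future variable at a time into a summand, and this is why an event about later variables has to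
    be carried along: the case [m.+1] for [k] provides independence of the sum, of [X k] and of the
    remaining future. *)
Lemma independent_partial_sum k m A (B : nat -> set R) :
  measurable A -> (forall i, measurable (B i)) ->
  P (S k @^-1` A `&` \bigcap_(i < m) X (k + i)%N @^-1` B i) =
  (P (S k @^-1` A) * \prod_(i < m) P (X (k + i)%N @^-1` B i))%E.
Proof.
elim: k m A B => [|k IH] m A B mA mB.
  have -> : S 0 = cst 0 by apply/funext => w; rewrite /S big_ord0.
  rewrite preimage_cst; case: ifPn => _.
    by rewrite setTI indep// probability_setT mul1e.
  by rewrite set0I measure0 mul0e.
have mE := measurable_future k.+1 m mB.
set E := future k.+1 m B in mE.
set p := (X in (_ * X)%E).
have key C D : measurable C -> measurable D ->
    P (S k @^-1` C `&` X k @^-1` D `&` E) =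
    (P (S k @^-1` C) * P (X k @^-1` D) * p)%E.
  move=> mC mD; pose B' i := if i is j.+1 then B j else D.
  have mB' i : measurable (B' i) by case: i.
  have := IH m.+1 C B' mC mB'.
  rewrite -/(future k m.+1 B') futureS setIA => ->.
  rewrite big_ord_recl/= addn0 muleA; congr (_ * _)%E.
  by apply: eq_bigr => i _; rewrite /bump/= add1n addnS addSn.
have pE : P E = p.
  have := key setT setT measurableT measurableT.
  by rewrite !preimage_setT !setTI probability_setT !mul1e.
have pfin : p \is a fin_num by rewrite -pE fin_num_measure.
have UV C D : measurable C -> measurable D ->
    P (S k @^-1` C `&` X k @^-1` D) = (P (S k @^-1` C) * P (X k @^-1` D))%E.
  move=> mC mD; have := IH 1%N C (fun=> D) mC (fun=> mD).
  rewrite big_ord1/= addn0 => <-; congr (P (_ `&` _)).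
  apply/seteqP; split=> w.
    by move=> Dw [|//] _; rewrite addn0.
  by move=> /(_ 0%N isT); rewrite addn0.
pose U : {mfun Omega >-> R} := mfun_Sub (mem_set (measurable_partial_sum k)).
pose f w := (U w, X k w).
have mf : measurable_fun setT f by exact: measurable_fun_pair.
pose Z : set (R * R) := [set z | A (z.1 + g z.2)].
have mZ : measurable Z.
  rewrite -[X in measurable X]setTI.
  have : measurable_fun setT (fun z : R * R => z.1 + g z.2).
    apply: measurable_funD; first exact: measurable_fst.
    by apply: measurableT_comp => //; exact: measurable_snd.
  exact.
have fZ : S k.+1 @^-1` A = f @^-1` Z.
  by apply/funext => w; rewrite /preimage/= /partial_sum big_ord_recr.
have PZ : (distribution P U \x distribution P (X k))%E Z = P (f @^-1` Z).
  exact: (@product_distribution _ _ _ _ _ _ _ P U (X k) UV).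
rewrite -/E fZ -PZ.
(* If the future event is null, both sides vanish; otherwise one can divide by its probability. *)
have [p0|p0] := eqVneq p 0%E.
  rewrite p0 mule0; apply/eqP; rewrite eq_le measure_ge0 andbT -p0 -pE.
  apply: le_measure; rewrite ?inE//.
  by apply: measurableI => //; rewrite -[X in measurable X]setTI; exact: mf.
have [q pq] : exists q, p = q%:E by exists (fine p); rewrite fineK.
have q0 : q != 0 by move: p0; rewrite pq.
have fp0 : 0 <= q^-1 by rewrite invr_ge0 -lee_fin -pq -pE.
(* The law of the pair ([S k], [X k]) conditioned on [E]. By [key] it agrees on rectangles with the
   product of the unconditional laws, hence also on [Z]. *)
pose m' := mscale (NngNum fp0) (pushforward (mrestr P mE) f).
have -> : (distribution P U \x distribution P (X k))%E Z = m' mf Z.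
  apply: product_measure_unique => // C D mC mD.
  transitivity (q^-1%:E * P (S k @^-1` C `&` X k @^-1` D `&` E))%E => //.
  by rewrite key// pq muleCA -EFinM mulVf// mule1.
have -> : m' mf Z = (q^-1%:E * P (f @^-1` Z `&` E))%E by [].
by rewrite pq muleC muleA -EFinM mulfV// mul1e.
Qed.

Hypothesis ident : forall i A, measurable A ->
  P (X i @^-1` A) = P (X 0%N @^-1` A).

Lemma expectation_ident (f : R -> R) M i : measurable_fun setT f ->
  (forall x, `|f x| <= M) -> \int[P]_w f (X i w) = \int[P]_w f (X 0%N w).
Proof.
move=> mf fM; have fi j : P.-integrable setT (EFin \o f \o X j).
  by apply: (@bounded_integrable _ _ _ _ (f \o X j) M) => [|w]; [exact: measurableT_comp|exact: fM].
have mf' : measurable_fun setT (EFin \o f) by exact/measurable_EFinP.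
rewrite /Rintegral; congr fine.
transitivity (\int[distribution P (X i)]_x (EFin \o f) x)%E.
  by rewrite integral_distribution.
transitivity (\int[distribution P (X 0%N)]_x (EFin \o f) x)%E.
  by apply: eq_measure_integral => A mA _; exact: ident.
by rewrite integral_distribution.
Qed.

Definition Ecos n : R := \int[P]_w cos (S n w).
Definition Esin n : R := \int[P]_w sin (S n w).
Let c : R := \int[P]_w cos (g (X 0%N w)).
Let s : R := \int[P]_w sin (g (X 0%N w)).

Lemma measurable_sin_cos :
  measurable_fun setT (@sin R) * measurable_fun setT (@cos R).
Proof.
by split; apply: continuous_measurable_fun;
  [exact: continuous_sin|exact: continuous_cos].
Qed.

Lemma norm_sin_cos_le1 (x : R) : (`|sin x| <= 1) * (`|cos x| <= 1).
Proof.
by rewrite !ler_norml sin_geN1 sin_le1 cos_geN1 cos_le1.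
Qed.

(** Multiplication by the complex number [c] + i [s], split into real and imaginary parts: this is
    the multiplicativity of characteristic functions, obtained from the addition formulas and the
    independence of [S n] and [X n]. *)
Lemma EcosS_EsinS n :
  (Ecos n.+1 = Ecos n * c - Esin n * s) * (Esin n.+1 = Esin n * c + Ecos n * s).
Proof.
pose U : {mfun Omega >-> R} := mfun_Sub (mem_set (measurable_partial_sum n)).
have UV C D : measurable C -> measurable D ->
    P (U @^-1` C `&` X n @^-1` D) = (P (U @^-1` C) * P (X n @^-1` D))%E.
  move=> mC mD; have := @independent_partial_sum n 1%N C (fun=> D) mC (fun=> mD).
  rewrite big_ord1/= addn0 => <-; congr (P (_ `&` _)).
  apply/seteqP; split=> w.
    by move=> Dw [|//] _; rewrite addn0.
  by move=> /(_ 0%N isT); rewrite addn0.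
have [ms mc] := measurable_sin_cos.
have mgs : measurable_fun setT (sin \o g) by exact: measurableT_comp.
have mgc : measurable_fun setT (cos \o g) by exact: measurableT_comp.
have b1 := norm_sin_cos_le1.
have prod (f h : R -> R) : measurable_fun setT f -> measurable_fun setT h ->
    (forall x, `|f x| <= 1) -> (forall x, `|h x| <= 1) ->
    (\int[P]_w (f (S n w) * h (X n w)) =
     (\int[P]_w f (S n w)) * (\int[P]_w h (X 0%N w))) *
    P.-integrable setT (EFin \o (fun w => f (S n w) * h (X n w))).
  move=> mf mh f1 h1; split.
    by rewrite (expectation_prod UV mf mh f1 h1) (expectation_ident n mh h1).
  apply: (@bounded_integrable _ _ _ _ _ 1).
    apply: measurable_funM; apply: measurableT_comp => //.
    exact: measurable_partial_sum.
  by move=> w; rewrite normrM -[leRHS]mulr1 ler_pM.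
split.
- have -> : Ecos n.+1 =
      \int[P]_w (cos (S n w) * (cos \o g) (X n w) - sin (S n w) * (sin \o g) (X n w)).
    by apply: eq_Rintegral => w _; rewrite /S big_ord_recr/= cosD.
  by rewrite RintegralB// ?prod//= => x; rewrite b1.
- have -> : Esin n.+1 =
      \int[P]_w (sin (S n w) * (cos \o g) (X n w) + cos (S n w) * (sin \o g) (X n w)).
    by apply: eq_Rintegral => w _; rewrite /S big_ord_recr/= sinD.
  by rewrite RintegralD// ?prod//= => x; rewrite b1.
Qed.

Lemma Ecos0 : Ecos 0 = 1.
Proof.
rewrite /Ecos -[RHS](expectation_cst P); apply: eq_Rintegral => w _.
by rewrite /S big_ord0 cos0.
Qed.

Lemma Esin0 : Esin 0 = 0.
Proof.
rewrite /Esin -[RHS](expectation_cst P); apply: eq_Rintegral => w _.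
by rewrite /S big_ord0 sin0.
Qed.

Lemma sqr_Ecos_Esin n : Ecos n ^+ 2 + Esin n ^+ 2 = (c ^+ 2 + s ^+ 2) ^+ n.
Proof.
elim: n => [|n IH]; first by rewrite Ecos0 Esin0 !expr0 expr1n expr0n addr0.
by rewrite [RHS]exprS -IH !EcosS_EsinS; ring.
Qed.

Lemma norm_Ecos_Esin_le q n : 0 <= q -> c ^+ 2 + s ^+ 2 <= q ^+ 2 ->
  (`|Ecos n| <= q ^+ n) * (`|Esin n| <= q ^+ n).
Proof.
move=> q0 cs; have h : Ecos n ^+ 2 + Esin n ^+ 2 <= (q ^+ n) ^+ 2.
  rewrite sqr_Ecos_Esin -exprM mulnC exprM lerXn2r// nnegrE//.
    by rewrite addr_ge0// sqr_ge0.
  by rewrite sqr_ge0.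
have qn : 0 <= q ^+ n by exact: exprn_ge0.
have abs (x : R) : x ^+ 2 <= (q ^+ n) ^+ 2 -> `|x| <= q ^+ n.
  by move=> xq; rewrite -(@ler_pXn2r _ 2%N)// ?nnegrE// real_normK ?num_real.
by split; apply: abs; apply: le_trans h; rewrite ?lerDl ?lerDr sqr_ge0.
Qed.

(** With z = [c] + i [s], the difference z^(n+1) - rho^(n+1) is z - rho times a sum of n + 1
    products of n factors, each of modulus at most [q]. The factor 2 comes from bounding real and
    imaginary parts separately. *)
Lemma Ecos_Esin_telescope q rho e n : 0 <= rho <= q -> 0 < q ->
  c ^+ 2 + s ^+ 2 <= q ^+ 2 -> `|c - rho| <= e -> `|s| <= e ->
  (`|Ecos n.+1 - rho ^+ n.+1| <= 2 * e * n.+1%:R * q ^+ n) *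
  (`|Esin n.+1| <= 2 * e * n.+1%:R * q ^+ n).
Proof.
move=> /andP[rho0 rhoq] q0 cs ce se.
have e0 : 0 <= e by apply: le_trans se.
have nb k := norm_Ecos_Esin_le k (ltW q0) cs.
(* The extra factor [q] replaces the exponent k - 1 by k, so that the induction can start at 0. *)
suff main k : (`|Ecos k - rho ^+ k| * q <= 2 * e * k%:R * q ^+ k) *
    (`|Esin k| * q <= 2 * e * k%:R * q ^+ k).
  by have [] := main n.+1; rewrite [q ^+ n.+1]exprSr mulrA !(@ler_pM2r _ q).
elim: k => [|k [IH1 IH2]].
  by rewrite Ecos0 Esin0 expr0 subrr normr0 mul0r mulr0 mul0r.
have [nb1 nb2] := nb k.
have step a b x y z : `|a| * q <= 2 * e * k%:R * q ^+ k -> `|b| <= q ^+ k ->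
    `|x| <= q ^+ k -> `|y| <= e -> `|z| <= e ->
    `|a * rho + b * y + x * z| * q <= 2 * e * k.+1%:R * q ^+ k.+1.
  move=> ha hb hx hy hz; rewrite [in leRHS]exprSr mulrA ler_wpM2r ?(ltW q0)//.
  apply: le_trans (ler_normD _ _) _; apply: le_trans (lerD (ler_normD _ _) (lexx _)) _.
  rewrite !normrM (ger0_norm rho0).
  have h1 : `|a| * rho <= 2 * e * k%:R * q ^+ k.
    by apply: le_trans ha; rewrite ler_wpM2l.
  have h2 : `|b| * `|y| <= q ^+ k * e by rewrite ler_pM.
  have h3 : `|x| * `|z| <= q ^+ k * e by rewrite ler_pM.
  rewrite -natr1; apply: le_trans (lerD (lerD h1 h2) h3) _.
  by rewrite le_eqVlt; apply/orP; left; apply/eqP; ring.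
split.
- rewrite EcosS_EsinS.
  have -> : Ecos k * c - Esin k * s - rho ^+ k.+1 =
    (Ecos k - rho ^+ k) * rho + Ecos k * (c - rho) + Esin k * - s.
    by rewrite exprSr; ring.
  by apply: step; rewrite ?normrN.
- rewrite EcosS_EsinS.
  have -> : Esin k * c + Ecos k * s =
    Esin k * rho + Esin k * (c - rho) + Ecos k * s by ring.
  exact: step.
Qed.

End partial_sums.

(** * Cramer's condition *)

Section cramer_condition.
Context {R : realType}.
Implicit Types (x y z s M alpha beta : R).

Lemma cos_ge_near_period z beta : 0 <= z -> 0 <= beta <= pi ->
  cos beta <= cos z ->
  exists k : nat, `|z - (pi *+ 2) * k%:R| <= beta /\ (pi *+ 2) * k%:R <= z + pi.
Proof.
move=> z0 /andP[b0 bpi] bz; have pi0 := pi_gt0 R.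
have tp0 : 0 < pi *+ 2 :> R by rewrite pmulrn_lgt0.
pose k := Num.truncn ((z + pi) / (pi *+ 2)).
have zpi0 : 0 <= (z + pi) / (pi *+ 2).
  by apply: divr_ge0; [exact: addr_ge0 (ltW _)|exact: ltW].
have /andP[k1 k2] := truncn_itv zpi0; rewrite -/k in k1 k2.
rewrite ler_pdivlMr // mulrC in k1.
rewrite ltr_pdivrMr // mulrC in k2.
exists k; split => //.
set y := z - _.
have zy : cos z = cos y.
  have -> : z = y + (pi *+ 2) *+ k by rewrite /y -(mulr_natr (pi *+ 2)) subrK.
  exact: (periodicn (@cosD2pi R)).
have ypi : `|y| <= pi.
  rewrite ler_norml /y; move: k1 k2; rewrite -natr1 mulrDr mulr1.
  rewrite !mulr2n => k1 k2.
  by apply/andP; split; lra.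
have yc : cos `|y| = cos y.
  by have [y0|y0] := leP 0 y; [rewrite ger0_norm//|rewrite ltr0_norm// cosN].
rewrite leNgt; apply/negP => yb.
have := @ltr_cos R; move=> /(_ beta `|y|); rewrite !in_itv/= normr_ge0 ypi b0 bpi.
by move=> /(_ isT isT); rewrite yb yc -zy ltNge bz.
Qed.

Notation mu := (@lebesgue_measure R).

(** The set is covered by intervals of length 2 beta / s around the maxima of the cosine, and at
    most s M + 5 of them are used. The total length is proportional to [beta], with a factor that
    stays bounded as s grows. *)
Lemma cos_superlevel_cover M s alpha beta : 0 <= M -> 0 < s -> `|alpha| <= pi ->
  0 < beta <= pi ->
  exists A : set R, [/\ measurable A,
    (forall x, `|x| <= M -> cos beta <= cos (s * x - alpha) -> A x) &
    (mu A <= (2 * beta * (M + 5 / s))%:E)%E].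
Proof.
move=> M0 s0 alpi /andP[b0 bpi]; have pi0 := pi_gt0 R.
have pi1 : 1 <= pi :> R by apply: le_trans (pi_ge2 R); lra.
have tp0 : 0 < pi *+ 2 :> R by rewrite pmulrn_lgt0.
(* Adding [K] periods makes s x - alpha nonnegative for |x| <= M, so that natural numbers can index
   the maxima; [J] = 2 K + 2 then exceeds every index that occurs. *)
pose K := (Num.truncn ((s * M + pi) / (pi *+ 2))).+1.
pose J := (K.*2.+2)%N.
have sMpi : 0 <= s * M + pi.
  by apply: addr_ge0; [apply: mulr_ge0 => //|]; exact: ltW.
have K1 : s * M + pi <= (pi *+ 2) * K%:R.
  rewrite [leRHS]mulrC -ler_pdivrMr//.
  exact/ltW/truncnS_gt.
have K2 : (pi *+ 2) * K%:R <= s * M + pi + pi *+ 2.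
  rewrite /K -natr1 mulrDr mulr1 lerD2r mulrC -ler_pdivlMr//.
  by rewrite truncn_le divr_ge0// ltW.
pose c (k : nat) := (alpha + (pi *+ 2) * k%:R - (pi *+ 2) * K%:R) / s.
pose I (k : nat) := `[c k - beta / s, c k + beta / s]%classic.
exists (\big[setU/set0]_(k < J) I k); split.
- by apply: bigsetU_measurable => k _; exact: measurable_itv.
- move=> x xM bx; pose z := s * x - alpha + (pi *+ 2) * K%:R.
  have sx : `|s * x| <= s * M by rewrite normrM gtr0_norm// ler_pM2l.
  move: sx alpi; rewrite !ler_norml => /andP[sx1 sx2] /andP[al1 al2].
  have z0 : 0 <= z by rewrite /z; lra.
  have cz : cos z = cos (s * x - alpha).
    by rewrite /z mulr_natr; exact: (periodicn (@cosD2pi R)).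
  have [||k [kz kle]] := @cos_ge_near_period z beta z0.
  + by rewrite (ltW b0).
  + by rewrite cz.
  have kJ : (k < J)%N.
    rewrite -(ltr_nat R) -(@ltr_pM2l _ (pi *+ 2))//.
    apply: (le_lt_trans kle); rewrite /z /J -addnn -2!natr1 natrD.
    by rewrite !mulrDr mulr1 mulr2n; rewrite mulr2n in K1 K2; lra.
  rewrite -bigcup_mkord; exists k => //=.
  rewrite /I/= in_itv/= /c; move: kz; rewrite ler_norml /z => /andP[kz1 kz2].
  rewrite -mulrBl -mulrDl ler_pdivrMr// ler_pdivlMr//.
  by apply/andP; split; lra.
- have := @Boole_inequality _ _ _ mu I J (fun k _ => measurable_itv _).
  move/le_trans; apply.
  have lI k : mu (I k) = (2 * beta / s)%:E.
    rewrite /I lebesgue_measure_itv/= lte_fin ltrD2l.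
    have bs : 0 < beta / s by rewrite divr_gt0.
    rewrite (_ : - (beta / s) < beta / s); last by lra.
    by rewrite -EFinB; congr EFin; ring.
  rewrite (eq_bigr (fun=> (2 * beta / s)%:E)); last by move=> k _; exact: lI.
  rewrite sumEFin lee_fin sumr_const card_ord -[_ *+ J]mulr_natr.
  have -> : 2 * beta * (M + 5 / s) = 2 * beta / s * (s * M + 5).
    by field; rewrite gt_eqF.
  have h0 : 0 <= 2 * beta / s.
    by apply: divr_ge0; [apply: mulr_ge0 => //|]; exact: ltW.
  rewrite ler_wpM2l//.
  have -> : J%:R = K%:R + K%:R + 2 :> R by rewrite /J -addn2 natrD -addnn natrD.
  have : 2 * K%:R <= s * M + 3.
    rewrite mulr2n in K2.
    have : 2 * K%:R * pi <= (s * M + 3) * pi.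
      have : s * M <= s * M * pi by rewrite ler_peMr// mulr_ge0// ltW.
      lra.
    by rewrite ler_pM2r.
  lra.
Qed.

Lemma polar_coordinates x y : exists alpha,
  [/\ `|alpha| <= pi, x = Num.sqrt (x ^+ 2 + y ^+ 2) * cos alpha &
      y = Num.sqrt (x ^+ 2 + y ^+ 2) * sin alpha].
Proof.
set rho := Num.sqrt _; have pi0 := pi_gt0 R.
have rho2 : rho ^+ 2 = x ^+ 2 + y ^+ 2.
  by rewrite sqr_sqrtr// addr_ge0 ?sqr_ge0.
have rho_ge0 : 0 <= rho by exact: sqrtr_ge0.
have [r0|r0] := eqVneq rho 0.
  exists 0; rewrite normr0 r0 !mul0r (ltW pi0).
  move: rho2; rewrite r0 expr0n/= => /esym/eqP.
  by rewrite paddr_eq0 ?sqr_ge0// !sqrf_eq0 => /andP[/eqP -> /eqP ->].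
have rp : 0 < rho by rewrite lt_def r0.
have x1 : -1 <= x / rho <= 1.
  rewrite -ler_norml normrM normfV (gtr0_norm rp) ler_pdivrMr// mul1r.
  rewrite -(@ler_pXn2r _ 2%N)// ?nnegrE ?normr_ge0// real_normK ?num_real// rho2.
  by rewrite lerDl sqr_ge0.
have [/andP[a0 api] ca] := acos_def x1.
have sa : rho * sin (acos (x / rho)) = `|y|.
  rewrite -(@ger0_norm _ (_ * _)); last by rewrite mulr_ge0// sin_ge0_pi// a0 api.
  apply/eqP; rewrite -(@eqrXn2 _ 2%N)// !real_normK ?num_real//.
  by rewrite exprMn sin2cos2 ca mulrBr mulr1 -exprMn mulrC divfK// rho2 addrC addKr.
have xr : x = rho * (x / rho) by rewrite mulrC divfK.
have [y0|y0] := leP 0 y.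
- exists (acos (x / rho)); rewrite ger0_norm// ca sa ger0_norm//; split => //.
- exists (- acos (x / rho)); rewrite normrN ger0_norm// cosN sinN ca mulrN sa.
  by rewrite ltr0_norm// opprK; split.
Qed.

Context {d : measure_display} {Omega : measurableType d}.
Variables (P : probability Omega R) (Y : {mfun Omega >-> R}).
Hypothesis Yac : forall A : set R, measurable A -> mu A = 0%E ->
  P (Y @^-1` A) = 0%E.

(** For a finite measure, vanishing on null sets implies the epsilon-delta form of absolute
    continuity. The library proves this for the variation of a charge, which for a nonnegative
    charge dominates the measure itself. *)
Lemma distribution_small_sets (e : R) : 0 < e -> exists2 eta : R, 0 < eta &
  forall A : set R, measurable A -> (mu A < eta%:E)%E -> (P (Y @^-1` A) < e%:E)%E.
Proof.
move=> e0; pose nu := charge_of_finite_measure (distribution P Y).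
have [U [V nuUV]] := Hahn_decomposition nu.
(* [lebesgue_measure] lives on the Borel sigma-algebra presented with another
   display than that of [R]; pushing it forward along the identity realigns it *)
have mid : measurable_fun setT (idfun : measurableTypeR R -> R).
  by move=> _ A mA; rewrite setTI.
pose mu' : {measure set R -> \bar R} := pushforward mu (idfun : measurableTypeR R -> R).
have numu : nu `<< mu' mid.
  by apply/null_content_dominatesP => A mA A0; exact: Yac.
have [eta [eta0 H]] := charge_variation_continuous nuUV numu e0.
exists eta => // A mA mAe; apply: le_lt_trans (H A mA mAe).
apply: le_trans (abse_charge_variation nuUV mA).
by rewrite gee0_abs// /nu /charge_of_finite_measure measure_ge0.
Qed.

Lemma distribution_tight (e : R) : 0 < e -> exists2 M : R, 0 <= M &
  (P [set w | (M < `|Y w|)%R] < e%:E)%E.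
Proof.
move=> e0; pose F (n : nat) := [set w | n%:R < `|Y w|].
have mF n : measurable (F n).
  rewrite -[X in measurable X]setTI.
  have mY : measurable_fun setT (fun w => `|Y w|) by exact: measurableT_comp.
  have := mY measurableT `]n%:R, +oo[%classic (measurable_itv _).
  by congr (measurable (_ `&` _)); apply/seteqP; split=> w/=; rewrite in_itv/= andbT.
have cF : P (F n) @[n --> \oo] --> P (\bigcap_n F n).
  apply: nonincreasing_cvg_mu => //.
  - by rewrite -ge0_fin_numE// fin_num_measure.
  - by apply: bigcapT_measurable.
  - move=> n m nm; apply/subsetPset => w; rewrite /F/=; apply: le_lt_trans.
    by rewrite ler_nat.
have F0 : \bigcap_n F n = set0.
  rewrite -subset0 => w /(_ (Num.truncn `|Y w|).+1 I); rewrite /F/=.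
  by move=> /ltW; rewrite leNgt truncnS_gt.
rewrite F0 measure0 in cF.
have /fine_cvgP[_ /cvgr0_norm_lt /(_ e e0)[n _ /(_ n (leqnn n))]] := cF.
rewrite /= ger0_norm ?fine_ge0// => Fn; exists n%:R => //.
by move: Fn; rewrite -lte_fin fineK ?fin_num_measure.
Qed.

(* If the modulus were close to 1, cos(s Y - alpha) would be close to 1 with high
   probability; but in a bounded interval the set where this happens has small
   Lebesgue measure, uniformly in s >= delta. *)
Lemma cramer_condition (delta : R) : 0 < delta -> exists2 q : R, 0 < q < 1 &
  forall s, delta <= s ->
  (\int[P]_w cos (s * Y w)) ^+ 2 + (\int[P]_w sin (s * Y w)) ^+ 2 <= q ^+ 2.
Proof.
move=> delta0; have pi0 := pi_gt0 R.
have [|M M0 PM] := @distribution_tight (4^-1); first by rewrite invr_gt0.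
have [|eta eta0 Peta] := @distribution_small_sets (4^-1); first by rewrite invr_gt0.
(* For s >= [delta] the cover has measure at most [beta] times [L], so [beta] is chosen to bring
   this below [eta]. The cap 1 keeps [beta] in the range where the cosine is decreasing and
   nonnegative. *)
pose L := 2 * (M + 5 / delta).
have L0 : 0 < L by rewrite mulr_gt0// ltr_wpDl// divr_gt0.
pose beta := Num.min 1 (eta / (2 * L)).
have beta0 : 0 < beta by rewrite lt_min ltr01 divr_gt0// mulr_gt0.
have beta1 : beta <= 1 by rewrite ge_min lexx.
have pi1 : 1 <= pi :> R by apply: le_trans (pi_ge2 R); lra.
have betapi : beta <= pi by exact: le_trans pi1.
have betaL : beta * L < eta.
  have : beta * (2 * L) <= eta.
    have L20 : 0 < 2 * L by rewrite mulr_gt0.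
    by rewrite -ler_pdivlMr// ge_min lexx orbT.
  have : 0 < beta * L by rewrite mulr_gt0.
  lra.
have cb1 : cos beta < 1.
  have := @ltr_cos R; move=> /(_ 0 beta).
  rewrite !in_itv/= lexx (ltW beta0) betapi (ltW pi0) cos0.
  by move=> /(_ isT isT) ->.
have cbN1 : -1 < cos beta.
  have cb : 0 <= cos beta.
    apply: cos_ge0_pihalf; have := pi_ge2 R => pi2.
    by apply/andP; split; lra.
  by apply: lt_le_trans cb; rewrite ltrN10.
(* On the event [B] below, of probability at most 1/4 + 1/4, the cosine is bounded by 1, and
   elsewhere by cos [beta]: the average of the two bounds the modulus. *)
exists ((1 + cos beta) / 2); first by apply/andP; split; lra.
move=> s ds; have s0 : 0 < s by exact: lt_le_trans ds.
set a := \int[P]_w cos (s * Y w); set b := \int[P]_w sin (s * Y w).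
(* Rotating by the argument of the characteristic function makes its modulus the expectation of the
   single cosine cos(s Y - alpha). *)
have [alpha [alpi aE bE]] := polar_coordinates a b.
set rho := Num.sqrt _ in aE bE.
have rho2 : rho ^+ 2 = a ^+ 2 + b ^+ 2.
  by rewrite sqr_sqrtr// addr_ge0 ?sqr_ge0.
have q_ge0 : 0 <= (1 + cos beta) / 2 by lra.
rewrite -rho2 lerXn2r ?nnegrE ?sqrtr_ge0//.
have [|A [mA AP Amu]] := @cos_superlevel_cover M s alpha beta M0 s0 alpi.
  by rewrite beta0.
have {}Amu : (mu A < eta%:E)%E.
  apply: (le_lt_trans Amu); rewrite lte_fin; apply: le_lt_trans betaL.
  rewrite /L mulrA [2 * beta]mulrC ler_wpM2l//; first by rewrite mulr_ge0// ltW.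
  by rewrite lerD2l ler_wpM2l// lef_pV2 ?posrE.
pose B := [set w | M < `|Y w|] `|` Y @^-1` A.
have mMY : measurable [set w | M < `|Y w|].
  have mY : measurable_fun setT (fun w => `|Y w|) by exact: measurableT_comp.
  have := mY measurableT `]M, +oo[%classic (measurable_itv _).
  by rewrite setTI; congr measurable; apply/seteqP; split=> w/=; rewrite in_itv/= andbT.
have mYA : measurable (Y @^-1` A) by exact: measurable_funPTI.
have mB : measurable B by exact: measurableU.
have PB : fine (P B) <= 2^-1.
  rewrite -lee_fin fineK ?fin_num_measure//.
  apply: (le_trans (measureU2 _ mMY mYA)).
  apply: (le_trans (leeD (ltW PM) (ltW (Peta A mA Amu)))).
  by rewrite -EFinD lee_fin; lra.
have [ms mc] := @measurable_sin_cos R.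
have mcs : measurable_fun setT (fun w => cos (s * Y w)).
  by apply: (measurableT_comp mc); exact: measurable_funM.
have mss : measurable_fun setT (fun w => sin (s * Y w)).
  by apply: (measurableT_comp ms); exact: measurable_funM.
have ics : P.-integrable setT (EFin \o (fun w => cos (s * Y w))).
  by apply: (@bounded_integrable _ _ _ _ _ 1) => // w; rewrite norm_sin_cos_le1.
have iss : P.-integrable setT (EFin \o (fun w => sin (s * Y w))).
  by apply: (@bounded_integrable _ _ _ _ _ 1) => // w; rewrite norm_sin_cos_le1.
have rhoE : rho = \int[P]_w (cos alpha * cos (s * Y w) + sin alpha * sin (s * Y w)).
  rewrite RintegralD//; [|exact: integrable_realZ..].
  rewrite !RintegralZl// -/a -/b aE bE mulrCA [X in _ + X]mulrCA -mulrDr.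
  by rewrite -!expr2 cos2Dsin2 mulr1.
have iB : P.-integrable setT (EFin \o \1_B) by exact: integrable_indic.
have -> : (1 + cos beta) / 2 = cos beta + (1 - cos beta) * 2^-1 by field.
apply: (@le_trans _ _ (cos beta + (1 - cos beta) * fine (P B))); last first.
  by rewrite lerD2l ler_wpM2l// subr_ge0 ltW.
have -> : cos beta + (1 - cos beta) * fine (P B) =
    \int[P]_w (cos beta + (1 - cos beta) * \1_B w).
  rewrite RintegralD//; [|exact: integrable_cst_prob|exact: integrable_realZ].
  rewrite RintegralZl// expectation_cst; congr (_ + _ * _).
  by rewrite /Rintegral integral_indic// setIT.
rewrite rhoE; apply: le_Rintegral => //.
- by apply: integrable_realD; exact: integrable_realZ.
- by apply: integrable_realD; [exact: integrable_cst_prob|exact: integrable_realZ].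
move=> w _; have -> : cos alpha * cos (s * Y w) + sin alpha * sin (s * Y w) =
    cos (s * Y w - alpha) by rewrite cosB; ring.
rewrite indicE; case: (boolP (w \in B)) => wB /=.
  by rewrite mulr1 subrKC cos_le1.
rewrite mulr0 addr0 leNgt; apply/negP => cw; move: wB; rewrite notin_setE; apply.
have [MY|YM] := ltP M `|Y w|; first by left.
by right; apply: AP => //; exact: ltW.
Qed.

End cramer_condition.

(** * Smoothing with Fejer kernels *)

Section fubini_expectation.
Context {R : realType} {d : measure_display} {Omega : measurableType d}.
Variable P : probability Omega R.
Notation mu := (@lebesgue_measure R).

Lemma Rintegral_itv_cst (A c : R) : 0 <= A -> \int[mu]_(s in `]0, A]) c = A * c.
Proof.
move=> A0; rewrite Rintegral_cst// [fine _](_ : _ = A) 1?mulrC//.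
have := @lebesgue_measure_itv R `]0, A]; rewrite /= lte_fin => ->.
move: A0; rewrite le_eqVlt => /predU1P[<-|->]; first by rewrite ltxx.
by rewrite oppr0 addr0.
Qed.

(** The bound on [f] holds only on the strip, so Fubini is applied to [f] truncated by the indicator
    of []0, A]], whose absolute value has integral at most A E|B|. *)
Lemma expectation_Fubini (f : Omega * measurableTypeR R -> R) (A : R)
    (B : Omega -> R) :
  0 < A -> measurable_fun setT f -> P.-integrable setT (EFin \o B) ->
  (forall w s, s \in `]0, A] -> `|f (w, s)| <= B w) ->
  [/\ \int[P]_w (\int[mu]_(s in `]0, A]) f (w, s)) =
      \int[mu]_(s in `]0, A]) (\int[P]_w f (w, s)),
      P.-integrable setT (EFin \o (fun w => \int[mu]_(s in `]0, A]) f (w, s))) &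
      mu.-integrable `]0, A] (EFin \o (fun s => \int[P]_w f (w, s)))].
Proof.
move=> A0 mf iB fB; pose D : set (measurableTypeR R) := `]0, A]%classic.
have mD : measurable D by exact: measurable_itv.
have muD : mu D = A%:E.
  by rewrite /D lebesgue_measure_itv/= lte_fin A0 oppr0 adde0.
pose g (z : Omega * measurableTypeR R) : R := \1_D z.2 * f z.
have mg : measurable_fun setT g.
  apply: measurable_funM => //.
  by apply: (measurableT_comp (measurable_indic mD)); exact: measurable_snd.
have gB w s : `|g (w, s)| <= `|B w| * \1_D s.
  rewrite /g/= indicE; case: (boolP (s \in D)) => sD /=.
    rewrite mul1r mulr1; apply: le_trans (ler_norm _); apply: fB.
    exact: set_mem sD.
  by rewrite mul0r normr0 mulr0.
have mB : measurable_fun setT B by have /integrableP[/measurable_EFinP] := iB.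
have ig : (P \x mu)%E.-integrable setT (EFin \o g).
  apply/(integrable12ltyP P mu); first exact/measurable_EFinP.
  apply: (@le_lt_trans _ _ (\int[P]_w (`|B w| * A)%:E)%E).
    apply: ge0_le_integral => //.
    - by move=> w _; exact: integral_ge0.
    - apply: (measurable_fun_fubini_tonelli_F (fun z => `|(g z)%:E|)%E) => //.
      by apply: measurableT_comp => //; exact/measurable_EFinP.
    - by apply/measurable_EFinP; apply: measurable_funM => //; exact: measurableT_comp.
    - move=> w _; apply: (@le_trans _ _ (\int[mu]_s (`|B w| * \1_D s)%:E)%E).
        apply: ge0_le_integral => //.
        + apply: measurableT_comp => //; apply/measurable_EFinP.
          exact: (measurable_fun_pair2 w mg).
        + by apply/measurable_EFinP; apply: measurable_funM.
        + by move=> s _; rewrite abse_EFin lee_fin gB.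
      under eq_integral do rewrite EFinM.
      rewrite ge0_integralZl//; last by apply/measurable_EFinP.
      by rewrite integral_indic// setIT [X in (_ * X)%E]muD EFinM.
  have iB' : P.-integrable setT (EFin \o (fun w => `|B w| * A)).
    under eq_fun do rewrite mulrC.
    by apply: integrable_realZ; exact: integrable_norm.
  by have := integrable_lty measurableT iB'.
have FE w : fubini_F mu (EFin \o g) w = (\int[mu]_(s in `]0, A]) f (w, s))%:E.
  have -> : fubini_F mu (EFin \o g) w = (\int[mu]_(s in D) (f (w, s))%:E)%E.
    rewrite /fubini_F [RHS]integral_mkcond; apply: eq_integral => s _.
    rewrite /g/= patchE indicE; case: ifPn => _ /=; first by rewrite mul1r.
    by rewrite mul0r.
  rewrite /Rintegral fineK//; apply: integrable_fin_num => //.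
  apply: measurable_bounded_integrable => //.
  - by rewrite [X in (X < _)%E]muD ltry.
  - by apply: measurable_funTS; exact: (measurable_fun_pair2 w mf).
  - exists (B w); split; first exact: num_real.
    by move=> x Bx s sD; apply: (le_trans (fB w s sD)); exact: ltW.
have GE s : s \in D -> fubini_G P (EFin \o g) s = (\int[P]_w f (w, s))%:E.
  move=> sD; have -> : fubini_G P (EFin \o g) s = (\int[P]_w (f (w, s))%:E)%E.
    by apply: eq_integral => w _; rewrite /g/= indicE sD mul1r.
  rewrite /Rintegral fineK//; apply: integrable_fin_num => //.
  apply: le_integrable iB => //.
    by apply/measurable_EFinP; exact: (measurable_fun_pair1 s mf).
  move=> w _ /=; rewrite lee_fin; apply: le_trans (ler_norm _).
  exact/fB/(set_mem sD).
have G0 s : s \notin D -> fubini_G P (EFin \o g) s = 0%E.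
  move=> sD; rewrite /fubini_G integral0_eq// => w _.
  by rewrite /g/= indicE (negbTE sD) mul0r.
have iF := integrable_fubini_F ig.
have FF : fubini_F mu (EFin \o g) = EFin \o (fun w => \int[mu]_(s in `]0, A]) f (w, s)).
  by apply/funext => w; rewrite FE.
have GG : fubini_G P (EFin \o g) = (EFin \o (fun s => \int[P]_w f (w, s))) \_ D.
  apply/funext => s; rewrite patchE; case: ifPn => sD; first by rewrite GE.
  by rewrite G0.
have iG : mu.-integrable setT (fubini_G P (EFin \o g)).
  apply/integrableP; split; first exact: (measurable_fubini_G ig).
  have := (integrable21ltyP P mu (measurable_int _ ig)).1 ig.
  apply: le_lt_trans; apply: ge0_le_integral => //.
  - by apply: measurableT_comp => //; exact: (measurable_fubini_G ig).
  - apply: (measurable_fun_fubini_tonelli_G (abse \o (EFin \o g))) => [|z];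
      last exact: abse_ge0.
    by apply: measurableT_comp => //; exact/measurable_EFinP.
  - by move=> s _; apply: le_abse_integral => //; apply/measurable_EFinP; exact: (measurable_fun_pair1 s mg).
split.
- transitivity (fine (\int[P \x mu]_z (EFin \o g) z)%E).
    rewrite /Rintegral; congr fine; rewrite -integral12_prod_meas1//.
    by apply: eq_integral => w _; rewrite FE.
  rewrite /Rintegral; congr fine.
  by rewrite -integral21_prod_meas1// GG -integral_mkcond.
- by rewrite -FF.
- by apply/(integrable_mkcond _ mD); rewrite -GG.
Qed.

End fubini_expectation.

Section fejer_kernel.
Context {R : realType}.
Implicit Types (A s x y : R).
Notation mu := (@lebesgue_measure R).

Lemma is_derive_scaled_comp (f : R -> R) (df c x : R) :
  is_derive (c * x) 1 f df -> is_derive x 1 (fun y => f (c * y)) (c * df).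
Proof.
move=> fd; rewrite mulrC.
apply: (@is_derive1_comp R f (fun y => c * y) x df c fd).
by apply: is_derive_eq; rewrite /GRing.scale/= mulr1.
Qed.

(** An unnormalised Fejer kernel, equal to (1 - cos(A x)) / (A x^2) for x != 0. Written as the
    cosine transform of a triangular weight, it has an expectation that involves the characteristic
    function on []0, A]] only; the same holds for its primitive. *)
Definition fejer A x : R := \int[mu]_(s in `]0, A]) ((1 - s / A) * cos (s * x)).

Definition fejer_primitive A x : R :=
  \int[mu]_(s in `]0, A]) ((1 - s / A) * (sin (s * x) / s)).

Lemma fejer_weight_bound A s : s \in `]0, A] -> 0 <= 1 - s / A <= 1.
Proof.
rewrite in_itv/= => /andP[s0 sA].
have A0 : 0 < A by exact: lt_le_trans sA.
rewrite subr_ge0 ler_pdivrMr// mul1r sA/= gerBl divr_ge0// ltW//.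
Qed.

Lemma norm_sinc_le s x : 0 < s -> `|sin (s * x) / s| <= `|x|.
Proof.
move=> s0; rewrite normrM normfV (gtr0_norm s0) ler_pdivrMr//.
by rewrite (le_trans (norm_sin_le _))// normrM (gtr0_norm s0) mulrC.
Qed.

Lemma fejerE A x : 0 < A -> A * x ^+ 2 * fejer A x = 1 - cos (A * x).
Proof.
move=> A0; have [->|x0] := eqVneq x 0.
  by rewrite expr0n/= mulr0 mul0r cos0 subrr.
pose F s := (1 - s / A) * (sin (s * x) / x) - cos (s * x) / (A * x ^+ 2).
have An0 : A != 0 by rewrite gt_eqF.
have dF s : is_derive s 1 F ((1 - s / A) * cos (s * x)).
  have ds : is_derive s 1 (fun s => sin (s * x)) (x * cos (s * x)).
    under eq_fun do rewrite mulrC.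
    by rewrite [s * x]mulrC; apply: is_derive_scaled_comp; exact: is_derive_sin.
  have dc : is_derive s 1 (fun s => cos (s * x)) (x * - sin (s * x)).
    under eq_fun do rewrite mulrC.
    by rewrite [s * x]mulrC; apply: is_derive_scaled_comp; exact: is_derive_cos.
  apply: is_derive_eq; rewrite /GRing.scale/=; field.
  by rewrite An0 x0.
rewrite /fejer (@Rintegral_FTC R F)//.
  rewrite /F !mul0r sin0 cos0 divff// !mul0r subr0 mul1r; field.
  by rewrite An0 x0.
move=> s; apply: cvgM.
  apply: cvgB; first exact: cvg_cst.
  by apply: cvgM; [exact: cvg_id|exact: cvg_cst].
apply: continuous_comp; last exact: continuous_cos.
by apply: cvgM; [exact: cvg_id|exact: cvg_cst].
Qed.

Lemma fejer0 A : 0 < A -> fejer A 0 = A / 2.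
Proof.
move=> A0; have An0 : A != 0 by rewrite gt_eqF.
have -> : fejer A 0 = \int[mu]_(s in `]0, A]) (1 - s / A).
  by apply: eq_Rintegral => s _; rewrite mulr0 cos0 mulr1.
have dF s : is_derive s 1 (fun s => s - s ^+ 2 / (2 * A)) (1 - s / A).
  by apply: is_derive_eq; rewrite /GRing.scale/=; field.
rewrite (Rintegral_FTC A0 dF); first by field.
- move=> s; apply: cvgB; first exact: cvg_cst.
  by apply: cvgM; [exact: cvg_id|exact: cvg_cst].
Qed.

Lemma fejer_ge0 A x : 0 < A -> 0 <= fejer A x.
Proof.
move=> A0; have [->|x0] := eqVneq x 0; first by rewrite fejer0// divr_ge0// ltW.
have : 0 <= A * x ^+ 2 * fejer A x by rewrite fejerE// subr_ge0 cos_le1.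
by rewrite pmulr_rge0// mulr_gt0// exprn_even_gt0.
Qed.

Lemma fejer_le A x : 0 < A -> x != 0 -> fejer A x <= 2 / (A * x ^+ 2).
Proof.
move=> A0 x0; have p : 0 < A * x ^+ 2 by rewrite mulr_gt0// exprn_even_gt0.
rewrite ler_pdivlMr// mulrC fejerE//.
by have := cos_geN1 (A * x); lra.
Qed.

(** With z = A x, 1 - cos z >= z^2 / 2 - z^4 >= z^2 / 4 as soon as z^2 <= 1/4. Together with
    [fejer_ge0] this makes the kernel a majorant of a multiple of an indicator. *)
Lemma fejer_ge A x : 0 < A -> `|A * x| <= 2^-1 -> A / 4 <= fejer A x.
Proof.
move=> A0 Ax; have [->|x0] := eqVneq x 0; first by rewrite fejer0//; lra.
have p : 0 < A * x ^+ 2 by rewrite mulr_gt0// exprn_even_gt0.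
rewrite -(ler_pM2l p) fejerE//.
have := norm_cos_taylor2_le (A * x); rewrite ler_norml => /andP[_].
have -> : A * x ^+ 2 * (A / 4) = (A * x) ^+ 2 / 4 by field.
have : (A * x) ^+ 2 <= 4^-1.
  have -> : (4^-1 : R) = 2^-1 ^+ 2 by field.
  by rewrite -real_normK ?num_real// lerXn2r ?nnegrE.
set z := A * x => z4; have z0 : 0 <= z ^+ 2 by exact: sqr_ge0.
have : z ^+ 4 <= z ^+ 2 / 4 by rewrite (exprM z 2 2) expr2 ler_wpM2l.
lra.
Qed.

Lemma measurable_fejer_weight A :
  measurable_fun `]0, A] (fun s => (1 - s / A) * s^-1).
Proof.
apply: subspace_continuous_measurable_fun => //.
apply: continuous_in_subspaceT => s; rewrite inE/= in_itv/= => /andP[s0 _].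
apply: cvgM; last by apply: cvgV; [rewrite gt_eqF|exact: cvg_id].
apply: cvgB; first exact: cvg_cst.
by apply: cvgM; [exact: cvg_id|exact: cvg_cst].
Qed.

Lemma bounded_integrable_itv A (f : R -> R) M : 0 < A ->
  measurable_fun `]0, A] f -> (forall s, s \in `]0, A] -> `|f s| <= M) ->
  mu.-integrable `]0, A] (EFin \o f).
Proof.
move=> A0 mf fM; have muD : mu `]0, A] = A%:E.
  by rewrite lebesgue_measure_itv/= lte_fin A0 oppr0 adde0.
apply: measurable_bounded_integrable => //.
- by rewrite [X in (X < _)%E]muD ltry.
- exists M; split; first exact: num_real.
  by move=> x Mx s sD; apply: (le_trans (fM s sD)); exact: ltW.
Qed.

Lemma measurable_sin_scale x : measurable_fun setT (fun s : R => sin (s * x)).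
Proof.
have [ms _] := @measurable_sin_cos R.
by apply: (measurableT_comp ms); exact: measurable_funM.
Qed.

Lemma norm_fejer_integrand_le A x s : s \in `]0, A] ->
  `|(1 - s / A) * (sin (s * x) / s)| <= `|x|.
Proof.
move=> sA; have /andP[w0 w1] := fejer_weight_bound sA.
rewrite normrM (ger0_norm w0) -[leRHS]mul1r ler_pM// norm_sinc_le//.
by move: sA; rewrite in_itv/= => /andP[].
Qed.

Lemma integrable_fejer_integrand A x : 0 < A ->
  mu.-integrable `]0, A] (EFin \o (fun s => (1 - s / A) * (sin (s * x) / s))).
Proof.
move=> A0; apply: (@bounded_integrable_itv A _ `|x|) => //.
  rewrite [X in measurable_fun _ X](_ : _ = fun s => (1 - s / A) * s^-1 * sin (s * x)).
    apply: measurable_funM; first exact: measurable_fejer_weight.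
    by apply: measurable_funTS; exact: measurable_sin_scale.
  by apply/funext => s; ring.
by move=> s; exact: norm_fejer_integrand_le.
Qed.

Lemma is_derive_fejer_primitive A x : 0 < A ->
  is_derive x 1 (fejer_primitive A) (fejer A x).
Proof.
move=> A0; pose f y s := (1 - s / A) * (sin (s * y) / s).
have dfE y s : s \in `]0, A] -> is_derive y 1 (f^~ s) ((1 - s / A) * cos (s * y)).
  rewrite in_itv/= => /andP[s0 _]; rewrite /f.
  have ds := is_derive_scaled_comp (is_derive_sin (s * y)).
  by apply: is_derive_eq; rewrite /GRing.scale/=; field; rewrite gt_eqF//= gt_eqF.
have Ix : (`]x - 1, x + 1[)%classic x by rewrite /= in_itv/=; apply/andP; split; lra.
have intf y : (`]x - 1, x + 1[)%classic y -> mu.-integrable `]0, A] (EFin \o f y).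
  by move=> _; exact: integrable_fejer_integrand.
have derf y s : (`]x - 1, x + 1[)%classic y -> `]0, A]%classic s ->
    derivable (f^~ s) y 1.
  by move=> _ sA; have [] := dfE y s sA.
have df1 y s : s \in `]0, A] -> partial1of2 f y s = (1 - s / A) * cos (s * y).
  by move=> sA; rewrite partial1of2E; have ? := dfE y s sA; exact: derive_val.
have G_ub y s : (`]x - 1, x + 1[)%classic y -> `]0, A]%classic s ->
    `|partial1of2 f y s| <= cst 1 s.
  move=> _ sA; rewrite df1//; have /andP[w0 w1] := fejer_weight_bound sA.
  rewrite normrM (ger0_norm w0) -[leRHS]mul1r ler_pM//.
  by have [] := norm_sin_cos_le1 (s * y).
have intG : mu.-integrable `]0, A] (EFin \o (cst 1 : R -> R)).
  by apply: (@bounded_integrable_itv A _ 1) => // s _; rewrite normr1.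
have G0 s : 0 <= (cst 1 : R -> R) s by [].
have mD : measurable (`]0, A]%classic : set (measurableTypeR R)) by exact: measurable_itv.
apply: DeriveDef.
  exact: (derivable_under_integral mD Ix intf derf G0 intG G_ub).
rewrite -derive1E (differentiation_under_integral mD Ix intf derf G0 intG G_ub).
by apply: eq_Rintegral => s; rewrite inE/= => sA; rewrite df1.
Qed.

Lemma fejer_primitive0 A : fejer_primitive A 0 = 0.
Proof.
rewrite /fejer_primitive (@eq_Rintegral _ _ _ _ _ (cst 0)).
  by rewrite /Rintegral integral0.
by move=> s _; rewrite mulr0 sin0 mul0r mulr0.
Qed.

Lemma fejer_primitiveN A x : 0 < A -> fejer_primitive A (- x) = - fejer_primitive A x.
Proof.
move=> A0; rewrite /fejer_primitive -[RHS]mulN1r -RintegralZl//.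
  by apply: eq_Rintegral => s _; rewrite mulrN sinN mulNr mulrN mulN1r.
exact: integrable_fejer_integrand.
Qed.

Lemma fejer_primitive_bound A x : 0 < A -> `|fejer_primitive A x| <= A * `|x|.
Proof.
move=> A0; have mD : measurable (`]0, A]%classic : set (measurableTypeR R)) by exact: measurable_itv.
have ii := integrable_fejer_integrand x A0.
apply: (le_trans (le_normr_Rintegral _ ii)) => //.
rewrite -Rintegral_itv_cst ?(ltW A0)//.
have ic : mu.-integrable `]0, A] (EFin \o (fun=> `|x|)).
  by apply: (@bounded_integrable_itv A _ `|x|) => // s _; rewrite normr_id.
apply: (le_Rintegral mD (integrable_norm ii) ic) => s sA.
exact: norm_fejer_integrand_le.
Qed.

Lemma fejer_primitive_nondecreasing A x y : 0 < A -> 0 <= x <= y ->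
  fejer_primitive A x <= fejer_primitive A y.
Proof.
move=> A0 /andP[x0 xy].
have [||c cxy e] := @MVT_segment R (fejer_primitive A) (fejer A) x y xy.
- by move=> t _; exact: is_derive_fejer_primitive.
- apply: derivable_within_continuous => t _.
  by have [] := is_derive_fejer_primitive t A0.
rewrite -subr_ge0 e.
by rewrite mulr_ge0 ?subr_ge0// fejer_ge0.
Qed.

(** By [fejer_le] the kernel is at most minus the derivative of 2 / (A x). Combined with the
    monotonicity of the primitive, this gives its limit at infinity and the rate of convergence
    without computing the Dirichlet integral. *)
Lemma fejer_primitive_nonincreasing A x y : 0 < A -> 0 < x <= y ->
  fejer_primitive A y + 2 / (A * y) <= fejer_primitive A x + 2 / (A * x).
Proof.
move=> A0 /andP[x0 xy]; pose L t := fejer_primitive A t + 2 / (A * t).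
have An0 : A != 0 by rewrite gt_eqF.
have dL (t : R) : 0 < t -> is_derive t 1 L (fejer A t - 2 / (A * t ^+ 2)).
  move=> t0; have ? := is_derive_fejer_primitive t A0.
  have dV : is_derive t 1 (fun t : R => (A * t)^-1) (- (A * t) ^- 2 *: A).
    apply: is_deriveV; first by rewrite mulf_neq0// gt_eqF.
    by apply: is_derive_eq; rewrite /GRing.scale/= mulr1.
  apply: is_derive_eq; rewrite /GRing.scale/=; field.
  by rewrite An0 gt_eqF.
have xt (t : R) : t \in `[x, y] -> 0 < t.
  by rewrite in_itv/= => /andP[+ _]; exact: lt_le_trans.
have [||c cxy e] := @MVT_segment R L (fun t => fejer A t - 2 / (A * t ^+ 2)) x y xy.
- by move=> t /subset_itv_oo_cc/xt; exact: dL.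
- by apply: derivable_within_continuous => t /xt t0; have [] := dL t t0.
rewrite -subr_le0 [leLHS]e mulr_le0_ge0 ?subr_ge0// subr_le0 fejer_le//.
by rewrite gt_eqF// xt.
Qed.

(* The constant is pi / 2, but its value plays no role. *)
Lemma fejer_primitive_sg A : 0 < A -> exists I : R, 0 <= I <= 3 /\
  forall x, `|fejer_primitive A x| <= I /\
    (x != 0 -> `|fejer_primitive A x - I * Num.sg x| <= 2 / (A * `|x|)).
Proof.
move=> A0; pose H := fejer_primitive A.
pose E := [set H x | x in [set x | 0 < x]].
have Hub x y : 0 < x -> 0 < y -> H y <= H x + 2 / (A * x).
  move=> x0 y0; have [xy|yx] := leP x y.
    have : H y + 2 / (A * y) <= H x + 2 / (A * x).
      by apply: fejer_primitive_nonincreasing => //; rewrite x0.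
    by apply: le_trans; rewrite lerDl divr_ge0// mulr_ge0// ltW.
  have : H y <= H x by apply: fejer_primitive_nondecreasing => //; rewrite !ltW.
  by move/le_trans; apply; rewrite lerDl divr_ge0// mulr_ge0// ltW.
have E3 y : E y -> y <= 3.
  (* The number 3 is found at the point 1 / A, where the primitive is at most 1 and the correction 2
     / (A x) equals 2. *)
  move=> [x x0 <-]; have A10 : 0 < A^-1 by rewrite invr_gt0.
  apply: (le_trans (Hub A^-1 x A10 x0)).
  rewrite divff ?gt_eqF// divr1.
  have := fejer_primitive_bound A^-1 A0.
  rewrite (gtr0_norm A10) divff ?gt_eqF// => /(le_trans (ler_norm _)).
  by rewrite -/H; lra.
have sE : has_sup E.
  by split; [exists (H 1); exists 1 => //=|exists 3 => y /E3].
have Iub x : 0 < x -> H x <= sup E.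
  by move=> x0; apply: sup_upper_bound => //; exists x.
have Ile x : 0 < x -> sup E <= H x + 2 / (A * x).
  move=> x0; apply: ge_sup; first by case: sE.
  by move=> _ [y y0 <-]; exact: Hub.
have H0 x : 0 < x -> 0 <= H x.
  move=> x0; rewrite -(fejer_primitive0 A); apply: fejer_primitive_nondecreasing => //.
  by rewrite lexx ltW.
have I0 : 0 <= sup E by apply: le_trans (Iub 1 ltr01); exact: H0.
exists (sup E); split.
  by rewrite I0; apply: ge_sup; [case: sE|exact: E3].
have pos x : 0 < x -> `|H x| <= sup E /\ `|H x - sup E| <= 2 / (A * x).
  move=> x0; rewrite ger0_norm ?H0// Iub//; split => //.
  rewrite ler0_norm ?subr_le0 ?Iub// opprB lerBlDl; exact: Ile.
move=> x; have [x0|x0|->] := ltgtP x 0.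
- have Nx0 : 0 < - x by rewrite oppr_gt0.
  have [h1 h2] := pos _ Nx0.
  move: h1 h2; rewrite /H fejer_primitiveN// normrN => h1 h2; split => // _.
  by rewrite ltr0_sg// (ltr0_norm x0) mulrN1 -normrN opprB addrC.
- have [h1 h2] := pos _ x0; split => // _.
  by rewrite gtr0_sg// mulr1 (gtr0_norm x0).
- by rewrite fejer_primitive0 normr0.
Qed.

End fejer_kernel.

Section smoothing.
Context {R : realType} {d : measure_display} {Omega : measurableType d}.
Variables (P : probability Omega R) (Y : {mfun Omega >-> R}).
Notation mu := (@lebesgue_measure R).
Hypothesis iY : P.-integrable setT (EFin \o Y).

Lemma measurable_scaled_product :
  measurable_fun setT (fun z : Omega * measurableTypeR R => z.2 * Y z.1 : R).
Proof.
apply: measurable_funM; first exact: measurable_snd.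
by apply: measurableT_comp => //; exact: measurable_fst.
Qed.

Lemma measurable_weighted (A : R) (g : R -> R) (phi : R -> R) :
  measurable_fun (`]0, A] : set R) g -> measurable_fun setT phi ->
  measurable_fun setT (fun z : Omega * measurableTypeR R =>
    (g \_ `]0, A]) z.2 * phi (z.2 * Y z.1)).
Proof.
move=> mg mphi; apply: measurable_funM.
  have mgD : measurable_fun setT (g \_ `]0, A]).
    exact/(measurable_restrictT g (measurable_itv _)).
  by apply: (measurableT_comp mgD); exact: measurable_snd.
exact: (measurableT_comp mphi measurable_scaled_product).
Qed.

Let patchE' (A : R) (g : R -> R) s : s \in `]0, A] -> (g \_ `]0, A]) s = g s.
Proof. by move=> sA; rewrite patchE mem_set. Qed.

Lemma expectation_fejer_primitive A : 0 < A ->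
  [/\ \int[P]_w fejer_primitive A (Y w) =
      \int[mu]_(s in `]0, A]) ((1 - s / A) * ((\int[P]_w sin (s * Y w)) / s)),
      P.-integrable setT (EFin \o (fun w => fejer_primitive A (Y w))) &
      mu.-integrable `]0, A]
        (EFin \o (fun s => (1 - s / A) * ((\int[P]_w sin (s * Y w)) / s)))].
Proof.
move=> A0; have [ms _] := @measurable_sin_cos R.
pose g s : R := (1 - s / A) * s^-1.
pose f (z : Omega * measurableTypeR R) : R := (g \_ `]0, A]) z.2 * sin (z.2 * Y z.1).
have mf : measurable_fun setT f.
  by apply: measurable_weighted => //; exact: measurable_fejer_weight.
have fE w s : s \in `]0, A] -> f (w, s) = (1 - s / A) * (sin (s * Y w) / s).
  by move=> sA; rewrite /f/= patchE'// /g; ring.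
have fB w s : s \in `]0, A] -> `|f (w, s)| <= `|Y w|.
  by move=> sA; rewrite fE// norm_fejer_integrand_le.
have [e1 e2 e3] := expectation_Fubini A0 mf (integrable_norm iY) fB.
have F1 : (fun w => fejer_primitive A (Y w)) = (fun w => \int[mu]_(s in `]0, A]) f (w, s)).
  by apply/funext => w; apply: eq_Rintegral => s; rewrite inE/= => sA; rewrite fE.
have F2 s : s \in `]0, A] -> \int[P]_w f (w, s) =
    (1 - s / A) * ((\int[P]_w sin (s * Y w)) / s).
  move=> sA; have -> : \int[P]_w f (w, s) = \int[P]_w (g s * sin (s * Y w)).
    by apply: eq_Rintegral => w _; rewrite /f/= patchE'.
  rewrite RintegralZl//; first by rewrite /g; ring.
  apply: (@bounded_integrable _ _ _ _ _ 1); last by move=> w; rewrite norm_sin_cos_le1.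
  by apply: (measurableT_comp ms); exact: measurable_funM.
split.
- rewrite F1 e1; apply: eq_Rintegral => s; rewrite inE/= => sA; exact: F2.
- by rewrite F1.
- apply: eq_integrable e3 => // s; rewrite inE/= => sA.
  by rewrite F2.
Qed.

Lemma expectation_fejer A : 0 < A ->
  \int[P]_w fejer A (Y w) =
      \int[mu]_(s in `]0, A]) ((1 - s / A) * \int[P]_w cos (s * Y w)) /\
  P.-integrable setT (EFin \o (fun w => fejer A (Y w))) /\
      mu.-integrable `]0, A]
        (EFin \o (fun s => (1 - s / A) * \int[P]_w cos (s * Y w))).
Proof.
move=> A0; have [_ mc] := @measurable_sin_cos R.
pose g s : R := 1 - s / A.
pose f (z : Omega * measurableTypeR R) : R := (g \_ `]0, A]) z.2 * cos (z.2 * Y z.1).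
have mf : measurable_fun setT f.
  apply: measurable_weighted => //.
  by apply: measurable_funB => //; exact: measurable_funM.
have fE w s : s \in `]0, A] -> f (w, s) = (1 - s / A) * cos (s * Y w).
  by move=> sA; rewrite /f/= patchE'.
have fB w s : s \in `]0, A] -> `|f (w, s)| <= cst 1 w.
  move=> sA; rewrite fE//; have /andP[w0 w1] := fejer_weight_bound sA.
  rewrite normrM (ger0_norm w0) -[leRHS]mul1r ler_pM//.
  by have [] := norm_sin_cos_le1 (s * Y w).
have [e1 e2 e3] := expectation_Fubini A0 mf (integrable_cst_prob P 1) fB.
have F1 : (fun w => fejer A (Y w)) = (fun w => \int[mu]_(s in `]0, A]) f (w, s)).
  by apply/funext => w; apply: eq_Rintegral => s; rewrite inE/= => sA; rewrite fE.
have F2 s : s \in `]0, A] -> \int[P]_w f (w, s) =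
    (1 - s / A) * \int[P]_w cos (s * Y w).
  move=> sA; have -> : \int[P]_w f (w, s) = \int[P]_w (g s * cos (s * Y w)).
    by apply: eq_Rintegral => w _; rewrite /f/= patchE'.
  rewrite RintegralZl//.
  apply: (@bounded_integrable _ _ _ _ _ 1); last by move=> w; rewrite norm_sin_cos_le1.
  by apply: (measurableT_comp mc); exact: measurable_funM.
split; [|split].
- rewrite F1 e1; apply: eq_Rintegral => s; rewrite inE/= => sA; exact: F2.
- by rewrite F1.
- apply: eq_integrable e3 => // s; rewrite inE/= => sA.
  by rewrite F2.
Qed.

Lemma measurable_near0 (A : R) : measurable [set w | `|A * Y w| <= 2^-1].
Proof.
have mY : measurable_fun setT (fun w => `|A * Y w|).
  by apply: measurableT_comp => //; exact: measurable_funM.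
have := mY measurableT `]-oo, 2^-1]%classic (measurable_itv _).
by rewrite setTI; congr measurable; apply/seteqP; split=> w/=; rewrite in_itv.
Qed.

Lemma expectation_indic (B : set Omega) : measurable B ->
  \int[P]_w \1_B w = fine (P B).
Proof. by move=> mB; rewrite /Rintegral integral_indic// setIT. Qed.

(** 4 / A times the Fejer kernel dominates the indicator of the event, by [fejer_ge] inside and
    [fejer_ge0] outside. *)
Lemma probability_near0_le A : 0 < A ->
  fine (P [set w | `|A * Y w| <= 2^-1]) <=
  4 / A * \int[mu]_(s in `]0, A]) ((1 - s / A) * \int[P]_w cos (s * Y w)).
Proof.
move=> A0; have [e [ie _]] := expectation_fejer A0.
have mB := measurable_near0 A; set B := [set w | _] in mB *.
have iB : P.-integrable setT (EFin \o \1_B) by exact: integrable_indic.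
rewrite -e -expectation_indic// -ler_pdivrMl ?divr_gt0// -RintegralZl//.
apply: le_Rintegral => //; first exact: integrable_realZ.
move=> w _; rewrite indicE; case: (boolP (w \in B)) => wB /=.
  by rewrite mulr1 invf_div fejer_ge//; move/set_mem : wB.
by rewrite mulr0 fejer_ge0.
Qed.

Lemma measurable_sign_sets :
  measurable [set w | 0 < Y w] * measurable [set w | Y w < 0].
Proof.
split.
- have := measurable_funPT Y measurableT `]0, +oo[%classic (measurable_itv _).
  by rewrite setTI; congr measurable; apply/seteqP; split=> w/=; rewrite in_itv/= andbT.
- have := measurable_funPT Y measurableT `]-oo, 0[%classic (measurable_itv _).
  by rewrite setTI; congr measurable; apply/seteqP; split=> w/=; rewrite in_itv/=.
Qed.

(* The primitive of the Fejer kernel of bandwidth A is within 2 / (A |x|) of I sgn x.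
   This is useless near 0, and P(|Y| <= 1 / (2 A')) is bounded by means of the
   nonnegativity of a second Fejer kernel, of bandwidth A'. *)
Lemma smoothing_inequality A A' : 0 < A -> 0 < A' -> exists I : R, 0 <= I /\
  `|I * (fine (P [set w | 0 < Y w]) - fine (P [set w | Y w < 0])) -
    \int[mu]_(s in `]0, A]) ((1 - s / A) * ((\int[P]_w sin (s * Y w)) / s))| <=
  24 / A' * (\int[mu]_(s in `]0, A']) ((1 - s / A') * \int[P]_w cos (s * Y w))) +
  4 * A' / A.
Proof.
move=> A0 A'0; have [I [/andP[I0 I3] HI]] := fejer_primitive_sg A0.
exists I; split => //.
have [mp mn] := measurable_sign_sets.
set Bp := [set w | 0 < Y w] in mp *; set Bn := [set w | Y w < 0] in mn *.
have ip : P.-integrable setT (EFin \o \1_Bp) by exact: integrable_indic.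
have iN : P.-integrable setT (EFin \o \1_Bn) by exact: integrable_indic.
have [e1 ie1 _] := expectation_fejer_primitive A0.
have sgE w : Num.sg (Y w) = \1_Bp w - \1_Bn w.
  rewrite !indicE.
  have -> : (w \in Bp) = (0 < Y w).
    by apply/idP/idP => [/set_mem//|h]; apply/mem_set.
  have -> : (w \in Bn) = (Y w < 0).
    by apply/idP/idP => [/set_mem//|h]; apply/mem_set.
  have [y0|y0|->] := ltgtP (Y w) 0.
  - by rewrite ltr0_sg//= sub0r.
  - by rewrite gtr0_sg//= subr0.
  - by rewrite sgr0 subrr.
have isg : P.-integrable setT (EFin \o (fun w => Num.sg (Y w))).
  rewrite (_ : (fun w => _) = (fun w => \1_Bp w - \1_Bn w)); last first.
    by apply/funext.
  exact: integrable_realB.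
have -> : fine (P Bp) - fine (P Bn) = \int[P]_w Num.sg (Y w).
  rewrite -!expectation_indic// -RintegralB//.
  by apply: eq_Rintegral => w _; rewrite sgE.
rewrite -e1 -RintegralZl// -RintegralB//; last exact: integrable_realZ.
have near0 := probability_near0_le A'0.
have mB := measurable_near0 A'; set B := [set w | _] in mB near0.
have iB : P.-integrable setT (EFin \o \1_B) by exact: integrable_indic.
(* On [B] the two terms are at most [I] <= 3 each. Off [B], |Y| > 1 / (2 A') and the error 2 / (A
   |Y|) is at most 4 A' / A. The 24 of the statement is 6 times the 4 of [probability_near0_le]. *)
apply: (@le_trans _ _ (\int[P]_w (6 * \1_B w + 4 * A' / A))).
  apply: le_norm_expectation.
  - by apply: integrable_realB => //; exact: integrable_realZ.
  - by apply: integrable_realD; [exact: integrable_realZ|exact: integrable_cst_prob].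
  move=> w; have [h1 h2] := HI (Y w).
  rewrite indicE; case: (boolP (w \in B)) => wB /=.
    rewrite mulr1; apply: le_trans (ler_normB _ _) _.
    apply: (@le_trans _ _ 6); last by rewrite lerDl divr_ge0 ?mulr_ge0// ltW.
    have : `|I * Num.sg (Y w)| <= I.
      rewrite normrM ger0_norm// -[leRHS]mulr1 ler_wpM2l//.
      by rewrite normr_sg; case: eqP.
    lra.
  have YB : 2^-1 < A' * `|Y w|.
    rewrite -(gtr0_norm A'0) -normrM ltNge; apply: contra wB => ?.
    exact/mem_set.
  have Y0 : Y w != 0.
    by apply/eqP => Y0; move: YB; rewrite Y0 normr0 mulr0; lra.
  rewrite mulr0 add0r distrC; apply: (le_trans (h2 Y0)).
  have nY : 0 < `|Y w| by rewrite normr_gt0.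
  rewrite ler_pdivlMr//.
  have -> : 2 / (A * `|Y w|) * A = 2 / `|Y w| by field; rewrite !gt_eqF.
  by rewrite ler_pdivrMr//; lra.
rewrite RintegralD//; [|exact: integrable_realZ|exact: integrable_cst_prob].
rewrite RintegralZl// expectation_cst expectation_indic// lerD2r.
set J := Rintegral _ _ _ in near0 *.
have -> : 24 / A' * J = 6 * (4 / A' * J) by field; rewrite gt_eqF.
by rewrite ler_wpM2l.
Qed.

End smoothing.

(** * The median of a sum *)

Section exponential_decay.
Context {R : realType}.

Lemma expR_pow_le (z : R) (k : nat) : 0 <= z -> z ^+ k * expR (- z) <= k`!%:R.
Proof.
move=> z0; rewrite expRN -ler_pdivlMr ?invr_gt0 ?expR_gt0// invrK.
case: k => [|k].
  by rewrite expr0 fact0 mul1r; have := expR_ge1Dx z; lra.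
have := expR_ge1Dxn k z0; rewrite addrC -lerBrDr mulrC => h.
rewrite -ler_pdivrMl ?ltr0n ?fact_gt0//; apply: (le_trans h).
by rewrite gerBl.
Qed.

Lemma pow_geometric_bounded (q : R) (k : nat) : 0 < q < 1 ->
  exists2 K : R, 0 <= K & forall n : nat, n%:R ^+ k * q ^+ n <= K.
Proof.
move=> /andP[q0 q1]; pose c := - ln q.
have c0 : 0 < c by rewrite oppr_gt0 ln_lt0// q0.
have ck : 0 < c ^+ k by exact: exprn_gt0.
exists (k`!%:R / c ^+ k); first by rewrite divr_ge0// ltW.
move=> n; rewrite ler_pdivlMr// mulrC mulrA -exprMn.
have -> : q ^+ n = expR (- (c * n%:R)).
  by rewrite /c mulNr opprK mulrC expRM_natl lnK.
by apply: expR_pow_le; rewrite mulr_ge0// ltW.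
Qed.

End exponential_decay.

(** * The characteristic function near the origin *)

Section moments.
Context {R : realType} {d : measure_display} {Omega : measurableType d}.
Variables (P : probability Omega R) (T : Omega -> R).
Hypothesis mT : measurable_fun setT T.
Hypothesis iT4 : P.-integrable setT (EFin \o (fun w => T w ^+ 4)).

Lemma integrable_moment (k : nat) : (k <= 4)%N ->
  P.-integrable setT (EFin \o (fun w => T w ^+ k)).
Proof.
move=> k4; have i1 : P.-integrable setT (EFin \o (fun w => 1 + T w ^+ 4)).
  by apply: integrable_realD => //; exact: integrable_cst_prob.
apply: le_integrable i1 => //.
  by apply/measurable_EFinP; exact: measurable_funX.
move=> w _ /=; rewrite lee_fin normrX.
have t4 : T w ^+ 4 = `|T w| ^+ 4.
  by rewrite (exprM _ 2 2) [in RHS](exprM _ 2 2) real_normK ?num_real.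
have p4 : 0 <= 1 + `|T w| ^+ 4 by rewrite addr_ge0// exprn_ge0.
rewrite t4 (ger0_norm p4).
have [t1|t1] := leP `|T w| 1.
  by apply: (@le_trans _ _ 1); [rewrite exprn_ile1|rewrite lerDl exprn_ge0].
by apply: (@le_trans _ _ (`|T w| ^+ 4)); [rewrite ler_weXn2l// ltW|rewrite lerDr].
Qed.

Definition moment k : R := \int[P]_w (T w ^+ k).

Lemma expectation_poly4 (a0 a1 a2 a3 a4 : R) (f : Omega -> R) :
  (forall w, f w = a0 + a1 * T w ^+ 1 + a2 * T w ^+ 2 + a3 * T w ^+ 3 + a4 * T w ^+ 4) ->
  P.-integrable setT (EFin \o f) /\
  \int[P]_w f w = a0 + a1 * moment 1 + a2 * moment 2 + a3 * moment 3 + a4 * moment 4.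
Proof.
move=> /funext ->.
have i0 : P.-integrable setT (EFin \o (fun=> a0)) by exact: integrable_cst_prob.
have iZ a k : (k <= 4)%N -> P.-integrable setT (EFin \o (fun w => a * T w ^+ k)).
  by move=> k4; apply: integrable_realZ; exact: integrable_moment.
have i1 := integrable_realD i0 (iZ a1 1%N isT).
have i2 := integrable_realD i1 (iZ a2 2%N isT).
have i3 := integrable_realD i2 (iZ a3 3%N isT).
split; first exact: (integrable_realD i3 (iZ a4 4%N isT)).
rewrite RintegralD//; last exact: iZ.
rewrite RintegralD//; last exact: iZ.
rewrite RintegralD//; last exact: iZ.
rewrite RintegralD//; last exact: iZ.
rewrite !RintegralZl//; [|exact: integrable_moment..].
by rewrite expectation_cst.
Qed.

Lemma pow4D_le (x y : R) : (x + y) ^+ 4 <= 8 * x ^+ 4 + 8 * y ^+ 4.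
Proof.
have sq (a b : R) : (a + b) ^+ 2 <= 2 * a ^+ 2 + 2 * b ^+ 2.
  rewrite -subr_ge0 (_ : _ - _ = (a - b) ^+ 2) ?sqr_ge0//; ring.
have e (a : R) : a ^+ 4 = (a ^+ 2) ^+ 2 by rewrite -exprM.
rewrite !e; apply: (@le_trans _ _ ((2 * x ^+ 2 + 2 * y ^+ 2) ^+ 2)).
  rewrite lerXn2r ?nnegrE ?sqr_ge0//.
  by rewrite addr_ge0// mulr_ge0// sqr_ge0.
by apply: (le_trans (sq _ _)); lra.
Qed.

Variables v kap mu4 : R.
Hypothesis T1 : moment 1 = 0.
Hypothesis T2 : moment 2 = v.
Hypothesis T3 : moment 3 = kap.
Hypothesis T4 : moment 4 = mu4.
Hypothesis v0 : 0 < v.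

Let shift s := kap * s ^+ 3 / 6.

Let mu4_ge0 : 0 <= mu4.
Proof. by rewrite -T4; apply: Rintegral_ge0 => w _; rewrite exprn_even_ge0. Qed.

(** A sum of bounds for the coefficients of s^4, with b = [shift s]: [kap ^+ 2] for b^2,
    [8 * mu4 + 8 * kap ^+ 4] for the Taylor remainder (s T + b)^4, [v * |kap|] for s^2 b,
    [|kap| ^+ 3] for b^3, and the last term for the second order remainder of the Gaussian
    factor. *)
Definition cf_const : R :=
  kap ^+ 2 + 8 * mu4 + 8 * kap ^+ 4 + v * `|kap| + `|kap| ^+ 3 + expR 1 * v ^+ 2.

Lemma cf_const_ge0 : 0 <= cf_const.
Proof.
have v0' := ltW v0.
have k4 : 0 <= kap ^+ 4 by rewrite exprn_even_ge0.
have k3 : 0 <= `|kap| ^+ 3 by rewrite exprn_ge0.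
have vk := mulr_ge0 v0' (normr_ge0 kap).
have ev := mulr_ge0 (expR_ge0 1) (sqr_ge0 v).
have k2 := sqr_ge0 kap.
by rewrite /cf_const; do 5 ?[apply: addr_ge0 => //]; exact: mulr_ge0.
Qed.

(* The phase shift removes the third cumulant: after it the characteristic
   function is exp(- v s^2 / 2) up to O(s^4). *)
Lemma cf_local_expansion s : 0 < s <= 1 -> v * s ^+ 2 <= 2 ->
  `|\int[P]_w cos (s * T w + shift s) - expR (- (v * s ^+ 2 / 2))| <=
    cf_const * s ^+ 4 /\
  `|\int[P]_w sin (s * T w + shift s)| <= cf_const * s ^+ 4.
Proof.
move=> /andP[s0 s1] vs; set b := shift s.
have [ms mc] := @measurable_sin_cos R.
pose g w := s * T w + b.
have mg : measurable_fun setT g.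
  by apply: measurable_funD => //; exact: measurable_funM.
have ic : P.-integrable setT (EFin \o (fun w => cos (g w))).
  apply: (@bounded_integrable _ _ _ _ _ 1); last by move=> w; rewrite norm_sin_cos_le1.
  exact: (measurableT_comp mc).
have is_ : P.-integrable setT (EFin \o (fun w => sin (g w))).
  apply: (@bounded_integrable _ _ _ _ _ 1); last by move=> w; rewrite norm_sin_cos_le1.
  exact: (measurableT_comp ms).
have bs : `|b| <= `|kap| * s ^+ 3.
  have s30 : 0 <= s ^+ 3 by rewrite exprn_ge0// ltW.
  rewrite /b /shift -mulrA normrM ler_wpM2l// ger0_norm; last by rewrite divr_ge0.
  by rewrite ler_pdivrMr// ler_peMr//; lra.
have s4 k : (4 <= k)%N -> s ^+ k <= s ^+ 4 by move=> ?; rewrite ler_wiXn2l// ltW.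
have bk (k : nat) (j : nat) : (4 <= 3 * k + j)%N -> s ^+ j * `|b| ^+ k <= `|kap| ^+ k * s ^+ 4.
  move=> kj; apply: (@le_trans _ _ (s ^+ j * (`|kap| * s ^+ 3) ^+ k)).
    rewrite ler_wpM2l ?exprn_ge0 ?(ltW s0)// lerXn2r ?nnegrE//.
    by rewrite mulr_ge0// exprn_ge0// ltW.
  rewrite exprMn mulrCA ler_wpM2l ?exprn_ge0// -exprM -exprD s4//.
  by rewrite addnC.
have b2 : b ^+ 2 <= kap ^+ 2 * s ^+ 4.
  have := bk 2%N 0%N isT; rewrite expr0 mul1r !real_normK ?num_real//.
have b4 : b ^+ 4 <= kap ^+ 4 * s ^+ 4.
  have e (x : R) : x ^+ 4 = `|x| ^+ 4.
    by rewrite (exprM _ 2 2) [in RHS](exprM _ 2 2) real_normK ?num_real.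
  by have := bk 4%N 0%N isT; rewrite expr0 mul1r -!e.
have b1 : s ^+ 2 * `|b| <= `|kap| * s ^+ 4 by have := bk 1%N 2%N isT; rewrite !expr1.
have b3 : `|b| ^+ 3 <= `|kap| ^+ 3 * s ^+ 4 by have := bk 3%N 0%N isT; rewrite expr0 mul1r.
have [|iD eD] := @expectation_poly4 (8 * b ^+ 4) 0 0 0 (8 * s ^+ 4)
  (fun w => 8 * (s * T w) ^+ 4 + 8 * b ^+ 4) .
  by move=> w; ring.
have D w : g w ^+ 4 <= 8 * (s * T w) ^+ 4 + 8 * b ^+ 4 by exact: pow4D_le.
have s40 : 0 <= s ^+ 4 by rewrite exprn_ge0// ltW.
have nn1 : 0 <= kap ^+ 2 * s ^+ 4 by rewrite mulr_ge0// sqr_ge0.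
have nn2 : 0 <= mu4 * s ^+ 4 by rewrite mulr_ge0.
have nn3 : 0 <= kap ^+ 4 * s ^+ 4 by rewrite mulr_ge0// exprn_even_ge0.
have nn4 : 0 <= v * `|kap| * s ^+ 4 by rewrite !mulr_ge0// ltW.
have nn5 : 0 <= `|kap| ^+ 3 * s ^+ 4 by rewrite mulr_ge0// exprn_ge0.
have nn6 : 0 <= expR 1 * v ^+ 2 * s ^+ 4 by rewrite !mulr_ge0 ?expR_ge0// ltW.
rewrite /cf_const !mulrDl.
split.
- have [|i2 e2] := @expectation_poly4 (1 - b ^+ 2 / 2) (- (s * b)) (- (s ^+ 2 / 2)) 0 0
    (fun w => 1 - g w ^+ 2 / 2).
    by move=> w; rewrite /g; field.
  have h1 : `|\int[P]_w (cos (g w) - (1 - g w ^+ 2 / 2))| <= 8 * b ^+ 4 + 8 * s ^+ 4 * mu4.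
    have -> : 8 * b ^+ 4 + 8 * s ^+ 4 * mu4 = \int[P]_w (8 * (s * T w) ^+ 4 + 8 * b ^+ 4).
      by rewrite eD T4 !mul0r !addr0.
    apply: le_norm_expectation => //; first exact: integrable_realB.
    move=> w; apply: le_trans (D w).
    have -> : cos (g w) - (1 - g w ^+ 2 / 2) = cos (g w) - 1 + g w ^+ 2 / 2 by ring.
    exact: norm_cos_taylor2_le.
  rewrite RintegralB// e2 T1 T2 in h1.
  have h2 : `|expR (- (v * s ^+ 2 / 2)) - 1 - - (v * s ^+ 2 / 2)| <=
      expR 1 * (- (v * s ^+ 2 / 2)) ^+ 2.
    apply: norm_expR_taylor1_le; rewrite normrN ger0_norm; last first.
      by rewrite divr_ge0// mulr_ge0// ?sqr_ge0// ltW.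
    lra.
  have h3 : (- (v * s ^+ 2 / 2)) ^+ 2 = v ^+ 2 * s ^+ 4 / 4 by field.
  rewrite h3 in h2; set E := \int[P]_w cos _.
  rewrite -/E in h1; move: h1 h2; rewrite !ler_norml => /andP[p1 p2] /andP[p3 p4].
  have b20 : 0 <= b ^+ 2 by exact: sqr_ge0.
  by apply/andP; split; lra.
- have [|i2 e2] := @expectation_poly4 (b - b ^+ 3 / 6) (s - s * b ^+ 2 / 2)
     (- (s ^+ 2 * b / 2)) (- (s ^+ 3 / 6)) 0
    (fun w => g w - g w ^+ 3 / 6).
    by move=> w; rewrite /g; field.
  have h1 : `|\int[P]_w (sin (g w) - (g w - g w ^+ 3 / 6))| <= 8 * b ^+ 4 + 8 * s ^+ 4 * mu4.
    have -> : 8 * b ^+ 4 + 8 * s ^+ 4 * mu4 = \int[P]_w (8 * (s * T w) ^+ 4 + 8 * b ^+ 4).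
      by rewrite eD T4 !mul0r !addr0.
    apply: le_norm_expectation => //; first exact: integrable_realB.
    move=> w; apply: le_trans (D w).
    have -> : sin (g w) - (g w - g w ^+ 3 / 6) = sin (g w) - g w + g w ^+ 3 / 6 by ring.
    exact: norm_sin_taylor3_le.
  rewrite RintegralB// e2 T1 T2 T3 in h1; set E := \int[P]_w sin _.
  rewrite -/E in h1.
  (* Here [b] cancels kap s^3 / 6, the only term of order less than 4; this dictates the value of
     [shift]. *)
  have h2 : b - b ^+ 3 / 6 + (s - s * b ^+ 2 / 2) * 0 + - (s ^+ 2 * b / 2) * v +
     - (s ^+ 3 / 6) * kap + 0 * moment 4 = - (v * (s ^+ 2 * b) / 2) - b ^+ 3 / 6.
    by rewrite {1}/b /shift; field.
  rewrite h2 in h1.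
  have h3 : `|v * (s ^+ 2 * b)| <= v * `|kap| * s ^+ 4.
    rewrite normrM (gtr0_norm v0) -mulrA ler_wpM2l// ?(ltW v0)//.
    by rewrite normrM ger0_norm ?sqr_ge0.
  have h4 : `|b ^+ 3| <= `|kap| ^+ 3 * s ^+ 4 by rewrite normrX.
  move: h1 h3 h4; rewrite !ler_norml => /andP[p1 p2] /andP[p3 p4] /andP[p5 p6].
  by apply/andP; split; lra.
Qed.

(** The modulus bound exploits the gap between exp(- v s^2 / 2) and exp(- v s^2 / 4): it is at least
    a multiple of s^2, which absorbs the errors of order s^4 when s is small. *)
Lemma cf_local_bounds : exists2 delta : R, 0 < delta <= 1 &
  forall s, 0 < s <= delta ->
  let c := \int[P]_w cos (s * T w + shift s) in
  let e := \int[P]_w sin (s * T w + shift s) in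
  [/\ `|c - expR (- (v * s ^+ 2 / 2))| <= cf_const * s ^+ 4,
      `|e| <= cf_const * s ^+ 4 &
      c ^+ 2 + e ^+ 2 <= expR (- (v * s ^+ 2 / 4)) ^+ 2].
Proof.
have vp := v0; pose C := cf_const + 1.
have C1 : 1 <= C by rewrite lerDr cf_const_ge0.
have C0 : 0 < C by exact: lt_le_trans C1.
(* For s <= 1 / D the summand 1 + v gives s <= 1 and v s <= 1, and 32 C / v gives 32 C s^2 <= v,
   which is what the comparison [Cs] needs. *)
pose D := 1 + v + 32 * C / v.
have D1 : 1 + v <= D by rewrite lerDl divr_ge0 ?mulr_ge0// ltW.
have D2 : 32 * C / v <= D by rewrite lerDr; lra.
have D0 : 0 < D by lra.
exists D^-1; first by rewrite invr_gt0 D0/= invf_le1//; lra.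
move=> s /andP[s0 sD]; have sD1 : s * D <= 1 by rewrite -ler_pdivlMr// div1r.
have sv : s * (1 + v) <= 1 by apply: le_trans sD1; rewrite ler_wpM2l// ltW.
have svp : 0 < s * v by rewrite mulr_gt0.
have s1 : s <= 1 by lra.
have vs1 : v * s <= 1 by lra.
have vs2 : v * s ^+ 2 <= 1.
  rewrite expr2 mulrA; apply: (@le_trans _ _ (1 * 1)); last by rewrite mulr1.
  by rewrite ler_pM// ltW// mulrC.
have [|| h1 h2] := @cf_local_expansion s; [by rewrite s0|lra|].
split => //.
set c := \int[P]_w cos _ in h1 *; set e := \int[P]_w sin _ in h2 *.
pose x := v * s ^+ 2 / 4; set y := expR (- (v * s ^+ 2 / 4)).
have x0 : 0 <= x by rewrite divr_ge0// mulr_ge0 ?sqr_ge0// ltW.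
have y0 : 0 < y by exact: expR_gt0.
have y2 : expR (- (v * s ^+ 2 / 2)) = y ^+ 2.
  by rewrite /y -expRM_natl; congr expR; field.
have x1 : x <= 4^-1 by rewrite /x; lra.
have ylow : 2^-1 <= y.
  have := expR_ge1Dx (- x); rewrite -/y; lra.
have yup : x / 2 <= 1 - y.
  have e1 : 1 + x <= y^-1 by rewrite /y expRN invrK expR_ge1Dx.
  have : y * (1 + x) <= 1 by rewrite mulrC -ler_pdivlMr ?div1r.
  have : x * 2^-1 <= x * y by rewrite ler_wpM2l.
  lra.
have yy : x / 4 <= y - y ^+ 2.
  have -> : y - y ^+ 2 = y * (1 - y) by ring.
  have : 2^-1 * (x / 2) <= y * (1 - y) by rewrite ler_pM// divr_ge0.
  lra.
have Cs : 2 * (cf_const * s ^+ 4) <= x / 4.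
  rewrite /x.
  have s20 : 0 <= s ^+ 2 by exact: sqr_ge0.
  have -> : v * s ^+ 2 / 4 / 4 = s ^+ 2 * (v / 16) by field.
  have -> : 2 * (cf_const * s ^+ 4) = s ^+ 2 * (2 * cf_const * s ^+ 2) by ring.
  rewrite ler_wpM2l//.
  have h : s ^+ 2 * (32 * C) <= v.
    have : s * (32 * C / v) <= 1 by apply: le_trans sD1; rewrite ler_wpM2l// ltW.
    rewrite mulrA ler_pdivrMr// mul1r => h; apply: le_trans h.
    rewrite expr2 -mulrA ler_piMl//; first by rewrite mulr_ge0 ?ltW// mulr_gt0.
  have : 0 <= s ^+ 2 by [].
  rewrite /C in h; lra.
have cn : `|c| <= y ^+ 2 + cf_const * s ^+ 4.
  rewrite -y2 -[c](subrK (expR (- (v * s ^+ 2 / 2)))).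
  apply: (le_trans (ler_normD _ _)); rewrite addrC lerD//.
  by rewrite ger0_norm ?expR_ge0.
have ce : `|c| + `|e| <= y by lra.
apply: (@le_trans _ _ ((`|c| + `|e|) ^+ 2)); last first.
  by rewrite lerXn2r ?nnegrE// ?addr_ge0// ltW.
rewrite -(real_normK (num_real c)) -(real_normK (num_real e)) sqrrD.
by rewrite addrAC lerDl mulrn_wge0// mulr_ge0.
Qed.

End moments.

(** * Gaussian integrals over an initial interval *)

Section gaussian_integrals.
Context {R : realType}.
Notation mu := (@lebesgue_measure R).
Implicit Types (c delta s : R).

Lemma continuous_gauss c : continuous (fun s => expR (- (c * s ^+ 2))).
Proof.
move=> s; apply: continuous_comp; last exact: continuous_expR.
apply: cvgN; apply: cvgM; first exact: cvg_cst.
by apply: cvgM; exact: cvg_id.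
Qed.

Lemma is_derive_gauss c s :
  is_derive s 1 (fun s => expR (- (c * s ^+ 2))) (- (2 * c * s) * expR (- (c * s ^+ 2))).
Proof.
have d1 : is_derive s 1 (fun s => - (c * s ^+ 2)) (- (2 * c * s)).
  by apply: is_derive_eq; rewrite /GRing.scale/=; ring.
have := @is_derive1_comp R expR (fun s => - (c * s ^+ 2)) s _ _
   (is_derive_expR (- (c * s ^+ 2))) d1.
by rewrite mulrC.
Qed.

Lemma Rintegral_id_gauss c delta : 0 < c -> 0 < delta ->
  \int[mu]_(s in `]0, delta]) (s * expR (- (c * s ^+ 2))) <= (2 * c)^-1.
Proof.
move=> c0 d0; have cn0 : c != 0 by rewrite gt_eqF.
have dF s : is_derive s 1 (fun s => - (2 * c)^-1 * expR (- (c * s ^+ 2)))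
    (s * expR (- (c * s ^+ 2))).
  have ? := is_derive_gauss c s.
  by apply: is_derive_eq; rewrite /GRing.scale/=; field.
rewrite (Rintegral_FTC d0 dF).
  rewrite expr0n/= mulr0 oppr0 expR0.
  have e0 : 0 < expR (- (c * delta ^+ 2)) by exact: expR_gt0.
  have c20 : 0 < (2 * c)^-1 by rewrite invr_gt0 mulr_gt0.
  have := mulr_gt0 c20 e0; lra.
by move=> s; apply: cvgM; [exact: cvg_id|exact: continuous_gauss].
Qed.

(** The integrand is the derivative of s exp(- c s^2). The identity trades the weight s^2, which
    comes from the skewness, for the plain Gaussian integral and a boundary term that is
    exponentially small in c. *)
Lemma Rintegral_gauss_third c delta : 0 < c -> 0 < delta ->
  \int[mu]_(s in `]0, delta]) (expR (- (c * s ^+ 2)) * (1 - 2 * c * s ^+ 2)) =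
  delta * expR (- (c * delta ^+ 2)).
Proof.
move=> c0 d0.
have dF s : is_derive s 1 (fun s => s * expR (- (c * s ^+ 2)))
    (expR (- (c * s ^+ 2)) * (1 - 2 * c * s ^+ 2)).
  have ? := is_derive_gauss c s.
  by apply: is_derive_eq; rewrite /GRing.scale/=; ring.
rewrite (Rintegral_FTC d0 dF); first by rewrite mul0r subr0.
move=> s; apply: cvgM; first exact: continuous_gauss.
apply: cvgB; first exact: cvg_cst.
apply: cvgM; first exact: cvg_cst.
by apply: cvgM; exact: cvg_id.
Qed.

(** On []0, e]] the integrand is at least its value at [e]. With [e] = n^(-1/2) and [c] proportional
    to n, the bound is a constant times n^(-1/2), the true order of the integral. *)
Lemma Rintegral_gauss_ge c delta e : 0 <= c -> 0 < e <= delta ->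
  e * expR (- (c * e ^+ 2)) <= \int[mu]_(s in `]0, delta]) expR (- (c * s ^+ 2)).
Proof.
move=> c0 /andP[e0 ed].
have i1 := integrable_itv_oc 0 delta (@continuous_gauss c).
have me : measurable (`]0, e]%classic : set (measurableTypeR R)) by exact: measurable_itv.
have md : measurable (`]0, delta]%classic : set (measurableTypeR R)) by exact: measurable_itv.
have sub : `]0, e]%classic `<=` (`]0, delta]%classic : set (measurableTypeR R)).
  by move=> s /=; rewrite !in_itv/= => /andP[-> /le_trans]; exact.
have i2 := integrableS md me sub i1.
have -> : e * expR (- (c * e ^+ 2)) =
    \int[mu]_(s in `]0, e]) expR (- (c * e ^+ 2)).
  by rewrite Rintegral_itv_cst// ltW.
apply: (@le_trans _ _ (\int[mu]_(s in `]0, e]) expR (- (c * s ^+ 2)))).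
  have ic : mu.-integrable `]0, e] (EFin \o (fun=> expR (- (c * e ^+ 2)))).
    apply: (@bounded_integrable_itv _ e _ `|expR (- (c * e ^+ 2))|) => //.
  apply: (le_Rintegral me ic i2) => s /=; rewrite in_itv/= => /andP[s0 se].
  by rewrite ler_expR lerN2 ler_wpM2l// lerXn2r// ?nnegrE ltW.
rewrite -subr_ge0 (Rintegral_itvB i1) ?bnd_simp ?(ltW e0)//.
by apply: Rintegral_ge0 => s _; exact: expR_ge0.
Qed.

End gaussian_integrals.

Section pointwise.
Context {R : realType}.

(* [e] stands for E sin(s (S_n - m)); [omega / s] is the derivative of the phase. *)
Lemma integrand_estimate (C v kap M A s e m : R) (n : nat) :
  0 <= C -> 0 < v -> 0 <= M -> 1 <= A -> 0 < s <= 1 -> s <= A -> `|m| <= M ->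
  (1 <= n)%N ->
  let N : R := n.+1%:R in
  let omega := N * (kap * s ^+ 3 / 6) + s * m in
  let L := 16 * (`|kap| / 6) / v + M in
  `|e + expR (- (v * s ^+ 2 / 2)) ^+ n.+1 * sin omega| <=
    4 * C * s ^+ 4 * N * expR (- (v * s ^+ 2 / 4)) ^+ n ->
  `|(1 - s / A) * (e / s) +
    expR (- (v * N / 2 * s ^+ 2)) * (N * kap * s ^+ 2 / 6 + m)| <=
  (64 * C / v + L ^+ 3 + L) * (s * expR (- (v * N / 16 * s ^+ 2))).
Proof.
move=> C0 v0 M0 A1 /andP[s0 s1] sA mM n1 N omega L he.
have N2 : 2 <= N by rewrite /N ler_nat.
have vn0 : v != 0 by rewrite gt_eqF.
have sn0 : s != 0 by rewrite gt_eqF.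
have A0 : 0 < A by lra.
have An0 : A != 0 by rewrite gt_eqF.
(* In this unit [rho] is exp(- 8 z), and the power of exp(- v s^2 / 4) is at most exp(- 2 z) because
   n >= N / 2. One factor exp(- z) is kept for the result, and the others absorb powers of 1 + z. *)
pose z := v * N / 16 * s ^+ 2.
have z0 : 0 <= z by rewrite !mulr_ge0 ?invr_ge0 ?sqr_ge0// ltW//; lra.
have L0 : 0 <= L.
  by rewrite addr_ge0// divr_ge0 ?mulr_ge0 ?divr_ge0// ltW.
have Ez : 0 < expR (- z) by exact: expR_gt0.
have qn : expR (- (v * s ^+ 2 / 4)) ^+ n <= expR (- z) * expR (- z).
  rewrite -expRM_natl -expRD ler_expR.
  have -> : n%:R = N - 1 :> R by rewrite /N -natr1 addrK.
  rewrite /z; have : 0 <= (N - 2) * (v * s ^+ 2).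
    by rewrite mulr_ge0 ?mulr_ge0 ?sqr_ge0 ?subr_ge0// ltW.
  lra.
have rhoE : expR (- (v * s ^+ 2 / 2)) ^+ n.+1 = expR (- (v * N / 2 * s ^+ 2)).
  by rewrite -expRM_natl; congr expR; rewrite /N; field.
set rho := expR (- (v * N / 2 * s ^+ 2)) in rhoE *.
rewrite rhoE in he.
have rho0 : 0 < rho by exact: expR_gt0.
have E1 : expR (- z) <= 1 by rewrite -expR0 ler_expR oppr_le0.
have e1z : 1 + z <= expR z by exact: expR_ge1Dx.
have rho8 : rho = expR (- z) ^+ 8.
  by rewrite -expRM_natl; congr expR; rewrite /z; field.
have h1z : (1 + z) * expR (- z) <= 1.
  by rewrite expRN ler_pdivrMr ?expR_gt0// mul1r.
have zE : z * expR (- z) <= 1.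
  have := ltW Ez; lra.
have p1z : 0 <= (1 + z) * expR (- z) by rewrite mulr_ge0 ?addr_ge0// ltW.
have r3 : rho * (1 + z) ^+ 3 <= expR (- z).
  have -> : rho * (1 + z) ^+ 3 = ((1 + z) * expR (- z)) ^+ 3 * expR (- z) ^+ 4 * expR (- z).
    by rewrite rho8; ring.
  by rewrite ler_piMl ?(ltW Ez)// mulr_ile1 ?exprn_ge0 ?exprn_ile1 ?(ltW Ez).
have r1 : rho * (1 + z) <= expR (- z).
  have -> : rho * (1 + z) = ((1 + z) * expR (- z)) * expR (- z) ^+ 6 * expR (- z).
    by rewrite rho8; ring.
  by rewrite ler_piMl ?(ltW Ez)// mulr_ile1 ?exprn_ge0 ?exprn_ile1 ?(ltW Ez).
(* A bound for |omega| / s. As N s^2 = 16 z / v, it is at most [L] (1 + z), which explains the 16 in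
   [L]. *)
pose B := N * (`|kap| * s ^+ 2 / 6) + M.
have BL : B <= L * (1 + z).
  have -> : L * (1 + z) = (B + 16 * (`|kap| / 6) / v + M * z).
    by rewrite /L /B /z; field.
  have : 0 <= 16 * (`|kap| / 6) / v by rewrite divr_ge0 ?mulr_ge0 ?divr_ge0// ltW.
  have := mulr_ge0 M0 z0; lra.
have B0 : 0 <= B.
  rewrite addr_ge0// mulr_ge0 ?divr_ge0 ?mulr_ge0 ?sqr_ge0//; lra.
have oB : `|omega| <= s * B.
  have -> : omega = s * (N * (kap * s ^+ 2 / 6) + m) by rewrite /omega; field.
  rewrite normrM (gtr0_norm s0) ler_pM2l//.
  apply: (le_trans (ler_normD _ _)); rewrite lerD//.
  rewrite normrM [`|N|]ger0_norm; last by lra.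
  rewrite ler_wpM2l//.
  by rewrite normrM [`|kap * _|]normrM (ger0_norm (sqr_ge0 s)) [`|6^-1|]ger0_norm.
have w0 : 0 <= s / A by rewrite divr_ge0// ltW.
have w1 : 0 <= 1 - s / A by rewrite subr_ge0 ler_pdivrMr// mul1r.
(* Three errors: the Gaussian approximation of E sin, the linearisation of the sine, and the
   deviation of the Fejer weight from 1. *)
have -> : (1 - s / A) * (e / s) + rho * (N * kap * s ^+ 2 / 6 + m) =
    (1 - s / A) * ((e + rho * sin omega) / s) -
    (1 - s / A) * (rho * (sin omega - omega) / s) + s / A * (rho * omega / s).
  by rewrite /omega; field; rewrite ?An0 ?sn0.
have b1 : `|(1 - s / A) * ((e + rho * sin omega) / s)| <= 64 * C / v * (s * expR (- z)).
  rewrite normrM (ger0_norm w1).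
  apply: (@le_trans _ _ `|(e + rho * sin omega) / s|).
    by rewrite ler_piMl// gerBl.
  rewrite normrM normfV (gtr0_norm s0) ler_pdivrMr//.
  apply: (le_trans he).
  have -> : 64 * C / v * (s * expR (- z)) * s = 4 * C * s ^+ 2 * (16 / v) * expR (- z).
    by field.
  apply: (@le_trans _ _ (4 * C * s ^+ 4 * N * (expR (- z) * expR (- z)))).
    rewrite ler_wpM2l// !mulr_ge0 ?exprn_ge0// ?(ltW s0)//; lra.
  have -> : 4 * C * s ^+ 4 * N * (expR (- z) * expR (- z)) =
      4 * C * s ^+ 2 * (16 / v) * (z * expR (- z)) * expR (- z).
    by rewrite /z; field.
  rewrite ler_wpM2r ?(ltW Ez)// ler_piMr// !mulr_ge0 ?sqr_ge0 ?invr_ge0// ltW//.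
have b2 : `|(1 - s / A) * (rho * (sin omega - omega) / s)| <= L ^+ 3 * (s * expR (- z)).
  rewrite normrM (ger0_norm w1).
  apply: (@le_trans _ _ `|rho * (sin omega - omega) / s|).
    by rewrite ler_piMl// gerBl.
  rewrite normrM normfV (gtr0_norm s0) ler_pdivrMr// normrM (gtr0_norm rho0).
  apply: (@le_trans _ _ (rho * (s * B) ^+ 3)).
    rewrite ler_wpM2l ?(ltW rho0)// (le_trans (norm_sinBid_le _))//.
    by rewrite lerXn2r ?nnegrE// mulr_ge0// ltW.
  apply: (@le_trans _ _ (rho * (s ^+ 2 * (L * (1 + z)) ^+ 3))).
    rewrite ler_wpM2l ?(ltW rho0)// exprMn ler_pM ?exprn_ge0 ?(ltW s0)//.
      by rewrite ler_wiXn2l// ltW.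
    by rewrite lerXn2r ?nnegrE// (le_trans B0).
  have -> : rho * (s ^+ 2 * (L * (1 + z)) ^+ 3) = L ^+ 3 * s ^+ 2 * (rho * (1 + z) ^+ 3).
    by ring.
  have -> : L ^+ 3 * (s * expR (- z)) * s = L ^+ 3 * s ^+ 2 * expR (- z) by ring.
  by rewrite ler_wpM2l// mulr_ge0 ?exprn_ge0// ltW.
have b3 : `|s / A * (rho * omega / s)| <= L * (s * expR (- z)).
  have -> : s / A * (rho * omega / s) = rho * omega / A by field; rewrite ?An0 ?sn0.
  rewrite normrM normfV (gtr0_norm A0) ler_pdivrMr// normrM (gtr0_norm rho0).
  apply: (@le_trans _ _ (rho * (s * (L * (1 + z))))).
    rewrite ler_wpM2l ?(ltW rho0)// (le_trans oB)// ler_wpM2l// ltW//.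
  have -> : rho * (s * (L * (1 + z))) = L * s * (rho * (1 + z)) by ring.
  apply: (@le_trans _ _ (L * (s * expR (- z)))).
    by rewrite [leRHS]mulrA ler_wpM2l// mulr_ge0// ltW.
  by rewrite ler_peMr// !mulr_ge0// ltW.
rewrite -/z [leRHS]mulrDl [X in _ <= X + _]mulrDl.
apply: (le_trans (ler_normD _ _)); rewrite lerD//.
by apply: (le_trans (ler_normB _ _)); rewrite lerD.
Qed.

End pointwise.

Section interval_integrals.
Context {R : realType}.
Notation mu := (@lebesgue_measure R).

Lemma Rintegral_tail_le (f : R -> R) (delta A B : R) : 0 < delta <= A -> 0 <= B ->
  mu.-integrable `]0, A] (EFin \o f) ->
  (forall s, delta <= s <= A -> `|f s| <= B) ->
  `|\int[mu]_(s in `]0, A]) f s - \int[mu]_(s in `]0, delta]) f s| <= A * B.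
Proof.
move=> /andP[d0 dA] B0 fi fB.
rewrite (Rintegral_itvB fi) ?bnd_simp ?(ltW d0)//.
have mD : measurable (`]delta, A]%classic : set (measurableTypeR R)).
  exact: measurable_itv.
have sub : `]delta, A]%classic `<=` (`]0, A]%classic : set (measurableTypeR R)).
  by move=> s /=; rewrite !in_itv/= => /andP[ds ->]; rewrite andbT (lt_trans d0).
have mA : measurable (`]0, A]%classic : set (measurableTypeR R)) by exact: measurable_itv.
have fi' := integrableS mA mD sub fi.
have muD : mu `]delta, A] = (A - delta)%:E.
  rewrite lebesgue_measure_itv/= lte_fin; move: dA.
  by rewrite le_eqVlt => /predU1P[->|->//]; rewrite ltxx subrr.
have ic : mu.-integrable `]delta, A] (EFin \o (fun=> B)).
  apply: measurable_bounded_integrable => //.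
    by rewrite [X in (X < _)%E]muD ltry.
  exact: bounded_cst.
apply: (le_trans (le_normr_Rintegral mD fi')).
apply: (@le_trans _ _ (\int[mu]_(s in `]delta, A]) B)).
  apply: (le_Rintegral mD (integrable_norm fi') ic) => s /=.
  by rewrite in_itv/= => /andP[ds sA]; apply: fB; rewrite (ltW ds).
rewrite Rintegral_cst// [fine _](_ : _ = A - delta); last exact: (congr1 fine muD).
by rewrite mulrC ler_wpM2r// lerBlDr lerDl ltW.
Qed.

Lemma norm_Rintegral_itv_le (f : R -> R) (A B : R) : 0 < A ->
  mu.-integrable `]0, A] (EFin \o f) ->
  (forall s, s \in `]0, A] -> `|f s| <= B) ->
  `|\int[mu]_(s in `]0, A]) f s| <= A * B.
Proof.
move=> A0 fi fB.
have mA : measurable (`]0, A]%classic : set (measurableTypeR R)) by exact: measurable_itv.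
have ic : mu.-integrable `]0, A] (EFin \o (fun=> B)).
  by apply: (@bounded_integrable_itv _ A _ `|B|).
apply: (le_trans (le_normr_Rintegral mA fi)).
rewrite -Rintegral_itv_cst ?(ltW A0)//.
by apply: (le_Rintegral mA (integrable_norm fi) ic) => s sA; exact: fB.
Qed.

Lemma le_norm_Rintegral_itv (f g : R -> R) (A : R) :
  mu.-integrable `]0, A] (EFin \o f) -> mu.-integrable `]0, A] (EFin \o g) ->
  (forall s, s \in `]0, A] -> `|f s| <= g s) ->
  `|\int[mu]_(s in `]0, A]) f s| <= \int[mu]_(s in `]0, A]) g s.
Proof.
move=> fi gi fg.
have mA : measurable (`]0, A]%classic : set (measurableTypeR R)) by exact: measurable_itv.
apply: (le_trans (le_normr_Rintegral mA fi)).
by apply: (le_Rintegral mA (integrable_norm fi) gi) => s sA; exact: fg.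
Qed.

End interval_integrals.

(** * Fourier inversion for the sign of the centred sum *)

Section core.
Context {R : realType} {d : measure_display} {Omega : measurableType d}.
Variables (P : probability Omega R) (X : nat -> {mfun Omega >-> R}).
Notation mu := (@lebesgue_measure R).
Hypothesis indep : independent P X.
Hypothesis ident : forall i A, measurable A ->
  P (X i @^-1` A) = P (X 0%N @^-1` A).
Variable tau : R -> R.
Hypothesis mtau : measurable_fun setT tau.
Let T w := tau (X 0%N w).
Local Notation S := (partial_sum X tau).

Lemma partial_sum_affine (s b : R) n w :
  partial_sum X (fun x => s * tau x + b) n w = s * S n w + n%:R * b.
Proof.
rewrite /partial_sum big_split/= -mulr_sumr; congr (_ + _).
by rewrite sumr_const card_ord mulr_natl.
Qed.

Let measurable_affine s b : measurable_fun setT (fun x => s * tau x + b).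
Proof. by apply: measurable_funD => //; exact: measurable_funM. Qed.

(** The shift [b] of each summand is undone by the phase [omega]. It is left free: 0 for the high
    frequencies, kap s^3 / 6 near the origin. *)
Lemma expectation_shifted_sum (s b m : R) n :
  let g := fun x => s * tau x + b in let omega := n%:R * b + s * m in
  (\int[P]_w sin (s * (S n w - m)) = Esin P X g n * cos omega - Ecos P X g n * sin omega) *
  (\int[P]_w cos (s * (S n w - m)) = Ecos P X g n * cos omega + Esin P X g n * sin omega).
Proof.
move=> g omega; have [ms mc] := @measurable_sin_cos R.
have mS : measurable_fun setT (partial_sum X g n).
  by apply: measurable_partial_sum; exact: measurable_affine.
have is_ : P.-integrable setT (EFin \o (fun w => sin (partial_sum X g n w))).
  apply: (@bounded_integrable _ _ _ _ _ 1); last by move=> w; rewrite norm_sin_cos_le1.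
  exact: (measurableT_comp ms).
have ic : P.-integrable setT (EFin \o (fun w => cos (partial_sum X g n w))).
  apply: (@bounded_integrable _ _ _ _ _ 1); last by move=> w; rewrite norm_sin_cos_le1.
  exact: (measurableT_comp mc).
have e w : s * (S n w - m) = partial_sum X g n w - omega.
  by rewrite partial_sum_affine /omega; ring.
split.
- have -> : \int[P]_w sin (s * (S n w - m)) = \int[P]_w (cos omega * sin (partial_sum X g n w) - sin omega * cos (partial_sum X g n w)).
    by apply: eq_Rintegral => w _; rewrite e sinB; ring.
  rewrite RintegralB//; [|exact: integrable_realZ..].
  by rewrite !RintegralZl// -/(Esin P X g n) -/(Ecos P X g n); ring.
- have -> : \int[P]_w cos (s * (S n w - m)) = \int[P]_w (cos omega * cos (partial_sum X g n w) + sin omega * sin (partial_sum X g n w)).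
    by apply: eq_Rintegral => w _; rewrite e cosB; ring.
  rewrite RintegralD//; [|exact: integrable_realZ..].
  by rewrite !RintegralZl// -/(Esin P X g n) -/(Ecos P X g n); ring.
Qed.

Lemma norm_expectation_shifted_sum_le (s m q : R) n : 0 <= q ->
  (\int[P]_w cos (s * T w)) ^+ 2 + (\int[P]_w sin (s * T w)) ^+ 2 <= q ^+ 2 ->
  (`|\int[P]_w sin (s * (S n w - m))| <= 2 * q ^+ n) *
  (`|\int[P]_w cos (s * (S n w - m))| <= 2 * q ^+ n).
Proof.
move=> q0 hq.
have hq' : (\int[P]_w cos (s * T w + 0)) ^+ 2 + (\int[P]_w sin (s * T w + 0)) ^+ 2 <= q ^+ 2.
  by under eq_Rintegral do rewrite addr0; under [X in _ + X ^+ 2]eq_Rintegral do rewrite addr0.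
have [h1 h2] := norm_Ecos_Esin_le indep (measurable_affine s 0) ident n q0 hq'.
have [-> ->] := expectation_shifted_sum s 0 m n.
have two (a b x y : R) : `|a| <= q ^+ n -> `|b| <= q ^+ n -> `|x| <= 1 -> `|y| <= 1 ->
    `|a * x + b * y| <= 2 * q ^+ n.
  move=> ha hb hx hy; apply: (le_trans (ler_normD _ _)); rewrite mulr_natl mulr2n.
  by rewrite lerD// normrM -[leRHS]mulr1 ler_pM.
have [s1 c1] := norm_sin_cos_le1 (n%:R * 0 + s * m).
split; last exact: two.
by rewrite -mulrN; apply: two; rewrite ?normrN.
Qed.

Hypothesis iT4 : P.-integrable setT (EFin \o (fun w => T w ^+ 4)).
Variables v kap mu4 : R.
Hypothesis T1 : moment P T 1 = 0.
Hypothesis T2 : moment P T 2 = v.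
Hypothesis T3 : moment P T 3 = kap.
Hypothesis T4 : moment P T 4 = mu4.
Hypothesis v0 : 0 < v.
Hypothesis Tac : forall A : set R, measurable A -> mu A = 0%E ->
  P (T @^-1` A) = 0%E.

Let mT : measurable_fun setT T.
Proof. exact: measurableT_comp. Qed.

Lemma integrable_shifted_sum n m :
  P.-integrable setT (EFin \o (fun w => S n w - m)).
Proof.
have i0 : P.-integrable setT (EFin \o (fun w => tau (X 0%N w))).
  have := integrable_moment mT iT4 (isT : (1 <= 4)%N).
  by under eq_fun do rewrite expr1.
have ii i : P.-integrable setT (EFin \o (fun w => tau (X i w))).
  apply/integrableP; split.
    by apply/measurable_EFinP; exact: measurableT_comp.
  have /integrableP[_] := i0; apply: le_lt_trans.
  have mt : measurable_fun setT (fun x : R => `|(tau x)%:E|%E).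
    by apply: measurableT_comp => //; exact/measurable_EFinP.
  rewrite le_eqVlt; apply/orP; left; apply/eqP.
  transitivity (\int[distribution P (X i)]_x `|(tau x)%:E|)%E.
    by rewrite ge0_integral_distribution.
  transitivity (\int[distribution P (X 0%N)]_x `|(tau x)%:E|)%E.
    by apply: eq_measure_integral => A mA _; exact: ident.
  by rewrite ge0_integral_distribution.
apply: integrable_realB; last exact: integrable_cst_prob.
rewrite (_ : EFin \o _ = fun w => (\sum_(i < n) (tau (X i w))%:E)%E).
  by apply: integrable_sum => // i _; exact: ii.
by apply/funext => w; rewrite /= /partial_sum sumEFin.
Qed.

Let Esn n m s : R := \int[P]_w sin (s * (S n w - m)).

(** Telescoping for the shifted summands, with the Gaussian value as [rho] and the modulus bound of
    [cf_local_bounds] as [q]. The shifts add up to the phase that carries the skewness; the sine and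
    cosine parts contribute a factor 2 each. *)
Lemma sin_expectation_local : exists2 delta : R, 0 < delta <= 1 &
  forall n m s, 0 < s <= delta ->
  `|Esn n.+1 m s + expR (- (v * s ^+ 2 / 2)) ^+ n.+1 *
      sin (n.+1%:R * (kap * s ^+ 3 / 6) + s * m)| <=
   4 * cf_const v kap mu4 * s ^+ 4 * n.+1%:R * expR (- (v * s ^+ 2 / 4)) ^+ n.
Proof.
have [delta d01 H] := cf_local_bounds mT iT4 T1 T2 T3 T4 v0.
exists delta => // n m s sd; have [h1 h2 h3] := H s sd.
set rho := expR (- (v * s ^+ 2 / 2)) in h1 *.
set q := expR (- (v * s ^+ 2 / 4)) in h3 *.
set b := kap * s ^+ 3 / 6; set C := cf_const v kap mu4 * s ^+ 4 in h1 h2.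
have q0 : 0 < q by exact: expR_gt0.
have rq : 0 <= rho <= q.
  rewrite expR_ge0/= ler_expR.
  have := mulr_ge0 (ltW v0) (sqr_ge0 s); lra.
have [t1 t2] := Ecos_Esin_telescope indep (measurable_affine s b) ident n rq q0 h3 h1 h2.
rewrite /Esn (expectation_shifted_sum s b m n.+1).
set omega := n.+1%:R * b + s * m.
set Ec := Ecos _ _ _ _ in t1 *; set Es := Esin _ _ _ _ in t2 *.
have -> : Es * cos omega - Ec * sin omega + rho ^+ n.+1 * sin omega =
    Es * cos omega - (Ec - rho ^+ n.+1) * sin omega by ring.
have [s1 c1] := norm_sin_cos_le1 omega.
apply: (le_trans (ler_normB _ _)).
have -> : 4 * cf_const v kap mu4 * s ^+ 4 * n.+1%:R * q ^+ n =
    2 * C * n.+1%:R * q ^+ n + 2 * C * n.+1%:R * q ^+ n by rewrite /C; ring.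
by rewrite lerD// normrM -[leRHS]mulr1 ler_pM.
Qed.

(** The bandwidths n^2 and n make both smoothing errors O(1/n): the concentration term is 1/n times
    a bounded integral, and 4 A' / A is 4 / n. Beyond [delta] Cramer's condition takes over; below
    it the bound of [integrand_estimate] has an integral of order 1/n. Uniformity in bounded [m] is
    essential, since the points at which the estimate is used vary with n. *)
Lemma core_estimate : exists2 delta : R, 0 < delta <= 1 &
  forall M, 0 <= M -> exists2 K : R, 0 <= K & forall n m, (2 <= n)%N -> `|m| <= M ->
  exists2 I : R, 0 <= I &
  `|I * (fine (P [set w | m < S n w]) - fine (P [set w | S n w < m])) +
    (m + kap / (6 * v)) * \int[mu]_(s in `]0, delta]) expR (- (v * n%:R / 2 * s ^+ 2))|
  <= K / n%:R.
Proof.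
have [delta /andP[d0 d1] Hloc] := sin_expectation_local.
pose TT : {mfun Omega >-> R} := mfun_Sub (mem_set mT).
have [q q01 Hq] := @cramer_condition R _ _ P TT Tac delta d0.
have /andP[q0 q1] := q01.
(* The exponent 3 consists of the length n^2 of the frequency range and one more n for the rate
   1/n. *)
have [K0 K00 HK0] := pow_geometric_bounded 3 q01.
exists delta; first by rewrite d0.
move=> M M0.
have vp := v0.
have vn0 : v != 0 by rewrite gt_eqF.
have dn0 : delta != 0 by rewrite gt_eqF.
have C0 : 0 <= cf_const v kap mu4.
  exact: (cf_const_ge0 kap T4 v0).
pose L := 16 * (`|kap| / 6) / v + M.
have L0 : 0 <= L.
  by rewrite addr_ge0// divr_ge0 ?mulr_ge0 ?divr_ge0// ltW.
pose K1 := 64 * cf_const v kap mu4 / v + L ^+ 3 + L.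
have K10 : 0 <= K1.
  by rewrite !addr_ge0 ?exprn_ge0// divr_ge0 ?mulr_ge0// ltW.
(* In this order: the two smoothing errors, the tail of [f1], the local error, and the boundary term
   of the Gaussian integral. *)
pose K := 24 * (delta + 2 * K0) + 4 + 2 * K0 / delta + 8 * K1 / v +
  `|kap| / (3 * v ^+ 2 * delta).
have K_ge0 : 0 <= K.
  have dp := ltW d0; have vpp := ltW vp.
  have h1 : 0 <= 24 * (delta + 2 * K0) by rewrite mulr_ge0// addr_ge0// mulr_ge0.
  have h2 : 0 <= 2 * K0 / delta by rewrite divr_ge0// mulr_ge0.
  have h3 : 0 <= 8 * K1 / v by apply: divr_ge0 => //; exact: mulr_ge0.
  have h4 : 0 <= `|kap| / (3 * v ^+ 2 * delta).
    by rewrite divr_ge0// mulr_ge0// mulr_ge0// sqr_ge0.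
  by rewrite /K; lra.
exists K => // n m n2 mM.
case: n n2 => [//|k] k1; set n := k.+1.
pose N : R := n%:R.
have N2 : 2 <= N by rewrite /N ler_nat.
have N0 : 0 < N by lra.
have Nn0 : N != 0 by rewrite gt_eqF.
have A0 : 0 < N ^+ 2 by rewrite exprn_gt0.
have A1 : 1 <= N ^+ 2 by rewrite expr_ge1//; lra.
have mY : measurable_fun setT (fun w => S n w - m).
  by apply: measurable_funB => //; exact: measurable_partial_sum.
pose Y : {mfun Omega >-> R} := mfun_Sub (mem_set mY).
have iY : P.-integrable setT (EFin \o Y) by exact: integrable_shifted_sum.
have [I [I0 smooth]] := @smoothing_inequality _ _ _ P Y iY (N ^+ 2) N A0 N0.
exists I => //.
have [_ _ if1] := @expectation_fejer_primitive _ _ _ P Y iY (N ^+ 2) A0.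
have [_ [_ if2]] := @expectation_fejer _ _ _ P Y N N0.
pose f1 s := (1 - s / N ^+ 2) * (Esn n m s / s).
pose f2 s := (1 - s / N) * \int[P]_w cos (s * (S n w - m)).
have sets : ([set w | 0 < Y w] = [set w | m < S n w]) *
            ([set w | Y w < 0] = [set w | S n w < m]).
  by split; apply/seteqP; split=> w /=; rewrite ?subr_gt0 ?subr_lt0.
rewrite !sets in smooth.
set D := fine _ - fine _ in smooth *.
have {}smooth : `|I * D - \int[mu]_(s in `]0, N ^+ 2]) f1 s| <=
  24 / N * (\int[mu]_(s in `]0, N]) f2 s) + 4 * N / N ^+ 2 by exact: smooth.
have {}if1 : mu.-integrable `]0, N ^+ 2] (EFin \o f1) by exact: if1.
have {}if2 : mu.-integrable `]0, N] (EFin \o f2) by exact: if2.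
have dN : delta <= N by lra.
have NN2 : N <= N ^+ 2 by rewrite expr2 ler_peMl; lra.
have qn0 : 0 <= q ^+ n by rewrite exprn_ge0// ltW.
have qN3 : N ^+ 3 * q ^+ n <= K0 by exact: HK0.
have tails (s : R) : delta <= s -> (`|Esn n m s| <= 2 * q ^+ n) *
    (`|\int[P]_w cos (s * (S n w - m))| <= 2 * q ^+ n).
  by move=> ds; apply: norm_expectation_shifted_sum_le; [exact: ltW|exact: Hq].
have w01 (A s : R) : 0 < A -> 0 < s -> s <= A -> 0 <= 1 - s / A <= 1.
  by move=> A0' s0 sA; apply: fejer_weight_bound; rewrite in_itv/= s0.
have f2_tail := @Rintegral_tail_le R f2 delta N (2 * q ^+ n).
have {}f2_tail : `|\int[mu]_(s in `]0, N]) f2 s - \int[mu]_(s in `]0, delta]) f2 s|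
    <= N * (2 * q ^+ n).
  apply: f2_tail; rewrite ?d0 ?mulr_ge0//.
  move=> s /andP[ds sN]; have s0 : 0 < s by exact: lt_le_trans ds.
  have /andP[w0 w1] := w01 N s N0 s0 sN.
  rewrite /f2 normrM (ger0_norm w0) -[leRHS]mul1r ler_pM//.
  by rewrite (tails s ds).
have md : measurable (`]0, delta]%classic : set (measurableTypeR R)) by exact: measurable_itv.
have sub (B : R) : delta <= B -> `]0, delta]%classic `<=` (`]0, B]%classic : set (measurableTypeR R)).
  by move=> dB s /=; rewrite !in_itv/= => /andP[-> /le_trans]; exact.
have mI (B : R) : measurable (`]0, B]%classic : set (measurableTypeR R)) by exact: measurable_itv.
have if1d := integrableS (mI _) md (sub _ (le_trans dN NN2)) if1.
have if2d := integrableS (mI _) md (sub _ dN) if2.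
have f2_main : `|\int[mu]_(s in `]0, delta]) f2 s| <= delta * 1.
  apply: norm_Rintegral_itv_le => // s; rewrite in_itv/= => /andP[s0 sd].
  have /andP[w0 w1] := w01 N s N0 s0 (le_trans sd dN).
  rewrite /f2 normrM (ger0_norm w0) -[leRHS]mul1r ler_pM//.
  have [_ mc] := @measurable_sin_cos R.
  apply: norm_expectation_le; last by move=> w; rewrite norm_sin_cos_le1.
  by apply: (measurableT_comp mc); exact: measurable_funM.
have f1_tail : `|\int[mu]_(s in `]0, N ^+ 2]) f1 s - \int[mu]_(s in `]0, delta]) f1 s|
    <= N ^+ 2 * (2 * q ^+ n / delta).
  apply: Rintegral_tail_le; rewrite ?d0 ?(le_trans dN)//.
    by rewrite divr_ge0 ?mulr_ge0// ltW.
  move=> s /andP[ds sN]; have s0 : 0 < s by exact: lt_le_trans ds.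
  have /andP[w0 w1] := w01 _ s A0 s0 sN.
  rewrite /f1 normrM (ger0_norm w0) -[leRHS]mul1r ler_pM//.
  rewrite normrM normfV (gtr0_norm s0) ler_pM ?invr_ge0 ?(ltW s0)//.
    by rewrite (tails s ds).
  by rewrite lef_pV2 ?posrE.
pose c := v * N / 16; pose c2 := v * N / 2.
have c0 : 0 < c by rewrite divr_gt0// mulr_gt0.
have c20 : 0 < c2 by rewrite divr_gt0// mulr_gt0.
(* The main part of [f1] is [- g]. *)
pose g s := expR (- (c2 * s ^+ 2)) * (N * kap * s ^+ 2 / 6 + m).
have cg : continuous g.
  move=> s; apply: cvgM; first exact: continuous_gauss.
  apply: cvgD; last exact: cvg_cst.
  apply: cvgM; last exact: cvg_cst.
  apply: cvgM; first exact: cvg_cst.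
  by apply: cvgM; exact: cvg_id.
have ig := integrable_itv_oc 0 delta cg.
have cid : continuous (fun s : R => K1 * (s * expR (- (c * s ^+ 2)))).
  move=> s; apply: cvgM; first exact: cvg_cst.
  by apply: cvgM; [exact: cvg_id|exact: continuous_gauss].
have cid1 : continuous (fun s : R => s * expR (- (c * s ^+ 2))).
  by move=> s; apply: cvgM; [exact: cvg_id|exact: continuous_gauss].
have f1_main : `|\int[mu]_(s in `]0, delta]) (f1 s + g s)| <= K1 * (2 * c)^-1.
  have ifg : mu.-integrable `]0, delta] (EFin \o (fun s => f1 s + g s)).
    exact: (integrableD md if1d ig).
  apply: (le_trans (le_norm_Rintegral_itv ifg (integrable_itv_oc 0 delta cid) _)).
    move=> s; rewrite in_itv/= => /andP[s0 sd].
    apply: integrand_estimate => //; rewrite ?s0 ?(le_trans sd)//.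
      by rewrite (le_trans d1)//; lra.
    by apply: Hloc; rewrite s0.
  rewrite RintegralZl//; last exact: integrable_itv_oc.
  by rewrite ler_wpM2l// Rintegral_id_gauss.
pose J : R := \int[mu]_(s in `]0, delta]) expR (- (c2 * s ^+ 2)).
pose G : R := delta * expR (- (c2 * delta ^+ 2)).
(* As 2 [c2] = v N, the s^2 term of [g] is kap / (6 v) times the Gaussian minus the derivative of s
   exp(- c2 s^2). This is where kap / (6 v) joins [m]. *)
have g_int : \int[mu]_(s in `]0, delta]) g s =
    (m + kap / (6 * v)) * J - kap / (6 * v) * G.
  have cJ := @continuous_gauss R c2.
  have cG : continuous (fun s : R => expR (- (c2 * s ^+ 2)) * (1 - 2 * c2 * s ^+ 2)).
    move=> s; apply: cvgM; first exact: cJ.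
    apply: cvgB; first exact: cvg_cst.
    apply: cvgM; first exact: cvg_cst.
    by apply: cvgM; exact: cvg_id.
  rewrite /G -Rintegral_gauss_third// /J.
  have RZ (a : R) (h : R -> R) : continuous h ->
      a * \int[mu]_(s in `]0, delta]) h s = \int[mu]_(s in `]0, delta]) (a * h s).
    by move=> ch; rewrite RintegralZl//; exact: integrable_itv_oc.
  rewrite (RZ _ _ cJ) (RZ _ _ cG).
  have iZ (a : R) (h : R -> R) : continuous h -> mu.-integrable `]0, delta] (EFin \o (fun s => a * h s)).
    move=> ch; apply: integrable_itv_oc => s.
    by apply: cvgM; [exact: cvg_cst|exact: ch].
  rewrite -(RintegralB md (iZ _ _ cJ) (iZ _ _ cG)).
  apply: eq_Rintegral => s _; rewrite /g /c2; field.
  by rewrite vn0.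
have G0 : 0 <= G by rewrite mulr_ge0 ?expR_ge0// ltW.
have GN : G * N <= 2 / (v * delta).
  have z0 : 0 <= c2 * delta ^+ 2 by rewrite mulr_ge0 ?sqr_ge0// ltW.
  have := expR_pow_le 1 z0; rewrite expr1 => h.
  have -> : G * N = 2 / (v * delta) * (c2 * delta ^+ 2 * expR (- (c2 * delta ^+ 2))).
    by rewrite /G /c2; field; rewrite ?vn0 ?dn0.
  by rewrite ler_piMr// divr_ge0// mulr_ge0// ltW.
have dec : I * D + (m + kap / (6 * v)) * J =
    (I * D - \int[mu]_(s in `]0, N ^+ 2]) f1 s) +
    (\int[mu]_(s in `]0, N ^+ 2]) f1 s - \int[mu]_(s in `]0, delta]) f1 s) +
    \int[mu]_(s in `]0, delta]) (f1 s + g s) + kap / (6 * v) * G.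
  rewrite (RintegralD md if1d ig) g_int; ring.
set F2 := \int[mu]_(s in `]0, N]) f2 s in smooth f2_tail.
have F2le : F2 <= delta + 2 * K0.
  have qN : N * (2 * q ^+ n) <= 2 * K0.
    rewrite mulrCA ler_wpM2l// (le_trans _ qN3)// ler_wpM2r//.
    by rewrite (le_trans NN2)// ler_weXn2l//; lra.
  move: f2_tail f2_main; rewrite !ler_norml => /andP[_ h1] /andP[_ h2]; lra.
have e1 : (24 / N * F2 + 4 * N / N ^+ 2) * N = 24 * F2 + 4 by field.
have e2 : N ^+ 2 * (2 * q ^+ n / delta) * N = 2 / delta * (N ^+ 3 * q ^+ n).
  by field.
have e3 : K1 * (2 * c)^-1 * N = 8 * K1 / v.
  by rewrite /c; field; rewrite ?vn0 ?Nn0.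
have b4 : `|kap / (6 * v) * G| * N <= `|kap| / (3 * v ^+ 2 * delta).
  rewrite normrM (ger0_norm G0) normrM normfV [`|6 * v|]gtr0_norm ?mulr_gt0//.
  have -> : `|kap| / (3 * v ^+ 2 * delta) = `|kap| / (6 * v) * (2 / (v * delta)).
    by field; rewrite ?vn0 ?dn0.
  by rewrite -[leLHS]mulrA ler_wpM2l// divr_ge0// mulr_ge0// ltW.
have b2 : N ^+ 2 * (2 * q ^+ n / delta) * N <= 2 * K0 / delta.
  rewrite e2 [leRHS]mulrAC ler_wpM2l// divr_ge0// ltW//.
rewrite -/N -/c2 -/J dec ler_pdivlMr//.
apply: (@le_trans _ _ ((24 / N * F2 + 4 * N / N ^+ 2 +
  N ^+ 2 * (2 * q ^+ n / delta) + K1 * (2 * c)^-1 + `|kap / (6 * v) * G|) * N)).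
  rewrite ler_wpM2r ?(ltW N0)//.
  apply: (le_trans (ler_normD _ _)); rewrite lerD2r.
  apply: (le_trans (ler_normD _ _)); rewrite lerD//.
  by apply: (le_trans (ler_normD _ _)); rewrite lerD.
have sumN (x1 x2 x3 x4 : R) : (x1 + x2 + x3 + x4) * N = x1 * N + x2 * N + x3 * N + x4 * N.
  by rewrite !mulrDl.
rewrite sumN e1 e3 /K.
lra.
Qed.

End core.

Section median.
Context {R : realType} {d : measure_display} {Omega : measurableType d}.
Variables (P : probability Omega R) (X : nat -> {mfun Omega >-> R}).
Notation mu := (@lebesgue_measure R).

(** Suppose a median m is farther than C / sqrt n from - kap / (6 v), and let a be the endpoint of
    that interval on the side of m. Then P(S_n > a) - P(S_n < a) cannot have the sign opposite to a
    + kap / (6 v). The two terms in [core_estimate] do not cancel, and the second alone exceeds K /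
    n. *)
Lemma median_expansion (tau : R -> R) (v kap : R) :
  independent P X ->
  (forall i A, measurable A -> P (X i @^-1` A) = P (X 0%N @^-1` A)) ->
  measurable_fun setT tau ->
  let T w := tau (X 0%N w) in
  P.-integrable setT (EFin \o (fun w => T w ^+ 4)) ->
  moment P T 1 = 0 -> moment P T 2 = v -> moment P T 3 = kap -> 0 < v ->
  (forall A : set R, measurable A -> mu A = 0%E -> P (T @^-1` A) = 0%E) ->
  exists2 C : R, 0 <= C & \forall n \near \oo, forall m : R,
    fine (P [set w | partial_sum X tau n w <= m]) = 2^-1 ->
    `|m + kap / (6 * v)| <= C / Num.sqrt n%:R.
Proof.
move=> indep ident mtau T iT4 T1 T2 T3 v0 Tac.
have [delta /andP[d0 d1] core] :=
  core_estimate indep ident mtau iT4 T1 T2 T3 erefl v0 Tac.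
(* The trial points - c +- L / sqrt n have absolute value at most [M] once L <= sqrt n. *)
pose c := kap / (6 * v); pose M := `|c| + 1.
have [|K K0 HK] := core M; first by rewrite addr_ge0.
(* The Gaussian integral is at least [c0] / sqrt n. With [L] = (K + 1) / c0, its product with L /
   sqrt n is at least (K + 1) / n, strictly above the error K / n. *)
pose c0 := expR (- (v / 2)); have c00 : 0 < c0 by exact: expR_gt0.
pose L := (K + 1) / c0.
have L0 : 0 < L by rewrite divr_gt0// ltr_wpDl.
exists L; first exact: ltW.
near=> n => m mP; set sn := Num.sqrt n%:R.
have n2 : (2 <= n)%N by near: n; exact: nbhs_infty_ge.
have n0 : 0 < n%:R :> R by rewrite ltr0n (leq_trans _ n2).
have sn0 : 0 < sn by rewrite sqrtr_gt0.
have sn2 : sn ^+ 2 = n%:R by rewrite sqr_sqrtr// ltW.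
have snn0 : sn != 0 by rewrite gt_eqF.
have large (z : R) : 0 < z -> z ^+ 2 <= n%:R -> z <= sn.
  move=> z0; rewrite -sn2 => h.
  by rewrite -(@ler_pXn2r _ 2%N)// nnegrE ltW.
have snL : L <= sn.
  apply: large => //; near: n; exact: nbhs_infty_ger.
have snd : sn^-1 <= delta.
  rewrite invf_ple ?posrE//; apply: large; first by rewrite invr_gt0.
  near: n; exact: nbhs_infty_ger.
set J := fun s => expR (- (v * n%:R / 2 * s ^+ 2)).
have Jge : c0 / sn <= \int[mu]_(s in `]0, delta]) expR (- (v * n%:R / 2 * s ^+ 2)).
  have -> : c0 / sn = sn^-1 * expR (- (v * n%:R / 2 * sn^-1 ^+ 2)).
    rewrite mulrC; congr (_ * expR (- _)); rewrite -sn2; field.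
    by rewrite snn0.
  apply: Rintegral_gauss_ge; first by rewrite divr_ge0// mulr_ge0// ltW.
  by rewrite invr_gt0 sn0.
have LJ : (K + 1) / n%:R <=
    L / sn * \int[mu]_(s in `]0, delta]) expR (- (v * n%:R / 2 * s ^+ 2)).
  have -> : (K + 1) / n%:R = L / sn * (c0 / sn).
    by rewrite -sn2 /L; field; rewrite snn0 gt_eqF.
  by rewrite ler_wpM2l// divr_ge0// ltW.
have K1n : K / n%:R < (K + 1) / n%:R by rewrite ltr_pM2r ?invr_gt0// ltrDl.
have Lsn : L / sn <= 1 by rewrite ler_pdivrMr// mul1r.
have Lsn0 : 0 < L / sn by rewrite divr_gt0.
have mS : measurable_fun setT (partial_sum X tau n) by exact: measurable_partial_sum.
have mle a : measurable [set w | partial_sum X tau n w <= a].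
  have := mS measurableT `]-oo, a]%classic (measurable_itv _).
  by rewrite setTI; congr measurable; apply/seteqP; split=> w/=; rewrite in_itv.
have mlt a : measurable [set w | partial_sum X tau n w < a].
  have := mS measurableT `]-oo, a[%classic (measurable_itv _).
  by rewrite setTI; congr measurable; apply/seteqP; split=> w/=; rewrite in_itv.
have gtE a : fine (P [set w | a < partial_sum X tau n w]) =
    1 - fine (P [set w | partial_sum X tau n w <= a]).
  have -> : [set w | a < partial_sum X tau n w] =
      ~` [set w | partial_sum X tau n w <= a].
    by apply/seteqP; split=> w /=; [rewrite ltNge => /negP|move/negP; rewrite -ltNge].
  by rewrite probability_setC// fineB// ?fin_num_measure.
have mono (A B : set Omega) : measurable A -> measurable B -> A `<=` B ->
    fine (P A) <= fine (P B).
  move=> mA mB AB; apply: fine_le; rewrite ?fin_num_measure//.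
  by apply: le_measure; rewrite ?inE.
rewrite -/c ler_norml; apply/andP; split.
- rewrite leNgt; apply/negP => hm; pose a := - c - L / sn.
  have ma : m < a by rewrite /a; lra.
  have [|I I0] := HK n a n2.
    rewrite /a /M -opprD normrN (le_trans (ler_normD _ _))// lerD2l.
    by rewrite gtr0_norm.
  have le1 : fine (P [set w | a < partial_sum X tau n w]) <= 2^-1.
    rewrite gtE; have : 2^-1 <= fine (P [set w | partial_sum X tau n w <= a]).
      by rewrite -mP; apply: mono => // w /= /le_trans; apply; exact: ltW.
    lra.
  have ge1 : 2^-1 <= fine (P [set w | partial_sum X tau n w < a]).
    by rewrite -mP; apply: mono => // w /= wm; exact: le_lt_trans ma.
  have ID : I * (fine (P [set w | a < partial_sum X tau n w]) -
                 fine (P [set w | partial_sum X tau n w < a])) <= 0.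
    by rewrite mulr_ge0_le0// subr_le0 (le_trans le1).
  have -> : a + kap / (6 * v) = - (L / sn) by rewrite /a /c; ring.
  rewrite ler_norml => /andP[h _].
  move: h; rewrite mulNr; lra.
- rewrite leNgt; apply/negP => hm; pose a := - c + L / sn.
  have ma : a < m by rewrite /a; lra.
  have [|I I0] := HK n a n2.
    rewrite /a /M (le_trans (ler_normD _ _))// normrN lerD2l.
    by rewrite gtr0_norm.
  have le1 : 2^-1 <= fine (P [set w | a < partial_sum X tau n w]).
    rewrite gtE; have : fine (P [set w | partial_sum X tau n w <= a]) <= 2^-1.
      by rewrite -mP; apply: mono => // w /= /le_trans; apply; exact: ltW.
    lra.
  have ge1 : fine (P [set w | partial_sum X tau n w < a]) <= 2^-1.
    by rewrite -mP; apply: mono => // w /= wm; exact/ltW/(lt_trans wm).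
  have ID : 0 <= I * (fine (P [set w | a < partial_sum X tau n w]) -
                 fine (P [set w | partial_sum X tau n w < a])).
    by rewrite mulr_ge0// subr_ge0 (le_trans ge1).
  have -> : a + kap / (6 * v) = L / sn by rewrite /a /c; ring.
  rewrite ler_norml => /andP[_ h]; lra.
Unshelve. all: by end_near. Qed.

End median.

(** * Exponential families *)

Section density_expectation.
Context {R : realType} {d : measure_display} {Omega : measurableType d}.
Variables (P : probability Omega R) (Y : {mfun Omega >-> R}) (p : R -> R).
Notation mu := (@lebesgue_measure R).
Hypothesis mp : measurable_fun (setT : set (measurableTypeR R)) p.
Hypothesis Yp : has_density P Y p.

(** [has_density] determines the law of [Y] on sets only. It identifies [p] almost everywhere with
    the Radon-Nikodym derivative, for which the change of variables is available. *)
Lemma expectation_density (f : R -> R) : measurable_fun setT f ->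
  (forall x, 0 <= f x) ->
  (\int[P]_w (f (Y w))%:E = \int[mu]_x (f x * p x)%:E)%E.
Proof.
move=> mf f0; have mY' : measurable_fun setT (Y : Omega -> measurableTypeR R).
  by move=> mT A mA; exact: (measurable_funPT Y).
pose Y' : {mfun Omega >-> measurableTypeR R} :=
  @mfun_Sub _ _ Omega (measurableTypeR R) Y (mem_set mY').
pose nu := distribution P Y'.
have mf' : measurable_fun (setT : set (measurableTypeR R)) (EFin \o f).
  by apply/measurable_EFinP.
have mp' : measurable_fun (setT : set (measurableTypeR R)) (EFin \o p).
  by apply/measurable_EFinP.
have numu : nu `<< mu.
  apply/null_content_dominatesP => A mA A0.
  transitivity (\int[mu]_(x in A) (p x)%:E)%E; first exact: Yp.
  by apply: null_set_integral => //; exact: measurable_funTS.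
pose g := Radon_Nikodym_SigmaFinite.f nu mu.
have gi := Radon_Nikodym_SigmaFinite.f_integrable numu.
have gp : ae_eq mu setT g (EFin \o p).
  apply: integral_ae_eq => // A _ mA.
  rewrite -(Radon_Nikodym_SigmaFinite.f_integral numu)//; exact: Yp.
transitivity (\int[nu]_x (EFin \o f) x)%E.
  by rewrite ge0_integral_distribution// => x; rewrite lee_fin.
rewrite -(Radon_Nikodym_SigmaFinite.change_of_variables numu)//.
apply: ae_eq_integral => //.
- by apply: emeasurable_funM => //; exact: (measurable_int mu gi).
- by under eq_fun do rewrite EFinM; exact: emeasurable_funM.
- by under [X in ae_eq _ _ _ X]eq_fun do rewrite EFinM; exact: ae_eqe_mul2l.
Qed.

End density_expectation.

Section expectation_gt0.
Context {R : realType} {d : measure_display} {Omega : measurableType d}.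
Variable P : probability Omega R.

Lemma expectation_gt0 (f : Omega -> R) : P.-integrable setT (EFin \o f) ->
  (forall w, 0 <= f w) -> P [set w | f w = 0] = 0%E -> 0 < \int[P]_w f w.
Proof.
move=> fi f0 Pf; rewrite lt_def Rintegral_ge0// andbT; apply/eqP => If.
have mf : measurable_fun setT (EFin \o f) by exact: measurable_int fi.
have mZ : measurable [set w | f w = 0].
  have /measurable_EFinP mf' := mf.
  rewrite -[X in measurable X]setTI.
  by have := mf' measurableT [set 0] (measurable_set1 0).
have : ae_eq P setT (EFin \o f) (cst 0%E).
  apply/(ae_eq_integral_abs P measurableT mf).
  have e : (\int[P]_w `|(EFin \o f) w| = \int[P]_w (f w)%:E)%E.
    by apply: eq_integral => w _ /=; rewrite ger0_norm.
  rewrite e -(@fineK _ (\int[P]_w (f w)%:E)%E); last exact: integrable_fin_num.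
  by rewrite -[fine _]/(\int[P]_w f w) If.
move=> [N [mN N0 sub]].
have : (P setT <= P N + P [set w | f w = 0%R])%E.
  apply: (@le_trans _ _ (P (N `|` [set w | f w = 0]))); last exact: measureU2.
  apply: le_measure; rewrite ?inE//; first exact: measurableU.
  move=> w _; have [fw|fw] := pselect (f w = 0); first by right.
  by left; apply: sub => /= /(_ I) [].
by rewrite N0 Pf adde0 probability_setT leNgt lte01.
Qed.

End expectation_gt0.

(** * Exponential tilting and cumulants *)

Section tilting.
Context {R : realType} {d : measure_display} {Omega : measurableType d}.
Variables (P : probability Omega R) (t : Omega -> R).
Hypothesis mt : measurable_fun setT t.
Variable rho : R.
Hypothesis rho0 : 0 < rho.
Hypothesis it : forall h, `|h| <= 2 * rho ->
  P.-integrable setT (EFin \o (fun w => expR (h * t w))).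

Definition tilted_moment (k : nat) (h : R) : R := \int[P]_w (t w ^+ k * expR (h * t w)).

(** A majorant for all |h| <= [rho]: |t|^k is at most k! / rho^k exp(rho |t|), and exp(h t) is at
    most exp(rho |t|). Their product calls for exponential moments up to 2 [rho]. *)
Let G k w : R := k`!%:R / rho ^+ k * (expR (2 * rho * t w) + expR (- (2 * rho) * t w)).

Let iG k : P.-integrable setT (EFin \o G k).
Proof.
have r := rho0.
apply: integrable_realZ; apply: integrable_realD; apply: it.
  by rewrite ger0_norm// mulr_ge0// ltW.
by rewrite normrN ger0_norm// mulr_ge0// ltW.
Qed.

Let tilted_bound k h w : `|h| <= rho -> `|t w ^+ k * expR (h * t w)| <= G k w.
Proof.
move=> hr; have r := rho0; rewrite normrM normrX (ger0_norm (expR_ge0 _)).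
set x := `|t w|.
have x0 : 0 <= x by exact: normr_ge0.
have e1 : expR (h * t w) <= expR (rho * x).
  rewrite ler_expR (le_trans (ler_norm _))// normrM ler_wpM2r//.
have e2 : x ^+ k <= k`!%:R / rho ^+ k * expR (rho * x).
  have rx : 0 <= rho * x by rewrite mulr_ge0// ltW.
  have := expR_pow_le k rx; rewrite expRN ler_pdivrMr ?expR_gt0// exprMn => h1.
  by rewrite mulrAC ler_pdivlMr ?exprn_gt0// mulrC.
have e3 : expR (2 * rho * x) <= expR (2 * rho * t w) + expR (- (2 * rho) * t w).
  rewrite /x; have [t0|t0] := leP 0 (t w).
    by rewrite ger0_norm// lerDl expR_ge0.
  by rewrite ltr0_norm// mulrN mulNr lerDr expR_ge0.
apply: (@le_trans _ _ (k`!%:R / rho ^+ k * expR (rho * x) * expR (rho * x))).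
  by rewrite ler_pM ?exprn_ge0 ?expR_ge0.
rewrite /G -mulrA ler_wpM2l//; first by rewrite divr_ge0// exprn_ge0// ltW.
rewrite -expRD; have -> : rho * x + rho * x = 2 * rho * x by ring.
exact: e3.
Qed.

Let mtilt k h : measurable_fun setT (fun w => t w ^+ k * expR (h * t w)).
Proof.
apply: measurable_funM; first exact: measurable_funX.
by apply: (measurableT_comp (@measurable_expR R)); exact: measurable_funM.
Qed.

Lemma integrable_tilted k h : `|h| <= rho ->
  P.-integrable setT (EFin \o (fun w => t w ^+ k * expR (h * t w))).
Proof.
move=> hr; apply: (le_integrable _ _ _ (iG k)) => //.
  by apply/measurable_EFinP; exact: mtilt.
move=> w _ /=; rewrite lee_fin (le_trans (tilted_bound k w hr))// ler_norm//.
Qed.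

Lemma is_derive_tilted_moment (k : nat) (h : R) : `|h| < rho ->
  is_derive h 1 (tilted_moment k) (tilted_moment k.+1 h).
Proof.
move=> hr; pose f h w := t w ^+ k * expR (h * t w).
have df (y : R) w : is_derive y 1 (f^~ w) (t w ^+ k.+1 * expR (y * t w)).
  have de : is_derive y 1 (fun y => expR (y * t w)) (t w * expR (y * t w)).
    under eq_fun do rewrite mulrC.
    rewrite [y * _]mulrC; apply: is_derive_scaled_comp; exact: is_derive_expR.
  by apply: is_derive_eq; rewrite /GRing.scale/= exprS; ring.
have Ih : (`] - rho, rho[)%classic h by rewrite /= in_itv/= -ltr_norml.
have intf y : (`] - rho, rho[)%classic y -> P.-integrable setT (EFin \o f y).
  rewrite /= in_itv/= -ltr_norml => /ltW yr; exact: integrable_tilted.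
have derf y w : (`] - rho, rho[)%classic y -> [set: Omega] w -> derivable (f^~ w) y 1.
  by move=> _ _; have [] := df y w.
have df1 y w : partial1of2 f y w = t w ^+ k.+1 * expR (y * t w).
  by rewrite partial1of2E; have ? := df y w; exact: derive_val.
have G_ub y w : (`] - rho, rho[)%classic y -> [set: Omega] w ->
    `|partial1of2 f y w| <= G k.+1 w.
  by rewrite /= in_itv/= -ltr_norml => /ltW yr _; rewrite df1 tilted_bound.
have G0 w : 0 <= G k.+1 w.
  have r := rho0; rewrite mulr_ge0 ?addr_ge0 ?expR_ge0// divr_ge0// exprn_ge0// ltW//.
apply: DeriveDef.
  exact: (derivable_under_integral measurableT Ih intf derf G0 (iG k.+1) G_ub).
rewrite -derive1E.
rewrite (differentiation_under_integral measurableT Ih intf derf G0 (iG k.+1) G_ub).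
by apply: eq_Rintegral => w _; rewrite df1.
Qed.

Lemma tilted_moment_gt0 h : `|h| <= rho -> 0 < tilted_moment 0 h.
Proof.
move=> hr; apply: expectation_gt0; first exact: integrable_tilted.
  by move=> w; rewrite expr0 mul1r expR_ge0.
rewrite (_ : [set w | _] = set0) ?measure0// -subset0 => w /=.
by rewrite expr0 mul1r => /eqP; rewrite gt_eqF// expR_gt0.
Qed.

Lemma tilted_moment0 k : tilted_moment k 0 = moment P t k.
Proof. by apply: eq_Rintegral => w _; rewrite mul0r expR0 mulr1. Qed.

End tilting.

Section cumulants.
Context {R : realType} {d : measure_display} {Omega : measurableType d}.
Variables (F : expfam R) (P : probability Omega R) (Y : {mfun Omega >-> R}).
Notation mu := (@lebesgue_measure R).
Variable e0 : R.
Hypothesis Yd : has_density P Y (density F e0).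
Let t w := stat F (Y w).

Lemma measurable_stat_comp : measurable_fun setT t.
Proof. by apply: (measurableT_comp (@measurable_stat R F)). Qed.

Lemma measurable_density e :
  measurable_fun (setT : set (measurableTypeR R)) (density F e).
Proof.
apply: measurable_funM; first exact: measurable_indic (@measurable_support R F).
apply: (measurableT_comp (@measurable_expR R)).
apply: measurable_funB; last exact: (@measurable_logbase R F).
apply: measurable_funB => //.
apply: measurable_funM => //; exact: (@measurable_stat R F).
Qed.

(** The tilt of the density by exp(h t) is the integrand of [laplace] at e0 + h, up to
    normalisation. In extended reals the identity yields both integrability and the value. *)
Lemma expectation_exp_stat h : (\int[P]_w (expR (h * t w))%:E =
  (expR (- psibar F e0))%:E * laplace F (e0 + h))%E.
Proof.
pose f x := expR (h * stat F x).
have mf : measurable_fun setT f.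
  apply: (measurableT_comp (@measurable_expR R)); apply: measurable_funM => //.
  exact: (@measurable_stat R F).
transitivity (\int[P]_w (f (Y w))%:E)%E; first by [].
rewrite (expectation_density (measurable_density e0) Yd mf); last first.
  by move=> x; exact: expR_ge0.
rewrite /laplace -ge0_integralZl_EFin//; last 2 first.
- exact: (@measurable_support R F).
- apply/measurable_EFinP; apply: measurable_funTS.
  apply: (measurableT_comp (@measurable_expR R)).
  apply: measurable_funB; last exact: (@measurable_logbase R F).
  by apply: measurable_funM => //; exact: (@measurable_stat R F).
rewrite [RHS]integral_mkcond; apply: eq_integral => x _.
rewrite patchE /density indicE; case: ifPn => xS; last by rewrite mul0r mulr0.
rewrite mul1r /f -EFinM -!expRD; congr (EFin (expR _)); ring.
Qed.

Lemma integrable_exp_stat h : nat_space F (e0 + h) ->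
  P.-integrable setT (EFin \o (fun w => expR (h * t w))).
Proof.
move=> hN; apply/integrableP; split.
  apply/measurable_EFinP; apply: (measurableT_comp (@measurable_expR R)).
  by apply: measurable_funM => //; exact: measurable_stat_comp.
have -> : (\int[P]_w `|(EFin \o (fun w => expR (h * t w))) w| =
    \int[P]_w (expR (h * t w))%:E)%E.
  by apply: eq_integral => w _ /=; rewrite ger0_norm// expR_ge0.
by rewrite expectation_exp_stat lte_mul_pinfty// lee_fin expR_ge0.
Qed.

Lemma psibar_shift h : nat_space F (e0 + h) ->
  psibar F (e0 + h) = psibar F e0 + ln (tilted_moment P t 0 h).
Proof.
move=> hN; have ih := integrable_exp_stat hN.
have M0 : tilted_moment P t 0 h = \int[P]_w expR (h * t w).
  by apply: eq_Rintegral => w _; rewrite expr0 mul1r.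
have Mp : 0 < \int[P]_w expR (h * t w).
  apply: (expectation_gt0 ih) => [w|]; first exact: expR_ge0.
  rewrite (_ : [set w | _] = set0) ?measure0// -subset0 => w /= /eqP.
  by rewrite gt_eqF// expR_gt0.
have lfin : laplace F (e0 + h) \is a fin_num.
  rewrite ge0_fin_numE//; apply: integral_ge0 => x _; rewrite lee_fin; exact: expR_ge0.
have : \int[P]_w expR (h * t w) = expR (- psibar F e0) * fine (laplace F (e0 + h)).
  by rewrite /Rintegral expectation_exp_stat fineM.
rewrite M0 => e; have fl : fine (laplace F (e0 + h)) =
    expR (psibar F e0) * \int[P]_w expR (h * t w).
  by rewrite e mulrA -expRD subrr expR0 mul1r.
by rewrite {1}/psibar fl lnM ?posrE ?expR_gt0// expRK.
Qed.

Hypothesis F_regular : regular F.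
Hypothesis He0 : nat_space F e0.

(** Near [e0], [psibar] is a constant plus the logarithm of the moment generating function of the
    statistic, so its derivatives are the cumulants, written here as polynomials in the moments
    under the member e. *)
Lemma cumulant_functions : exists rho B : R, exists c1 c2 c3 c4 : R -> R,
  [/\ 0 < rho,
   forall e, `|e - e0| < rho ->
    [/\ nat_space F e, is_derive e 1 (psibar F) (c1 e), is_derive e 1 c1 (c2 e),
        is_derive e 1 c2 (c3 e) & is_derive e 1 c3 (c4 e) /\ `|c4 e| <= B],
   forall k, P.-integrable setT (EFin \o (fun w => t w ^+ k)) &
   [/\ c1 e0 = moment P t 1, c2 e0 = moment P t 2 - moment P t 1 ^+ 2 &
       c3 e0 = moment P t 3 - 3 * moment P t 1 * moment P t 2 + 2 * moment P t 1 ^+ 3]].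
Proof.
have /nbhs_ballP[r /= r0 Hr] := open_nbhs_nbhs (conj F_regular He0).
(* The tilting lemmas need integrability up to 2 [rho], which is below [r]. *)
pose rho := r / 3; have rho0 : 0 < rho by rewrite divr_gt0.
have N2 h : `|h| <= 2 * rho -> nat_space F (e0 + h).
  move=> hr; apply: Hr; rewrite /ball/= opprD addNKr normrN.
  by apply: (le_lt_trans hr); rewrite /rho; lra.
have it h : `|h| <= 2 * rho -> P.-integrable setT (EFin \o (fun w => expR (h * t w))).
  by move=> /N2; exact: integrable_exp_stat.
have mt := measurable_stat_comp.
pose M := tilted_moment P t.
have dM k (h : R) : `|h| < rho -> is_derive h 1 (M k) (M k.+1 h).
  exact: (is_derive_tilted_moment mt rho0 it).
have Mp h : `|h| < rho -> 0 < M 0%N h.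
  by move=> /ltW; exact: (tilted_moment_gt0 mt rho0 it).
pose m k e := M k (e - e0) / M 0%N (e - e0).
have dMe k (e : R) : `|e - e0| < rho -> is_derive e 1 (fun e => M k (e - e0)) (M k.+1 (e - e0)).
  move=> er; have dk := dM k _ er.
  have ds : is_derive e 1 (fun e : R => e - e0) 1.
    by apply: is_derive_eq; rewrite subr0.
  by have := @is_derive1_comp R (M k) (fun e => e - e0) e _ _ dk ds; rewrite mulr1.
(* [m k e] is the k-th moment under the member e, and its derivative is the covariance of t^k and t.
   The derivatives of [c1], [c2] and [c3] follow from this rule by algebra. *)
have dm k (e : R) : `|e - e0| < rho -> is_derive e 1 (m k) (m k.+1 e - m k e * m 1%N e).
  move=> er; have n0 : M 0%N (e - e0) != 0 by rewrite gt_eqF ?Mp.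
  have d1 := dMe k e er.
  have d2 : is_derive e 1 (fun e => (M 0%N (e - e0))^-1)
      (- (M 0%N (e - e0)) ^- 2 *: M 1%N (e - e0)).
    have d0 := dMe 0%N e er.
    exact: (@is_deriveV _ (fun e => M 0%N (e - e0)) e _ 1 n0 d0).
  apply: is_derive_eq; rewrite /m /GRing.scale/=; field.
  exact: n0.
have m0 k : m k e0 = moment P t k.
  by rewrite /m subrr /M !tilted_moment0 {2}/moment expectation_cst divr1.
pose c1 e := m 1%N e.
pose c2 e := m 2%N e - m 1%N e ^+ 2.
pose c3 e := m 3%N e - 3 * m 1%N e * m 2%N e + 2 * m 1%N e ^+ 3.
pose c4 e := m 4%N e - 4 * m 1%N e * m 3%N e - 3 * m 2%N e ^+ 2 +
  12 * m 1%N e ^+ 2 * m 2%N e - 6 * m 1%N e ^+ 4.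
have e00 : `|e0 - e0| < rho by rewrite subrr normr0.
have c4c : {for e0, continuous c4}.
  have d1 := dm 1%N _ e00; have d2 := dm 2%N _ e00.
  have d3 := dm 3%N _ e00; have d4 := dm 4%N _ e00.
  have [D dc] : exists D, is_derive e0 (1 : R) c4 D.
    by eexists; rewrite /c4; apply: is_derive_eq.
  exact: is_derive_continuous dc.
(* The bound on the fourth cumulant comes from continuity at [e0], at the price of a smaller
   radius. *)
have [r' /= r'0 Hr'] : exists2 r' : R, 0 < r' & forall e, `|e - e0| < r' ->
    `|c4 e| <= `|c4 e0| + 1.
  have /cvgrPdist_lt/(_ 1 ltr01)/nbhs_ballP[r' /= r'0 H] := c4c.
  exists r' => // e; rewrite distrC => er; have /= := H e er.
  rewrite distrC => h; rewrite -(subrK (c4 e0) (c4 e)) addrC.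
  by rewrite (le_trans (ler_normD _ _))// lerD2l ltW.
exists (Num.min rho r'), (`|c4 e0| + 1), c1, c2, c3, c4; split.
- by rewrite lt_min rho0.
- move=> e; rewrite lt_min => /andP[er er'].
  have eN x : `|x - e0| < rho -> nat_space F x.
    move=> h; rewrite -(subrK e0 x) addrC; apply: N2.
    by rewrite (le_trans (ltW h))// ler_peMl ?(ltW rho0)//; lra.
  have d0 := dMe 0%N e er.
  have d1 := dm 1%N _ er; have d2 := dm 2%N _ er.
  have d3 := dm 3%N _ er; have d4 := dm 4%N _ er.
  split.
  + exact: eN.
  + apply: (@near_eq_is_derive _ _ _ (fun x => psibar F e0 + ln (M 0%N (x - e0)))).
    * near=> x; rewrite -psibar_shift; first by congr (psibar F _); ring.
      rewrite addrC subrK; apply: eN; near: x.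
      have : \forall x \near e, `|x - e| < rho - `|e - e0|.
        have p : 0 < rho - `|e - e0| by rewrite subr_gt0.
        apply: filterS (nbhsx_ballx e _ p) => x; by rewrite /ball/= distrC.
      apply: filterS => y hx; rewrite (_ : y - e0 = (y - e) + (e - e0)); last by ring.
      by rewrite (le_lt_trans (ler_normD _ _))// -ltrBrDr.
    * have dl := is_derive1_ln (Mp _ er).
      have dc := @is_derive1_comp R (@ln R) (fun x => M 0%N (x - e0)) e _ _ dl d0.
      have da := @is_deriveD _ _ _ (cst (psibar F e0)) _ e 1 0 _ (is_derive_cst _ _ _) dc.
      by apply: (is_derive_eq da); rewrite add0r /c1 /m mulrC.
  + by apply: is_derive_eq; rewrite /c2; ring.
  + by apply: is_derive_eq; rewrite /c3 /GRing.scale/=; ring.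
  + split; last exact: Hr'.
    by apply: is_derive_eq; rewrite /c4 /GRing.scale/=; ring.
- move=> k; have z : `|0 : R| <= rho by rewrite normr0 ltW.
  have := integrable_tilted mt rho0 it k z.
  by under eq_fun do rewrite mul0r expR0 mulr1.
- by rewrite /c1 /c2 /c3 !m0.
Unshelve. all: by end_near.
Qed.

End cumulants.

Lemma lebesgue_measure_translate {R : realType} (c : R)
    (A : set (measurableTypeR R)) : measurable A ->
  lebesgue_measure ((fun x : measurableTypeR R => x - c) @^-1` A) = lebesgue_measure A.
Proof.
move=> mA.
have mf : measurable_fun setT (fun x : measurableTypeR R => x - c : measurableTypeR R).
  by apply: measurable_funB.
rewrite -[LHS]/(pushforward lebesgue_measure (fun x : measurableTypeR R => x - c : measurableTypeR R) A).
apply/esym/lebesgue_measure_unique => //= _ [[a b]] _ <-.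
rewrite /pushforward (_ : _ @^-1` _ = `]a + c, b + c]%classic); last first.
  by apply/seteqP; split=> x /=; rewrite !in_itv/= ltrBrDr lerBlDr.
have e1 := @lebesgue_measure_itv R (`]a, b]).
have e2 := @lebesgue_measure_itv R (`]a + c, b + c]).
rewrite /= in e1 e2; rewrite e1 e2 !lte_fin ltrD2r -!EFinB.
by case: ifP => // _; congr EFin; ring.
Qed.

Section family_member.
Context {R : realType} {d : measure_display} {Omega : measurableType d}.
Variables (F : expfam R) (P : probability Omega R) (Y : {mfun Omega >-> R}).
Notation mu := (@lebesgue_measure R).
Variable e0 : R.
Hypothesis F_regular : regular F.
Hypothesis F_continuous : continuous_family F.
Hypothesis Yd : has_density P Y (density F e0).
Hypothesis He0 : nat_space F e0.
Let t w := stat F (Y w).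

(** Each cumulant function has to be identified with an iterated derivative on the whole ball before
    the next differentiation, hence the inductive [step]. *)
Lemma psibar_smooth : exists2 rho : R, 0 < rho & exists B : R,
  (forall e, `|e - e0| < rho -> [/\ nat_space F e,
    forall k, (k < 4)%N ->
      is_derive e 1 (derive1n k (psibar F)) (derive1n k.+1 (psibar F) e) &
    `|derive1n 4 (psibar F) e| <= B]) /\
  [/\ derive1n 1 (psibar F) e0 = moment P t 1,
      derive1n 2 (psibar F) e0 = moment P t 2 - moment P t 1 ^+ 2 &
      derive1n 3 (psibar F) e0 =
        moment P t 3 - 3 * moment P t 1 * moment P t 2 + 2 * moment P t 1 ^+ 3].
Proof.
have [rho [B [c1 [c2 [c3 [c4 [rho0 H _ [m1 m2 m3]]]]]]]] :=
  cumulant_functions Yd F_regular He0.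
exists rho => //; exists B.
have nearball e : `|e - e0| < rho -> \forall x \near e, `|x - e0| < rho.
  move=> er; have p : 0 < rho - `|e - e0| by rewrite subr_gt0.
  apply: filterS (nbhsx_ballx e _ p) => y; rewrite /ball/= distrC => hy.
  rewrite (_ : y - e0 = (y - e) + (e - e0)); last by ring.
  by rewrite (le_lt_trans (ler_normD _ _))// -ltrBrDr.
have step k (f df : R -> R) : (forall e, `|e - e0| < rho -> derive1n k (psibar F) e = f e) ->
    (forall e, `|e - e0| < rho -> is_derive e 1 f (df e)) ->
    forall e, `|e - e0| < rho -> is_derive e 1 (derive1n k (psibar F)) (df e) /\
      derive1n k.+1 (psibar F) e = df e.
  move=> kf fd e er.
  have dk : is_derive e 1 (derive1n k (psibar F)) (df e).
    apply: (@near_eq_is_derive _ _ _ f); last exact: fd.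
    by apply: filterS (nearball e er) => x xr; rewrite kf.
  by split=> //; rewrite derive1nS derive1E; apply: derive_val.
have s0 := step 0%N (psibar F) c1 (fun e _ => erefl) (fun e er => let: And5 _ h _ _ _ := H e er in h).
have s1 := step 1%N c1 c2 (fun e er => (s0 e er).2) (fun e er => let: And5 _ _ h _ _ := H e er in h).
have s2 := step 2%N c2 c3 (fun e er => (s1 e er).2) (fun e er => let: And5 _ _ _ h _ := H e er in h).
have s3 := step 3%N c3 c4 (fun e er => (s2 e er).2)
  (fun e er => let: And5 _ _ _ _ h := H e er in h.1).
have e00 : `|e0 - e0| < rho by rewrite subrr normr0.
split; last by rewrite (s0 _ e00).2 (s1 _ e00).2 (s2 _ e00).2.
move=> e er; split.
- by have [] := H e er.
- case=> [|[|[|[|//]]]] _.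
  + by rewrite (s0 e er).2; have [] := s0 e er.
  + by rewrite (s1 e er).2; have [] := s1 e er.
  + by rewrite (s2 e er).2; have [] := s2 e er.
  + by rewrite (s3 e er).2; have [] := s3 e er.
- by rewrite (s3 e er).2; have [_ _ _ _ []] := H e er.
Qed.

Lemma integrable_stat_pow k : P.-integrable setT (EFin \o (fun w => t w ^+ k)).
Proof.
by have [rho [B [c1 [c2 [c3 [c4 [_ _ H _]]]]]]] := cumulant_functions Yd F_regular He0.
Qed.

Lemma stat_null (A : set R) : measurable A -> mu A = 0%E -> P (t @^-1` A) = 0%E.
Proof.
move=> mA A0; have mtA : measurable (stat F @^-1` A).
  by rewrite -[X in measurable X]setTI; have := @measurable_stat R F measurableT A mA.
have := Yd mtA; rewrite -[X in P X]/(t @^-1` A) => ->.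
rewrite integral_mkcond.
transitivity (\int[mu]_(x in Defs.support F `&` stat F @^-1` A) (density F e0 x)%:E)%E.
  rewrite [RHS]integral_mkcond; apply: eq_integral => x _; rewrite !patchE.
  rewrite in_setI /density indicE.
  by case: (x \in Defs.support F); case: (x \in _); rewrite ?mul0r.
apply: null_set_integral.
- by apply: measurableI => //; exact: (@measurable_support R F).
- by apply/measurable_EFinP; apply: measurable_funTS; exact: measurable_density.
- exact: F_continuous.
Qed.

Lemma stat_null_translate (c : R) (A : set R) : measurable A -> mu A = 0%E ->
  P ((fun w => t w - c) @^-1` A) = 0%E.
Proof.
move=> mA A0; pose B : set R := (fun x : R => x - c) @^-1` A.
have mB : measurable B.
  rewrite -[B]setTI; have mf : measurable_fun setT (fun x : R => x - c) by exact: measurable_funB.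
  exact: mf.
apply: (stat_null mB); rewrite -A0; exact: lebesgue_measure_translate.
Qed.

(** This is the variance of the statistic; it could vanish only if the statistic were almost surely
    equal to its mean, but its law has no atoms. *)
Lemma psibar2_gt0 : 0 < derive1n 2 (psibar F) e0.
Proof.
have [_ _ [_ [_ [_ k2 _]]]] := psibar_smooth.
have mt := measurable_stat_comp F Y.
have [|i e] := @expectation_poly4 R d Omega P t mt (integrable_stat_pow 4)
  (moment P t 1 ^+ 2) (- 2 * moment P t 1) 1 0 0 (fun w => (t w - moment P t 1) ^+ 2).
  by move=> w; ring.
have -> : derive1n 2 (psibar F) e0 = \int[P]_w ((t w - moment P t 1) ^+ 2).
  by rewrite k2 e; ring.
apply: (expectation_gt0 i) => [w|]; first exact: sqr_ge0.
rewrite -[RHS](@stat_null_translate (moment P t 1) [set 0])//; last first.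
  exact: lebesgue_measure_set1.
congr (P _); apply/seteqP; split=> w /=.
  by move=> /eqP; rewrite sqrf_eq0 => /eqP.
by move=> ->; rewrite expr0n.
Qed.

Lemma central_moments (c := derive1n 1 (psibar F) e0)
    (T := fun w => t w - c) :
  [/\ P.-integrable setT (EFin \o (fun w => T w ^+ 4)), moment P T 1 = 0,
      moment P T 2 = derive1n 2 (psibar F) e0 &
      moment P T 3 = derive1n 3 (psibar F) e0].
Proof.
have [_ _ [_ [_ [k1 k2 k3]]]] := psibar_smooth.
have mt := measurable_stat_comp F Y.
have poly4 := @expectation_poly4 R d Omega P t mt (integrable_stat_pow 4).
have c1 : c = moment P t 1 by [].
split.
- have [|//] := poly4 (c ^+ 4) (- 4 * c ^+ 3) (6 * c ^+ 2) (- 4 * c) 1 (fun w => T w ^+ 4).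
  by move=> w; rewrite /T; ring.
- have [|_ E] := poly4 (- c) 1 0 0 0 (fun w => T w ^+ 1).
    by move=> w; rewrite /T; ring.
  by apply: (eq_trans E); rewrite c1; ring.
- have [|_ E] := poly4 (c ^+ 2) (- 2 * c) 1 0 0 (fun w => T w ^+ 2).
    by move=> w; rewrite /T; ring.
  by apply: (eq_trans E); rewrite k2 c1; ring.
- have [|_ E] := poly4 (- c ^+ 3) (3 * c ^+ 2) (- 3 * c) 1 0 (fun w => T w ^+ 3).
    by move=> w; rewrite /T; ring.
  by apply: (eq_trans E); rewrite k3 c1; ring.
Qed.

End family_member.

(** * Likelihood quantities in the canonical parameter *)

Section canonical_parameter.
Context {R : realType}.
Variable F : expfam R.
Local Notation K k := (derive1n k (psibar F)).
Implicit Types (e y th : R) (n : nat).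

(** Pointwise, depending on the sign of the statistic, the integrand at [e] is at most the one at
    [e2] or the one at [e1]. *)
Lemma nat_space_convex e1 e2 e : nat_space F e1 -> nat_space F e2 ->
  e1 <= e <= e2 -> nat_space F e.
Proof.
rewrite /nat_space/= => l1 l2 /andP[e1e ee2].
have mS := @measurable_support R F.
have mexp h : measurable_fun (Defs.support F : set (measurableTypeR R))
    (fun x => (expR (h * stat F x - logbase F x))%:E).
  apply/measurable_EFinP; apply: measurable_funTS.
  apply: (measurableT_comp (@measurable_expR R)).
  apply: measurable_funB; last exact: (@measurable_logbase R F).
  by apply: measurable_funM => //; exact: (@measurable_stat R F).
apply: (@le_lt_trans _ _ (laplace F e1 + laplace F e2)%E); last by rewrite lte_add_pinfty.
rewrite /laplace -ge0_integralD//.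
apply: ge0_le_integral => //; first exact: emeasurable_funD.
move=> x _; rewrite -EFinD lee_fin; have [t0|t0] := leP 0 (stat F x).
  apply: (@le_trans _ _ (expR (e2 * stat F x - logbase F x))); last by rewrite lerDr expR_ge0.
  by rewrite ler_expR lerD2r ler_wpM2r.
apply: (@le_trans _ _ (expR (e1 * stat F x - logbase F x))); last by rewrite lerDl expR_ge0.
by rewrite ler_expR lerD2r ler_wnM2r// ltW.
Qed.

Hypothesis smooth : forall e0, nat_space F e0 ->
  exists2 rho : R, 0 < rho & exists B : R,
    forall e, `|e - e0| < rho -> [/\ nat_space F e,
      forall k, (k < 4)%N -> is_derive e 1 (K k) (K k.+1 e) & `|K 4 e| <= B].
Hypothesis psibar2_gt0 : forall e, nat_space F e -> 0 < K 2 e.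

Lemma is_derive_psibar k e : nat_space F e -> (k < 4)%N ->
  is_derive e 1 (K k) (K k.+1 e).
Proof.
move=> /smooth[rho rho0 [B H]] k4; have [|_ d _] := H e; first by rewrite subrr normr0.
exact: d.
Qed.

Lemma nat_space_near e : nat_space F e -> \forall x \near e, nat_space F x.
Proof.
move=> /smooth[rho rho0 [B H]]; apply: filterS (nbhsx_ballx e _ rho0) => y.
by rewrite /ball/= distrC => /H[].
Qed.

Lemma lt_psibar1 e1 e2 : nat_space F e1 -> nat_space F e2 -> e1 < e2 -> K 1 e1 < K 1 e2.
Proof.
move=> n1 n2 e12.
have N x : x \in `[e1, e2] -> nat_space F x.
  by rewrite in_itv/=; exact: nat_space_convex.
have [||c cI E] := @MVT_segment R (K 1) (K 2) e1 e2 (ltW e12).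
- move=> x xI; apply: is_derive_psibar => //; apply: N; exact: subset_itv_oo_cc xI.
- apply: derivable_within_continuous => x xI.
  by have [] := is_derive_psibar (N x xI) (isT : 1 < 4)%N.
rewrite -subr_gt0 E mulr_gt0 ?subr_gt0//; exact/psibar2_gt0/N.
Qed.

Lemma psibar1_inj e1 e2 : nat_space F e1 -> nat_space F e2 -> K 1 e1 = K 1 e2 -> e1 = e2.
Proof.
move=> n1 n2 E; have [/(lt_psibar1 n1 n2)|/(lt_psibar1 n2 n1)|//] := ltgtP e1 e2.
  by rewrite E ltxx.
by rewrite E ltxx.
Qed.

Lemma is_derive_psi n e : (0 < n)%N -> nat_space F e ->
  is_derive (n%:R * e) 1 (psi F n) (K 1 e).
Proof.
move=> n0 ne; have nz : n%:R != 0 :> R by rewrite pnatr_eq0 -lt0n.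
have E : n%:R * e / n%:R = e by rewrite mulrC mulKf.
have d0 : is_derive (n%:R * e / n%:R : R) 1 (K 0) (K 1 e).
  by rewrite E; exact: (@is_derive_psibar 0).
have ds : is_derive (n%:R * e : R) 1 (fun x : R => x / n%:R) n%:R^-1.
  by apply: is_derive_eq; rewrite /GRing.scale/=; ring.
have dc := @is_derive1_comp R (K 0) (fun x : R => x / n%:R) _ _ _ d0 ds.
have dz := @is_deriveZ _ _ _ _ n%:R _ _ _ dc.
by apply: (is_derive_eq dz); rewrite /GRing.scale/= mulrC mulfVK.
Qed.

(** [eta_of] is a choice made by [xget]; the strict monotonicity of psibar' leaves a single
    candidate. *)
Lemma eta_of_psibar1 n e : (0 < n)%N -> nat_space F e ->
  eta_of F n (K 1 e) = n%:R * e.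
Proof.
move=> n0 ne; have nz : n%:R != 0 :> R by rewrite pnatr_eq0 -lt0n.
apply: xget_unique => /=.
  rewrite mulrAC divff// mul1r; split => //.
  by rewrite derive1E; have ? := is_derive_psi n0 ne; exact: derive_val.
move=> eta [neta]; rewrite derive1E.
have := is_derive_psi n0 neta; rewrite mulrC divfK// => ?.
by rewrite derive_val => /(psibar1_inj neta ne) <-; rewrite mulrC divfK.
Qed.

Lemma sigma_psibar1 n e : (0 < n)%N -> nat_space F e ->
  sigma F n (K 1 e) = Num.sqrt (K 2 e / n%:R).
Proof.
move=> n0 ne; have nz : n%:R != 0 :> R by rewrite pnatr_eq0 -lt0n.
rewrite /sigma eta_of_psibar1//; congr (Num.sqrt _).
rewrite derive1nS derive1E.
have E : n%:R * e / n%:R = e by rewrite mulrC mulKf.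
have d1 : is_derive (n%:R * e / n%:R : R) 1 (K 1) (K 2 e).
  by rewrite E; exact: (@is_derive_psibar 1).
have ds : is_derive (n%:R * e : R) 1 (fun x : R => x / n%:R) n%:R^-1.
  by apply: is_derive_eq; rewrite /GRing.scale/=; ring.
have dc := @is_derive1_comp R (K 1) (fun x : R => x / n%:R) _ _ _ d1 ds.
have ? : is_derive (n%:R * e : R) 1 (derive1n 1 (psi F n)) (K 2 e / n%:R).
  apply: (@near_eq_is_derive _ _ _ (K 1 \o (fun x : R => x / n%:R))).
  have cs : {for n%:R * e, continuous (fun x : R => x / n%:R)}.
    exact: is_derive_continuous ds.
  have : \forall x \near n%:R * e, nat_space F (x / n%:R).
    by apply: cs; rewrite mulrAC divff// mul1r; exact: nat_space_near.
  apply: filterS => x nx; rewrite [RHS]derive1E.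
  have := is_derive_psi n0 nx; rewrite mulrC divfK// => ?.
  by rewrite derive_val.
exact: derive_val.
Qed.

Lemma loglik_psibar1 n e y : (0 < n)%N -> nat_space F e ->
  loglik F n (K 1 e) y = n%:R * (e * y - psibar F e).
Proof.
move=> n0 ne; have nz : n%:R != 0 :> R by rewrite pnatr_eq0 -lt0n.
have E : n%:R * e / n%:R = e by rewrite mulrC mulKf.
by rewrite /loglik eta_of_psibar1// /psi E; ring.
Qed.

Lemma loglik_1_psibar1 n e y : (0 < n)%N -> nat_space F e ->
  loglik_1 F n (K 1 e) y = n%:R * e.
Proof.
move=> n0 ne; rewrite /loglik_1 derive1E.
have ? : is_derive y 1 (loglik F n (K 1 e)) (n%:R * e).
  rewrite /loglik eta_of_psibar1//.
  by apply: is_derive_eq; rewrite /GRing.scale/=; ring.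
exact: derive_val.
Qed.

(** For sample size 1, [eta_of] inverts psibar' itself, and the inverse function theorem applies
    because psibar'' is positive. The inversion is stated on a neighbourhood, as the log-likelihood
    is to be differentiated twice in th. *)
Lemma psibar1_local_inverse e (g := fun th => eta_of F 1 th) : nat_space F e ->
  [/\ g (K 1 e) = e, \forall th \near K 1 e, nat_space F (g th) /\ K 1 (g th) = th &
      is_derive (K 1 e) 1 g (K 2 e)^-1].
Proof.
move=> ne; have gK x : nat_space F x -> g (K 1 x) = x.
  by move=> nx; rewrite /g eta_of_psibar1// mul1r.
have nK : {near e, cancel (K 1) g}.
  by apply: filterS (nat_space_near ne) => x /gK.
have cK : {near e, continuous (K 1)}.
  apply: filterS (nat_space_near ne) => x nx.
  exact: is_derive_continuous (is_derive_psibar nx (isT : 1 < 4)%N).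
split; first exact: gK.
  have [cg sym] := near_can_continuousAcan_sym nK cK.
  have cge : {for K 1 e, continuous g} by exact: nbhs_singleton cg.
  have ng : \forall th \near K 1 e, nat_space F (g th).
    by apply: cge; rewrite gK//; exact: nat_space_near.
  by near=> th; split; near: th.
apply: (is_derive_inverse nK cK); first exact: (@is_derive_psibar 1).
by rewrite gt_eqF// psibar2_gt0.
Unshelve. all: by end_near. Qed.

(** The score in th is n (y - th) / K2(g th). At th = y the first factor vanishes, so only its own
    derivative survives and the third cumulant drops out. *)
Lemma obs_info_psibar1 n e : (0 < n)%N -> nat_space F e ->
  obs_info F n (K 1 e) = n%:R / K 2 e.
Proof.
move=> n0 ne; have [ge ng dg] := psibar1_local_inverse ne.
set g := fun th => eta_of F 1 th in ge ng dg.
pose y : R := K 1 e; rewrite /obs_info -/y.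
have gy : g y = e by exact: ge.
have dgn : \forall th \near (y : R), is_derive (th : R) 1 g (K 2 (g th))^-1.
  apply: filterS ng => th [nth Kth].
  by have [_ _] := psibar1_local_inverse nth; rewrite Kth.
have ll th : nat_space F (g th) -> K 1 (g th) = th ->
    loglik F n th y = n%:R * (g th * y - psibar F (g th)).
  by move=> nth Kth; rewrite -{1}Kth loglik_psibar1.
have dl : \forall th \near y,
    derive1 (loglik F n ^~ y) th = n%:R * ((y - th) * (K 2 (g th))^-1).
  near=> th.
  have dth : is_derive (th : R) 1 g (K 2 (g th))^-1 by near: th.
  have [nth Kth] : nat_space F (g th) /\ K 1 (g th) = th by near: th.
  have d0 : is_derive (g th) 1 (K 0) (K 1 (g th)) by exact: (@is_derive_psibar 0).
  have dc := @is_derive1_comp R (K 0) g th _ _ d0 dth.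
  rewrite derive1E.
  have ? : is_derive th 1 (loglik F n ^~ y) (n%:R * ((y - th) * (K 2 (g th))^-1)).
    apply: (@near_eq_is_derive _ _ _ (fun th => n%:R * (g th * y - (K 0 \o g) th))).
      have ngth : \forall x \near th, nat_space F (g x) /\ K 1 (g x) = x.
        by have [_ + _] := psibar1_local_inverse nth; rewrite Kth.
      by apply: filterS ngth => x [nx Kx]; rewrite ll.
    have Kth' : derive1 (psibar F) (g th) = th by exact: Kth.
    by apply: is_derive_eq; rewrite /GRing.scale/= Kth'; ring.
  exact: derive_val.
rewrite derive1nS derive1E.
have d2 : is_derive e 1 (K 2) (K 3 e) by exact: (@is_derive_psibar 2).
have d2g : is_derive y 1 (fun th => K 2 (g th)) (K 3 e * (K 2 e)^-1).
  have d2' : is_derive (g y) 1 (K 2) (K 3 e) by rewrite gy.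
  exact: (@is_derive1_comp R (K 2) g y _ _ d2' dg).
have nz : K 2 (g y) != 0 by rewrite gy gt_eqF// psibar2_gt0.
have di := @is_deriveV _ (fun th => K 2 (g th)) y _ 1 nz d2g.
have ? : is_derive y 1 (derive1n 1 (loglik F n ^~ y)) (- (n%:R / K 2 e)).
  apply: (@near_eq_is_derive _ _ _ (fun th => n%:R * ((y - th) * (K 2 (g th))^-1))).
    by apply: filterS dl => th E; exact/esym/E.
  by apply: is_derive_eq; rewrite /GRing.scale/= gy; ring.
by rewrite derive_val opprK.
Unshelve. all: by end_near. Qed.

End canonical_parameter.

(** * Expansion of the directed likelihoods *)

Section order_calculus.
Context {R : realType} {I : Type}.
Variable a : I -> R.
Implicit Types (S : set I) (f g : I -> R) (k l : nat).

(** O(a^k) with one constant for the whole set [S]. Indices are kept abstract so that they can be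
    sample sizes for the median and pairs (n, h) for the directed likelihoods, where the bound must
    be uniform in h. *)
Definition order S k f : Prop :=
  exists2 M : R, 0 <= M & forall i, S i -> `|f i| <= M * a i ^+ k.

Lemma order_subset S S' k f : S' `<=` S -> order S k f -> order S' k f.
Proof. by move=> SS' [M M0 H]; exists M => // i /SS'/H. Qed.

Lemma order_eq S k f g : (forall i, S i -> f i = g i) -> order S k f -> order S k g.
Proof. by move=> fg [M M0 H]; exists M => // i Si; rewrite -fg ?H. Qed.

Lemma orderN S k f : order S k f -> order S k (fun i => - f i).
Proof. by move=> [M M0 H]; exists M => // i Si; rewrite normrN H. Qed.

Lemma orderD S k f g : order S k f -> order S k g -> order S k (fun i => f i + g i).
Proof.
move=> [M M0 H] [N N0 H']; exists (M + N); first exact: addr_ge0.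
by move=> i Si; rewrite mulrDl (le_trans (ler_normD _ _))// lerD ?H ?H'.
Qed.

Lemma orderB S k f g : order S k f -> order S k g -> order S k (fun i => f i - g i).
Proof. by move=> fk gk; apply: orderD fk _; exact: orderN. Qed.

Lemma orderM S k l f g :
  order S k f -> order S l g -> order S (k + l) (fun i => f i * g i).
Proof.
move=> [M M0 H] [N N0 H']; exists (M * N); first exact: mulr_ge0.
by move=> i Si; rewrite exprD mulrACA normrM ler_pM ?H ?H'.
Qed.

Lemma order_cst S (c : R) : order S 0 (fun=> c).
Proof. by exists `|c| => // i _; rewrite expr0 mulr1. Qed.

Lemma order_bounded S f (M : R) : (forall i, S i -> `|f i| <= M) -> order S 0 f.
Proof.
move=> H; exists `|M| => // i Si; rewrite expr0 mulr1.
exact: (le_trans (H i Si) (ler_norm _)).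
Qed.

Lemma order_inv S f (m : R) : 0 < m -> (forall i, S i -> m <= f i) ->
  order S 0 (fun i => (f i)^-1).
Proof.
move=> m0 H; apply: (@order_bounded _ _ m^-1) => i Si.
have fi := H i Si; have f0 := lt_le_trans m0 fi.
by rewrite ger0_norm ?invr_ge0 ?(ltW f0)// lef_pV2.
Qed.

Lemma order_small S k f (eps : R) : order S k.+1 f -> 0 < eps ->
  exists2 a0 : R, 0 < a0 & forall i, S i -> 0 < a i <= 1 -> a i <= a0 -> `|f i| <= eps.
Proof.
move=> [M M0 H] e0; exists (eps / (M + 1)); first by rewrite divr_gt0// ltr_wpDl.
move=> i Si /andP[ai0 ai1] aa; apply: (le_trans (H i Si)).
apply: (@le_trans _ _ (M * a i)).
  by rewrite ler_wpM2l// exprS ler_piMr ?exprn_ile1// ltW.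
apply: (@le_trans _ _ ((M + 1) * a i)); first by rewrite ler_wpM2r ?lerDl ?(ltW ai0).
by rewrite mulrC -ler_pdivlMr// ltr_wpDl.
Qed.

Variable S : set I.
Hypothesis a01 : forall i, S i -> 0 < a i <= 1.

Lemma order_le k l f : (k <= l)%N -> order S l f -> order S k f.
Proof.
move=> kl [M M0 H]; exists M => // i Si; apply: (le_trans (H i Si)).
have /andP[ai0 ai1] := a01 Si.
by rewrite ler_wpM2l// ler_wiXn2l// ltW.
Qed.

Lemma order_div k f : order S k.+1 f -> order S k (fun i => f i / a i).
Proof.
move=> [M M0 H]; exists M => // i Si; have /andP[ai0 ai1] := a01 Si.
rewrite normrM normfV (gtr0_norm ai0) ler_pdivrMr// -mulrA -exprSr.
exact: H.
Qed.

Lemma order_scale : order S 1 a.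
Proof.
exists 1 => // i Si; have /andP[ai0 _] := a01 Si.
by rewrite expr1 mul1r gtr0_norm.
Qed.

End order_calculus.

Section expansion.
Context {R : realType}.
Variables (K : nat -> R -> R) (e0 rho B : R).
Hypothesis rho0 : 0 < rho.
Hypothesis dK : forall e k, `|e - e0| < rho -> (k < 4)%N -> is_derive e 1 (K k) (K k.+1 e).
Hypothesis K4B : forall e, `|e - e0| < rho -> `|K 4 e| <= B.
Implicit Types (h b : R).

(** Four uses of [taylor_step] around [h], starting from the bound on [K 4]. With both points within
    rho / 4 of [e0], increments up to rho / 2 stay inside the ball where the derivatives are
    controlled. *)
Lemma taylor_remainders h b (t := b - h) :
  `|h - e0| <= rho / 4 -> `|b - e0| <= rho / 4 ->
  [/\ `|K 3 b - K 3 h| <= B * `|t|,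
      `|K 2 b - K 2 h - K 3 h * t| <= B * `|t| ^+ 2,
      `|K 1 b - K 1 h - K 2 h * t - K 3 h / 2 * t ^+ 2| <= B * `|t| ^+ 3 &
      `|K 0 b - K 0 h - K 1 h * t - K 2 h / 2 * t ^+ 2 - K 3 h / 6 * t ^+ 3|
        <= B * `|t| ^+ 4].
Proof.
have r0 := rho0; move=> hr br.
have near s : `|s| <= rho / 2 -> `|h + s - e0| < rho.
  move=> sr; rewrite addrAC (le_lt_trans (ler_normD _ _))//.
  by apply: (le_lt_trans (lerD hr sr)); lra.
have tr : `|t| <= rho / 2.
  rewrite /t (_ : b - h = (b - e0) - (h - e0)); last by ring.
  by apply: (le_trans (ler_normB _ _)); apply: (le_trans (lerD br hr)); lra.
have dKs (s : R) k : `|s| <= rho / 2 -> (k < 4)%N ->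
    is_derive s 1 (fun s : R => K k (h + s)) (K k.+1 (h + s)).
  move=> /near sr k4; have d1 := dK sr k4.
  have ds : is_derive s 1 (fun s : R => h + s) 1.
    have := @is_deriveD R R R (cst h) id s 1 0 1 (is_derive_cst _ _ _) (is_derive_id _ _).
    by rewrite add0r.
  by have := @is_derive1_comp R (K k) (fun s : R => h + s) s _ _ d1 ds; rewrite mulr1.
have ht : h + t = b by rewrite /t addrC subrK.
have s3 : forall s, `|s| <= rho / 2 -> `|K 3 (h + s) - K 3 h| <= B * `|s| ^+ 1.
  apply: (@taylor_step _ _ (fun s => K 4 (h + s))); first 2 last.
  - by move=> s sr; rewrite expr0 mulr1; exact/K4B/near.
  - by move=> s sr; have ? := dKs s 3%N sr isT; apply: is_derive_eq; rewrite subr0.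
  - by rewrite addr0 subrr.
have s2 : forall s, `|s| <= rho / 2 ->
    `|K 2 (h + s) - K 2 h - K 3 h * s| <= B * `|s| ^+ 2.
  apply: (@taylor_step _ _ (fun s => K 3 (h + s) - K 3 h)); first 2 last.
  - exact: s3.
  - move=> s sr; have ? := dKs s 2%N sr isT; apply: is_derive_eq.
    by rewrite /GRing.scale/=; ring.
  - by rewrite addr0; ring.
have s1 : forall s, `|s| <= rho / 2 ->
    `|K 1 (h + s) - K 1 h - K 2 h * s - K 3 h / 2 * s ^+ 2| <= B * `|s| ^+ 3.
  apply: (@taylor_step _ _ (fun s => K 2 (h + s) - K 2 h - K 3 h * s)); first 2 last.
  - exact: s2.
  - move=> s sr; have ? := dKs s 1%N sr isT; apply: is_derive_eq.
    by rewrite /GRing.scale/=; field.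
  - by rewrite addr0; ring.
have s0 : forall s, `|s| <= rho / 2 ->
    `|K 0 (h + s) - K 0 h - K 1 h * s - K 2 h / 2 * s ^+ 2 - K 3 h / 6 * s ^+ 3|
      <= B * `|s| ^+ 4.
  apply: (@taylor_step _ _ (fun s =>
    K 1 (h + s) - K 1 h - K 2 h * s - K 3 h / 2 * s ^+ 2)); first 2 last.
  - exact: s1.
  - move=> s sr; have ? := dKs s 0%N sr isT; apply: is_derive_eq.
    by rewrite /GRing.scale/=; field.
  - by rewrite addr0; ring.
by rewrite -ht; split; [rewrite -(expr1 `|t|); exact: s3|exact: s2|exact: s1|exact: s0].
Qed.

(* Twice the Kullback-Leibler divergence between the members h and b, divided by
   (b - h)^2 and extended by its limit at b = h. *)
Definition curv h b : R :=
  if b == h then K 2 h else 2 * (K 0 b - K 0 h - K 1 h * (b - h)) / (b - h) ^+ 2.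

Lemma curvE h b : 2 * (K 0 b - K 0 h - K 1 h * (b - h)) = (b - h) ^+ 2 * curv h b.
Proof.
rewrite /curv; case: eqVneq => [->|bh]; first by rewrite !subrr; ring.
by rewrite [RHS]mulrC divfK// sqrf_eq0 subr_eq0.
Qed.

Definition curv_rem h b : R := (curv h b - K 2 h - K 3 h / 3 * (b - h)) / (b - h) ^+ 2.

Lemma curv_expansion h b : `|h - e0| <= rho / 4 -> `|b - e0| <= rho / 4 ->
  curv h b = K 2 h + K 3 h / 3 * (b - h) + (b - h) ^+ 2 * curv_rem h b /\
  `|curv_rem h b| <= 2 * B.
Proof.
move=> hr br; have [_ _ _] := taylor_remainders hr br.
have B0 : 0 <= B.
  by rewrite (le_trans _ (@K4B e0 _))// subrr normr0.
rewrite /curv_rem /curv; case: eqVneq => [->|bh] H.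
  rewrite subrr; split; first by ring.
  by rewrite expr0n invr0 mulr0 normr0 mulr_ge0.
have n0 : b - h != 0 by rewrite subr_eq0.
split; first by field.
set t := b - h in H n0 *.
have -> : (2 * (K 0 b - K 0 h - K 1 h * t) / t ^+ 2 - K 2 h - K 3 h / 3 * t) / t ^+ 2 =
   2 * (K 0 b - K 0 h - K 1 h * t - K 2 h / 2 * t ^+ 2 - K 3 h / 6 * t ^+ 3) / t ^+ 4.
  by field.
rewrite normrM normfV normrX ler_pdivrMr ?exprn_gt0 ?normr_gt0//.
by rewrite normrM (ger0_norm (ler0n R 2)) -[2 * B * _]mulrA ler_wpM2l.
Qed.

End expansion.

Lemma norm_ln1D_le {R : realType} (z : R) : `|z| <= 1 / 2 -> `|ln (1 + z) - z| <= 2 * z ^+ 2.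
Proof.
rewrite -real_normK ?num_real// => zr.
apply: (@taylor_step _ (fun z => ln (1 + z) - z) (fun z => (1 + z)^-1 - 1) (1 / 2)) => //.
- move=> t; rewrite ler_norml => /andP[t1 t2]; have p : 0 < 1 + t by lra.
  have dl := is_derive1_ln p.
  have ds := @is_deriveD R R R (cst 1) id t 1 0 1 (is_derive_cst _ _ _) (is_derive_id _ _).
  rewrite add0r in ds.
  have dc := @is_derive1_comp R (@ln R) (fun s : R => 1 + s) t _ _ dl ds.
  by apply: (is_derive_eq (is_deriveB dc (is_derive_id _ _))); rewrite mulr1.
- by rewrite addr0 ln1 subrr.
move=> t; rewrite ler_norml => /andP[t1 t2]; have p : 0 < 1 + t by lra.
have -> : (1 + t)^-1 - 1 = - t / (1 + t) by field; rewrite gt_eqF.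
rewrite normrM normfV normrN (gtr0_norm p) ler_pdivrMr// expr1 mulrAC ler_peMl//.
lra.
Qed.

Section directed_expansion.
Context {R : realType} {I : Type}.
Variables (K : nat -> R -> R) (e0 rho B : R).
Hypothesis rho0 : 0 < rho.
Hypothesis dK : forall e k, `|e - e0| < rho -> (k < 4)%N -> is_derive e 1 (K k) (K k.+1 e).
Hypothesis K4B : forall e, `|e - e0| < rho -> `|K 4 e| <= B.
Hypothesis v0 : 0 < K 2 e0.
Local Notation v := (K 2 e0).
Local Notation kap := (K 3 e0).
Let B0 : 0 <= B.
Proof. by rewrite (le_trans _ (@K4B e0 _))// subrr normr0. Qed.

Variables (a h b : I -> R) (S : set I).
Hypothesis a01 : forall i, S i -> 0 < a i <= 1.
Hypothesis h0 : forall i, S i -> h i != e0.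
Let x i := h i - e0.
Let y i := b i - e0.
Let t i := b i - h i.
Hypothesis hx : order a S 1 x.
Hypothesis hy : order a S 3 (fun i => y i + kap / (6 * v ^+ 2) * a i ^+ 2).
Hypothesis hball : forall i, S i -> `|h i - e0| <= rho / 4.
Hypothesis bball : forall i, S i -> `|b i - e0| <= rho / 4.

Let Qb i := curv K (h i) (b i).
Let Q0 i := curv K (h i) e0.
Let K2 i := K 2 (h i).
Let K3 i := K 3 (h i).
Let Eb i := curv_rem K (h i) (b i).
Let E0 i := curv_rem K (h i) e0.

Let e0ball : `|e0 - e0| <= rho / 4.
Proof. by have r := rho0; rewrite subrr normr0 divr_ge0// ltW. Qed.

Let order_K3 : order a S 1 (fun i => K3 i - kap).
Proof.
have [M M0 H] := hx; exists (B * M); first exact: mulr_ge0.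
move=> i Si; have [k3 _ _ _] := taylor_remainders rho0 dK K4B e0ball (hball Si).
by rewrite (le_trans k3)// -mulrA ler_wpM2l// H.
Qed.

Let order_K2 : order a S 1 (fun i => K2 i - v).
Proof.
have o2 : order a S 2 (fun i => K2 i - v - kap * x i).
  have [M M0 H] := hx; exists (B * M ^+ 2); first by rewrite mulr_ge0// exprn_ge0.
  move=> i Si; have [_ k2 _ _] := taylor_remainders rho0 dK K4B e0ball (hball Si).
  rewrite (le_trans k2)// -mulrA ler_wpM2l// -exprMn lerXn2r ?nnegrE//.
    by rewrite mulr_ge0//; have /andP[/ltW] := a01 Si.
  by have := H i Si; rewrite expr1.
have o1 := order_le a01 (isT : 1 <= 2)%N o2.
apply: order_eq (orderD o1 (orderM (order_cst a S kap) hx)).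
by move=> i Si; rewrite subrK.
Qed.

Let order_y : order a S 2 y.
Proof.
have o2 := order_le a01 (isT : 2 <= 3)%N hy.
have os := order_scale a01.
have oc := orderM (order_cst a S (- (kap / (6 * v ^+ 2))))
  (orderM os os).
by apply: order_eq (orderD o2 oc) => i Si; rewrite expr2; ring.
Qed.

Let order_t : order a S 1 t.
Proof.
have o1 := order_le a01 (isT : 1 <= 2)%N order_y.
by apply: order_eq (orderB o1 hx) => i Si; rewrite /t /y /x; ring.
Qed.

Let order_Eb : order a S 0 Eb.
Proof.
apply: (@order_bounded _ _ _ _ _ (2 * B)) => i Si.
by have [] := curv_expansion rho0 dK K4B (hball Si) (bball Si).
Qed.

Let order_E0 : order a S 0 E0.
Proof.
apply: (@order_bounded _ _ _ _ _ (2 * B)) => i Si.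
by have [] := curv_expansion rho0 dK K4B (hball Si) e0ball.
Qed.

Let QbE i : S i -> Qb i = K2 i + K3 i / 3 * t i + t i ^+ 2 * Eb i.
Proof. by move=> Si; have [] := curv_expansion rho0 dK K4B (hball Si) (bball Si). Qed.

Let Q0E i : S i -> Q0 i = K2 i - K3 i / 3 * x i + x i ^+ 2 * E0 i.
Proof.
move=> Si; have [E _] := curv_expansion rho0 dK K4B (hball Si) e0ball.
by rewrite /Q0 E /K2 /K3 /x /E0; ring.
Qed.

Let order_K3_0 : order a S 0 K3.
Proof.
have o := order_le a01 (isT : 0 <= 1)%N order_K3.
by apply: order_eq (orderD o (order_cst a S kap)) => i Si; rewrite subrK.
Qed.

(** Through [order_small] this yields the hypothesis [small] below, hence its place before it. The
    fraction 1/8 there makes |Q0 / K2 - 1| <= 1/2, the range of [norm_ln1D_le]. *)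
Lemma order_curvature : [/\ order a S 1 (fun i => K2 i - v),
  order a S 1 (fun i => Qb i - v) & order a S 1 (fun i => Q0 i - v)].
Proof.
have o3 : order a S 0 (fun i => K3 i / 3) := orderM order_K3_0 (order_cst a S 3^-1).
split=> //.
- have o : order a S 1 _ := orderD (orderD order_K2 (orderM o3 order_t))
    (order_le a01 (isT : 1 <= 2)%N (orderM (orderM order_t order_t) order_Eb)).
  by apply: order_eq o => i Si; rewrite QbE//; ring.
- have o : order a S 1 _ := orderD (orderB order_K2 (orderM o3 hx))
    (order_le a01 (isT : 1 <= 2)%N (orderM (orderM hx hx) order_E0)).
  by apply: order_eq o => i Si; rewrite Q0E//; ring.
Qed.

Hypothesis small : forall i, S i ->
  [/\ `|K2 i - v| <= v / 8, `|Qb i - v| <= v / 8 & `|Q0 i - v| <= v / 8].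

Lemma curvature_gt0 i : S i -> [/\ v / 2 <= K2 i, v / 2 <= Qb i & v / 2 <= Q0 i].
Proof.
have v0' := v0; move=> /small[]; rewrite !ler_norml.
by move=> /andP[? ?] /andP[? ?] /andP[? ?]; split; lra.
Qed.

Let m := Num.sqrt (v / 2).
Let m0 : 0 < m.
Proof. by rewrite sqrtr_gt0 divr_gt0. Qed.

Let p i := Num.sqrt (Qb i).
Let q i := Num.sqrt (Q0 i).
Let pm i : S i -> m <= p i.
Proof. by move=> Si; rewrite ler_wsqrtr//; have [] := curvature_gt0 Si. Qed.
Let qm i : S i -> m <= q i.
Proof. by move=> Si; rewrite ler_wsqrtr//; have [] := curvature_gt0 Si. Qed.
Let p2 i : S i -> p i ^+ 2 = Qb i.
Proof.
have v0' := v0; move=> Si; rewrite sqr_sqrtr//; have [_ + _] := curvature_gt0 Si; lra.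
Qed.
Let q2 i : S i -> q i ^+ 2 = Q0 i.
Proof.
have v0' := v0; move=> Si; rewrite sqr_sqrtr//; have [_ _] := curvature_gt0 Si; lra.
Qed.

Let order_p : order a S 0 p.
Proof.
apply: (@order_bounded _ _ _ _ _ (2 * v + 1)) => i Si.
have [_ + _] := small Si; rewrite ler_norml => /andP[_ Qv].
have pp := p2 Si; have v0' := v0; have p0 : 0 <= p i := sqrtr_ge0 _.
rewrite ger0_norm//; have := sqr_ge0 (p i - 1); nra.
Qed.

Let order_qV : order a S 0 (fun i => (q i)^-1).
Proof. exact: order_inv m0 qm. Qed.

Let order_K2V : order a S 0 (fun i => (K2 i)^-1).
Proof.
apply: (@order_inv _ _ _ _ _ (v / 2)); first by rewrite divr_gt0.
by move=> i /curvature_gt0[].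
Qed.

(** The linear part of p^2 - q^2 is K3 / 3 times t + x = y, which is already of order 2: moving the
    second argument of the curvature from e0 to b is a small perturbation. *)
Let order_pBq : order a S 2 (fun i => p i - q i).
Proof.
have oV : order a S 0 (fun i => (p i + q i)^-1).
  apply: order_inv m0 _ => i Si; rewrite (le_trans (pm Si))// lerDl.
  exact: sqrtr_ge0.
have o3 : order a S 0 (fun i => K3 i / 3) := orderM order_K3_0 (order_cst a S 3^-1).
have o : order a S 2 _ := orderB (orderD (orderM o3 order_y)
  (orderM (orderM order_t order_t) order_Eb)) (orderM (orderM hx hx) order_E0).
have o' : order a S 2 _ := orderM o oV.
apply: order_eq o' => i Si.
have n0 : p i + q i != 0.
  by rewrite gt_eqF// (lt_le_trans m0)// (le_trans (pm Si))// lerDl sqrtr_ge0.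
apply: (mulIf n0); rewrite divfK//.
have -> : (p i - q i) * (p i + q i) = p i ^+ 2 - q i ^+ 2 by ring.
by rewrite p2// q2// QbE// Q0E// /t /x /y; ring.
Qed.

Let order_pq : order a S 1 (fun i => p i * q i - v).
Proof.
have [_ ob o0] := order_curvature.
have oV : order a S 0 (fun i => (p i * q i + v)^-1).
  apply: (@order_inv _ _ _ _ _ v) => // i Si; rewrite lerDr mulr_ge0// sqrtr_ge0//.
have o : order a S 1 _ := orderM (orderD (orderM (orderM order_p order_p) o0)
  (orderM (order_cst a S v) ob)) oV.
apply: order_eq o => i Si.
have n0 : p i * q i + v != 0.
  by rewrite gt_eqF// ltr_wpDl// mulr_ge0// sqrtr_ge0.
apply: (mulIf n0); rewrite divfK// -p2// -q2//; ring.
Qed.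

(** Chosen so that 1 + x w = Q0 / K2; the factor x compensates the division by r in the correction
    term. The limit of [w] is - kap / (3 v), which [w1] removes. *)
Let w i := (- (K3 i / 3) + x i * E0 i) / K2 i.
Let w1 i := w i + kap / (3 * v).

Let order_w1 : order a S 1 w1.
Proof.
have o : order a S 1 _ := orderM (orderD (orderM (order_cst a S (3 * v)^-1)
  (orderB (orderM (order_cst a S kap) order_K2) (orderM (order_cst a S v) order_K3)))
  (orderM hx order_E0)) order_K2V.
apply: order_eq o => i Si; rewrite /w1 /w.
have [k2 _ _] := curvature_gt0 Si.
have n0 : K2 i != 0 by rewrite gt_eqF// (lt_le_trans _ k2)// divr_gt0.
by field; rewrite n0 gt_eqF.
Qed.

Let lam i := (ln (1 + x i * w i) - x i * w i) / (x i * w i) ^+ 2.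

Let xw i : S i -> 1 + x i * w i = Q0 i / K2 i.
Proof.
move=> Si; have [k2 _ _] := curvature_gt0 Si.
have n0 : K2 i != 0 by rewrite gt_eqF// (lt_le_trans _ k2)// divr_gt0.
by rewrite Q0E// /w; field.
Qed.

Let xw_small i : S i -> `|x i * w i| <= 1 / 2.
Proof.
move=> Si; have [k2 _ _] := curvature_gt0 Si; have v0' := v0.
have k20 : 0 < K2 i by lra.
have -> : x i * w i = (Q0 i - K2 i) / K2 i.
  by apply: (addrI 1); rewrite xw//; field; rewrite gt_eqF.
rewrite normrM normfV (gtr0_norm k20) ler_pdivrMr//.
have [] := small Si; rewrite !ler_norml => /andP[? ?] /andP[? ?] /andP[? ?].
by apply/andP; split; lra.
Qed.

Let lamE i : S i -> ln (1 + x i * w i) = x i * w i + (x i * w i) ^+ 2 * lam i /\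
  `|lam i| <= 2.
Proof.
move=> /xw_small/norm_ln1D_le; rewrite /lam; set z := x i * w i => H.
have [->|z0] := eqVneq z 0.
  by rewrite addr0 ln1 expr0n invr0 !mulr0 addr0 normr0.
have z2 : z ^+ 2 != 0 by rewrite sqrf_eq0.
split; first by field.
rewrite normrM normfV ler_pdivrMr ?normr_gt0//.
by rewrite (ger0_norm (sqr_ge0 _)).
Qed.

(* With c = kap / (6 v^2), the sum equals
   - p (y + c a^2) / a + (x / a) (p - q)
   + a (c (p q - v) / q + w1 / (2 q) + x w^2 lam / (2 q)). *)
Lemma directed_expansion : order a S 2 (fun i =>
  (a i)^-1 * ((h i - b i) * p i - x i * q i) +
  ((a i)^-1 * (x i * q i))^-1 * ln (q i / Num.sqrt (K2 i))).
Proof.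
have ow : order a S 0 w.
  have o := orderB (order_le a01 (isT : 0 <= 1)%N order_w1) (order_cst a S (kap / (3 * v))).
  by apply: order_eq o => i Si; rewrite addrK.
have ol : order a S 0 lam by apply: (@order_bounded _ _ _ _ _ 2) => i /lamE[].
have oc := order_cst a S.
have o1 : order a S 2 _ := orderM order_p (order_div a01 hy).
have o2 : order a S 2 _ := orderM (order_div a01 hx) order_pBq.
have o3 : order a S 1 _ := orderM (oc (kap / (6 * v ^+ 2))) (orderM order_pq order_qV).
have o4 : order a S 1 _ := orderM (oc 2^-1) (orderM order_qV order_w1).
have o5 : order a S 1 _ := orderM (oc 2^-1) (orderM order_qV
  (orderM hx (orderM (orderM ow ow) ol))).
have o6 : order a S 2 _ := orderM (order_scale a01) (orderD (orderD o3 o4) o5).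
have o : order a S 2 _ := orderD (orderB o2 o1) o6.
apply: order_eq o => i Si.
have [k2 _ _] := curvature_gt0 Si.
have k20 : 0 < K2 i by rewrite (lt_le_trans _ k2)// divr_gt0.
have q0 : 0 < q i := lt_le_trans m0 (qm Si).
have /andP[ai0 _] := a01 Si.
have xn : x i != 0 by rewrite subr_eq0 h0.
have -> : ln (q i / Num.sqrt (K2 i)) = 2^-1 * (x i * w i + (x i * w i) ^+ 2 * lam i).
  have [<- _] := lamE Si; rewrite xw// -q2//.
  have -> : q i ^+ 2 / K2 i = (q i / Num.sqrt (K2 i)) ^+ 2.
    by rewrite expr_div_n (sqr_sqrtr (ltW k20)).
  rewrite lnXn ?divr_gt0 ?sqrtr_gt0//; last first.
    by have [_ _ h2] := curvature_gt0 Si; rewrite (lt_le_trans _ h2)// divr_gt0.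
  by set L := ln _; field.
have -> : h i - b i = x i - y i by rewrite /x /y; ring.
(* The two terms of order a meet here: c a p from the shift of b, with c = kap / (6 v^2), and - a
   kap / (6 v q) from the logarithm. As kap / (6 v) = c v, they add up to a c (p q - v) / q, of
   order 2. *)
rewrite /w1; field.
by rewrite (gt_eqF q0) (gt_eqF v0) (gt_eqF ai0) xn.
Qed.

End directed_expansion.

(** An atom at [y] would be a jump of the distribution function. This serves to discard the event
    thetahat = th, where the modified directed likelihood has no meaningful value. *)
Lemma null_level {R : realType} {d : measure_display} {Omega : measurableType d}
    (P : probability Omega R) (Z : Omega -> R) (y : R) : measurable_fun setT Z ->
  {for y, continuous (fun y => fine (P [set w | Z w <= y]))} ->
  P [set w | Z w = y] = 0%E.
Proof.
move=> mZ cG; have mle s : measurable [set w | Z w <= s].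
  by rewrite -[X in measurable X]setTI; exact: measurable_fun_ler.
have meq : measurable [set w | Z w = y].
  by rewrite -[X in measurable X]setTI; exact: (mZ measurableT [set y] (measurable_set1 y)).
have fin A : measurable A -> P A \is a fin_num by exact: fin_num_measure.
apply/eqP; rewrite eq_le measure_ge0 andbT -(fineK (fin _ meq)) lee_fin.
apply/ler_addgt0Pr => e e0; rewrite add0r.
have /cvgrPdist_lt/(_ e e0)/nbhs_ballP[r /= r0 H] := cG.
pose s := y - r / 2; have sy : s < y by rewrite /s ltrBlDr ltrDl divr_gt0.
have := H s; rewrite /ball/= /s opprB addrC subrK => {}H.
have {}H : `|fine (P [set w | Z w <= y]) - fine (P [set w | Z w <= s])| < e.
  by apply: H; rewrite gtr0_norm ?divr_gt0// gtr_pMr// invf_lt1// ltr1n.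
pose L z := [set w | Z w <= z].
have U : (P [set w | Z w = y] + P (L s) <= P (L y))%E.
  have mLs : measurable (L s) by exact: mle.
  have dis : [set w | Z w = y] `&` L s = set0.
    by rewrite -subset0 => w [/= Zy]; rewrite /L/= Zy leNgt sy.
  rewrite -(measureU P meq mLs dis); apply: le_measure; rewrite ?inE//.
  - exact: measurableU.
  - exact: mle.
  by move=> w [Zy|Zs]; rewrite /L/=; [rewrite Zy|exact: (le_trans Zs (ltW sy))].
have : ((fine (P [set w | Z w = y]))%:E + (fine (P (L s)))%:E <= (fine (P (L y)))%:E)%E.
  by rewrite !fineK// ?fin_num_measure//; exact: mle.
rewrite -EFinD lee_fin => {}U.
move: H; rewrite ltr_norml => /andP[_ H]; lra.
Qed.

Section directed_likelihoods.
Context {R : realType}.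
Variable F : expfam R.
Local Notation K := (fun k => derive1n k (psibar F)).
Implicit Types (e y th : R) (n : nat).

Hypothesis smooth : forall e0, nat_space F e0 ->
  exists2 rho : R, 0 < rho & exists B : R,
    forall e, `|e - e0| < rho -> [/\ nat_space F e,
      forall k, (k < 4)%N -> is_derive e 1 (K k) (K k.+1 e) & `|K 4%N e| <= B].
Hypothesis psibar2_gt0 : forall e, nat_space F e -> 0 < K 2%N e.

Lemma r_psibar1 n b h : (0 < n)%N -> nat_space F b -> nat_space F h ->
  0 <= curv K h b ->
  r F n (K 1%N b) (K 1%N h) = Num.sqrt n%:R * ((h - b) * Num.sqrt (curv K h b)).
Proof.
move=> n0 nb nh c0; have E : lr F n (K 1%N b) (K 1%N h) = n%:R * ((h - b) ^+ 2 * curv K h b).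
  have l1 : loglik F n (K 1%N h) (K 1%N h) = n%:R * (h * K 1%N h - K 0%N h).
    exact: (loglik_psibar1 smooth psibar2_gt0).
  have l2 : loglik F n (K 1%N b) (K 1%N h) = n%:R * (b * K 1%N h - K 0%N b).
    exact: (loglik_psibar1 smooth psibar2_gt0).
  apply: (eq_trans (congr2 (fun x y => 2 * (x - y)) l1 l2)); have := curvE K h b.
  move: (curv K h b) (K 1%N h) (K 0%N h) (K 0%N b) => c k1 k0 kb E.
  have -> : (h - b) ^+ 2 * c = (b - h) ^+ 2 * c by ring.
  by rewrite -E; ring.
rewrite /r E sqrtrM ?ler0n// sqrtrM ?sqr_ge0// sqrtr_sqr.
have -> : Num.sg (K 1%N h - K 1%N b) = Num.sg (h - b).
  have lt := lt_psibar1 smooth psibar2_gt0.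
  have [hb|bh|->] := ltgtP h b; last by rewrite !subrr.
    by rewrite !ltr0_sg// subr_lt0//; exact: lt.
  by rewrite !gtr0_sg// subr_gt0//; exact: lt.
by rewrite mulrCA; congr (_ * _); rewrite mulrA -numEsg.
Qed.

Lemma u_psibar1 n e h : (0 < n)%N -> nat_space F e -> nat_space F h ->
  u F n (K 1%N e) (K 1%N h) = Num.sqrt n%:R * ((h - e) * Num.sqrt (K 2%N h)).
Proof.
move=> n0 ne nh; have n0' : 0 < n%:R :> R by rewrite ltr0n.
have k0 : 0 < K 2%N h := psibar2_gt0 nh.
have l1 : loglik_1 F n (K 1%N h) (K 1%N h) = n%:R * h.
  exact: (loglik_1_psibar1 smooth psibar2_gt0).
have l2 : loglik_1 F n (K 1%N e) (K 1%N h) = n%:R * e.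
  exact: (loglik_1_psibar1 smooth psibar2_gt0).
have oi : obs_info F n (K 1%N h) = n%:R / K 2%N h.
  exact: (obs_info_psibar1 smooth psibar2_gt0).
rewrite /u oi; apply: (eq_trans (congr1 ( *%R _) (congr2 (fun x y => x - y) l1 l2))).
move: (K 2%N h) k0 => k k0.
rewrite sqrtrM ?ler0n// sqrtrV ?(ltW k0)//.
rewrite -{2 3}(sqr_sqrtr (ltW n0')); field.
by rewrite !gt_eqF// sqrtr_gt0.
Qed.

(** The factor sqrt n (h - e), nonzero because h != e, is common to r and u and cancels in the
    logarithm; what remains is the ratio of the two curvatures. *)
Lemma directed_difference n b e h : (0 < n)%N ->
  nat_space F b -> nat_space F e -> nat_space F h -> h != e ->
  0 <= curv K h b -> 0 < curv K h e ->
  r F n (K 1%N b) (K 1%N h) - rstar F n (K 1%N e) (K 1%N h) =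
  Num.sqrt n%:R * ((h - b) * Num.sqrt (curv K h b) - (h - e) * Num.sqrt (curv K h e)) +
  (Num.sqrt n%:R * ((h - e) * Num.sqrt (curv K h e)))^-1 *
    ln (Num.sqrt (curv K h e) / Num.sqrt (K 2%N h)).
Proof.
move=> n0 nb ne nh he cb ce; have k0 : 0 < K 2%N h := psibar2_gt0 nh.
have Eb := r_psibar1 n0 nb nh cb; have Ee := r_psibar1 n0 ne nh (ltW ce).
have Eu := u_psibar1 n0 ne nh.
apply: (eq_trans (f_equal3 (fun rb re u => rb - (re - re^-1 * ln (re / u))) Eb Ee Eu)).
move: (Num.sqrt (curv K h b)) (Num.sqrt (curv K h e)) => p q.
have : 0 < Num.sqrt (K 2%N h) by rewrite sqrtr_gt0.
have : 0 < Num.sqrt n%:R :> R by rewrite sqrtr_gt0 ltr0n.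
move: (Num.sqrt n%:R) (Num.sqrt (K 2%N h)) => s k s0' k0'.
have -> : s * ((h - e) * q) / (s * ((h - e) * k)) = q / k.
  have s0 : s != 0 by rewrite gt_eqF.
  have kn : k != 0 by rewrite gt_eqF.
  have xn : h - e != 0 by rewrite subr_eq0.
  by field; rewrite s0 kn xn.
by rewrite mulrBr; ring.
Qed.

End directed_likelihoods.

Section local_parameter.
Context {R : realType}.
Variable F : expfam R.
Local Notation K := (fun k => derive1n k (psibar F)).
Hypothesis smooth : forall e0, nat_space F e0 ->
  exists2 rho : R, 0 < rho & exists B : R,
    forall e, `|e - e0| < rho -> [/\ nat_space F e,
      forall k, (k < 4)%N -> is_derive e 1 (K k) (K k.+1 e) & `|K 4%N e| <= B].
Hypothesis psibar2_gt0 : forall e, nat_space F e -> 0 < K 2%N e.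

(** Caratheodory's slope function of psibar' at [e0] is continuous with value v there, so near [e0]
    it exceeds v / 2; this makes the inverse Lipschitz at psibar'(e0) with constant 2 / v. *)
Lemma mean_parametrization (e0 eps : R) : nat_space F e0 -> 0 < eps ->
  exists g : R -> R, exists2 eta : R, 0 < eta &
    forall y, `|y - K 1%N e0| < eta ->
      [/\ nat_space F (g y), K 1%N (g y) = y, `|g y - e0| <= eps &
          `|g y - e0| <= 2 / K 2%N e0 * `|y - K 1%N e0|].
Proof.
move=> ne e0p; have v0 := psibar2_gt0 ne; set v := K 2%N e0 in v0 *.
have [ge ng dg] := psibar1_local_inverse smooth psibar2_gt0 ne.
set g := fun th => eta_of F 1 th in ge ng dg.
have gE : g (K 1%N e0) = e0 by exact: ge.
have dc : is_derive e0 (1 : R) (K 1%N) v by exact: (@is_derive_psibar _ _ smooth 1).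
have /is_derive1_caratheodory[q [qE qc qe]] := dc.
have cg : {for K 1%N e0, continuous g} := is_derive_continuous dg.
have q2 : \forall e \near e0, v / 2 <= q e.
  have /cvgrPdist_lt/(_ (v / 2)) := qc; rewrite divr_gt0// => /(_ isT).
  by apply: filterS => e; rewrite qe ltr_norml => /andP[? ?]; lra.
have nb : \forall e \near e0, `|e - e0| <= eps.
  by apply: filterS (nbhsx_ballx e0 _ e0p) => e; rewrite /ball/= distrC => /ltW.
rewrite -gE in q2 nb.
have gq : \forall y \near K 1%N e0, v / 2 <= q (g y) := cg _ q2.
have gb : \forall y \near K 1%N e0, `|g y - g (K 1%N e0)| <= eps := cg _ nb.
rewrite gE in gb.
have /nbhs_ballP[eta /= eta0 H] : \forall y \near K 1%N e0,
    [/\ nat_space F (g y), K 1%N (g y) = y, `|g y - e0| <= eps & v / 2 <= q (g y)].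
  near=> y; have [? ?] : nat_space F (g y) /\ K 1%N (g y) = y by near: y; exact: ng.
  by split=> //; near: y.
exists g, eta => // y ye; have [|ny Ky yb yq] := H y; first by rewrite /ball/= distrC.
have E : y - K 1%N e0 = q (g y) * (g y - e0) by rewrite -(qE (g y)); congr (_ - _).
split=> //; rewrite E.
rewrite normrM mulrA ler_peMl// ger0_norm; last by rewrite (le_trans _ yq)// divr_ge0// ltW.
by rewrite mulrAC ler_pdivlMr// mul1r; lra.
Unshelve. all: by end_near. Qed.

End local_parameter.

(** * A deterministic bound, uniform near the true mean *)

Section asymptotics.
Context {R : realType}.
Variables (K : nat -> R -> R) (e0 rho B : R).
Hypothesis rho0 : 0 < rho.
Hypothesis dK : forall e k, `|e - e0| < rho -> (k < 4)%N -> is_derive e 1 (K k) (K k.+1 e).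
Hypothesis K4B : forall e, `|e - e0| < rho -> `|K 4 e| <= B.
Hypothesis v0 : 0 < K 2 e0.
Local Notation v := (K 2 e0).
Local Notation kap := (K 3 e0).
Variables (N : set R) (g : R -> R) (eta : R).
Hypothesis eta0 : 0 < eta.
Hypothesis gP : forall y, `|y - K 1 e0| < eta ->
  [/\ N (g y), K 1 (g y) = y, `|g y - e0| <= rho / 4 &
      `|g y - e0| <= 2 / v * `|y - K 1 e0|].

Let a (n : nat) : R := (Num.sqrt n%:R)^-1.

Lemma root_scale n : (0 < n)%N -> 0 < a n <= 1.
Proof.
move=> n0; have n1 : 1 <= n%:R :> R by rewrite ler1n.
have s1 : 1 <= Num.sqrt n%:R :> R by rewrite -[leLHS]sqrtr1 ler_wsqrtr.
have s0 : 0 < Num.sqrt n%:R :> R := lt_le_trans ltr01 s1.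
by rewrite /a invr_gt0 s0 invf_le1.
Qed.

Lemma root_scale_sqr n : a n ^+ 2 = n%:R^-1.
Proof. by rewrite /a exprVn sqr_sqrtr. Qed.

Lemma root_scale_small (eps : R) : 0 < eps -> \forall n \near \oo, a n <= eps.
Proof.
move=> e0'; near=> n; have n0 : (0 < n)%N by near: n; exact: nbhs_infty_gt.
have /andP[a0 _] := root_scale n0.
rewrite -(ler_pXn2r (isT : 0 < 2)%N) ?nnegrE ?(ltW a0) ?(ltW e0')//.
rewrite root_scale_sqr -(invrK (eps ^+ 2)) lef_pV2 ?posrE ?invr_gt0 ?exprn_gt0 ?ltr0n//.
by near: n; exact: nbhs_infty_ger.
Unshelve. all: by end_near. Qed.

(** With y the deviation of the canonical parameter, bn - th = v y + kap y^2 / 2 + O(y^3). Since y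
    has order 2, the quadratic term has order 4 and the median correction is simply divided by v. *)
Lemma order_canonical_median (bn : nat -> R) (S : set nat) :
  (forall n, S n -> (0 < n)%N) -> (forall n, S n -> `|bn n - K 1 e0| < eta) ->
  order a S 3 (fun n => bn n - K 1 e0 + kap / (6 * v) * a n ^+ 2) ->
  order a S 3 (fun n => g (bn n) - e0 + kap / (6 * v ^+ 2) * a n ^+ 2).
Proof.
move=> S0 Seta o3; have a01 n : S n -> 0 < a n <= 1 by move=> /S0/root_scale.
have oa := order_scale a01; have oc := order_cst a S.
have of2 : order a S 2 (fun n => bn n - K 1 e0).
  have o := orderB (order_le a01 (isT : 2 <= 3)%N o3)
    (orderM (oc (kap / (6 * v))) (orderM oa oa)).
  by apply: order_eq o => n Sn; rewrite expr2 addrK.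
have [M M0 HM] := of2.
have B0 : 0 <= B by rewrite (le_trans _ (@K4B e0 _))// subrr normr0.
have v0' := v0.
have oy : order a S 2 (fun n => g (bn n) - e0).
  exists (2 / v * M); first by rewrite mulr_ge0// divr_ge0// ltW.
  move=> n Sn; have [_ _ _ h] := gP (Seta n Sn); apply: (le_trans h).
  by rewrite -[leRHS]mulrA ler_wpM2l ?HM// divr_ge0// ltW.
pose rem n := bn n - K 1 e0 - v * (g (bn n) - e0) - kap / 2 * (g (bn n) - e0) ^+ 2.
have orem : order a S 3 rem.
  apply: (order_le a01 (isT : 3 <= 6)%N); have [L L0 HL] := oy.
  exists (B * L ^+ 3); first by rewrite mulr_ge0// exprn_ge0.
  move=> n Sn; have [_ Kn nb _] := gP (Seta n Sn).
  have e0b : `|e0 - e0| <= rho / 4.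
    by have r := rho0; rewrite subrr normr0 divr_ge0// ltW.
  have [_ _ h _] := taylor_remainders rho0 dK K4B e0b nb; rewrite Kn in h.
  apply: (le_trans h); rewrite -[leRHS]mulrA ler_wpM2l//.
  have -> : L ^+ 3 * a n ^+ 6 = (L * a n ^+ 2) ^+ 3 by rewrite exprMn -exprM.
  rewrite lerXn2r ?nnegrE ?HL// mulr_ge0// exprn_ge0//.
  by have /andP[/ltW] := a01 n Sn.
have o := orderM (oc v^-1) (orderB (orderB o3 orem) (orderM (oc (kap / 2))
  (order_le a01 (isT : 3 <= 4)%N (orderM oy oy)))).
by apply: order_eq o => n Sn; rewrite /rem; field; rewrite gt_eqF.
Qed.

(** Stands for the difference of the two directed likelihoods as a function of n, of the median and
    of the observed value. *)
Variable D : nat -> R -> R -> R.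
Hypothesis DE : forall n b h, (0 < n)%N -> N b -> N h -> h != e0 ->
  0 <= curv K h b -> 0 < curv K h e0 ->
  D n (K 1 b) (K 1 h) =
  Num.sqrt n%:R * ((h - b) * Num.sqrt (curv K h b) - (h - e0) * Num.sqrt (curv K h e0)) +
  (Num.sqrt n%:R * ((h - e0) * Num.sqrt (curv K h e0)))^-1 *
    ln (Num.sqrt (curv K h e0) / Num.sqrt (K 2 h)).

(** No probability is left here: [X] is the radius of the normal deviation region in units of
    n^(-1/2), and one constant has to serve for all observed values inside it. *)
Lemma difference_bound (bn : nat -> R) (C X : R) : 0 <= C ->
  (\forall n \near \oo,
    `|n%:R * (bn n - K 1 e0) + kap / (6 * v)| <= C / Num.sqrt n%:R) ->
  exists M : R, \forall n \near \oo, forall y, `|y - K 1 e0| <= X * a n ->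
    y != K 1 e0 -> `|D n (bn n) y| <= M * n%:R^-1.
Proof.
move=> C0 bnP; have v0' := v0; have eta0' := eta0.
pose S0 : set nat := [set n | (0 < n)%N /\
  `|n%:R * (bn n - K 1 e0) + kap / (6 * v)| <= C / Num.sqrt n%:R].
have a0 n : S0 n -> 0 < a n <= 1 by move=> [/root_scale].
have o3 : order a S0 3 (fun n => bn n - K 1 e0 + kap / (6 * v) * a n ^+ 2).
  exists C => // n [n0 h].
  have n0' : n%:R != 0 :> R by rewrite pnatr_eq0 -lt0n.
  have -> : bn n - K 1 e0 + kap / (6 * v) * a n ^+ 2 =
      (n%:R * (bn n - K 1 e0) + kap / (6 * v)) * a n ^+ 2.
    by rewrite root_scale_sqr; field; rewrite n0' gt_eqF.
  have a2 : 0 <= a n ^+ 2 := sqr_ge0 _.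
  by rewrite normrM (ger0_norm a2) (exprS _ 2) mulrA ler_wpM2r.
have of1 : order a S0 1 (fun n => bn n - K 1 e0).
  have oa := order_scale a0.
  have o := orderB (order_le a0 (isT : 1 <= 3)%N o3) (order_le a0 (isT : 1 <= 2)%N
    (orderM (order_cst a S0 (kap / (6 * v))) (orderM oa oa))).
  by apply: order_eq o => n Sn; rewrite expr2 addrK.
have [|a1 a10 small1] := order_small (eps := eta / 2) of1; first by rewrite divr_gt0.
pose S1 : set nat := [set n | S0 n /\ a n <= a1].
have S1eta n : S1 n -> `|bn n - K 1 e0| < eta.
  by move=> [Sn an]; rewrite (le_lt_trans (small1 n Sn (a0 n Sn) an))//; lra.
have oy : order a S1 3 (fun n => g (bn n) - e0 + kap / (6 * v ^+ 2) * a n ^+ 2).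
  apply: order_canonical_median => //; first by move=> n [[]].
  by apply: order_subset o3 => n [].
(* The estimate h is part of the index, so that the constants in [order] do not depend on it. *)
pose ai (i : nat * R) := a i.1; pose hi (i : nat * R) := i.2.
pose bi (i : nat * R) := g (bn i.1).
pose S2 : set (nat * R) := [set i | [/\ S1 i.1, i.2 != e0, `|i.2 - e0| <= rho / 4 &
  `|i.2 - e0| <= 2 / v * `|X| * a i.1]].
have a2 i : S2 i -> 0 < ai i <= 1 by move=> [[Sn _] _ _ _]; exact: a0.
have h2 i : S2 i -> hi i != e0 by case.
have hb2 i : S2 i -> `|hi i - e0| <= rho / 4 by case.
have bb2 i : S2 i -> `|bi i - e0| <= rho / 4.
  by move=> [Sn _ _ _]; have [] := gP (S1eta _ Sn).
have ox2 : order ai S2 1 (fun i => hi i - e0).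
  exists (2 / v * `|X|); first by rewrite mulr_ge0// divr_ge0// ltW.
  by move=> i [_ _ _]; rewrite expr1.
have oy2 : order ai S2 3 (fun i => bi i - e0 + kap / (6 * v ^+ 2) * ai i ^+ 2).
  have [M M0 H] := oy; exists M => // i [Sn _ _ _]; exact: H.
have [k2 kb k0] := order_curvature rho0 dK K4B a2 ox2 oy2 hb2 bb2.
have v8 : 0 < v / 8 by rewrite divr_gt0.
have [c2 c20 sm2] := order_small k2 v8.
have [cb cb0 smb] := order_small kb v8.
have [c0 c00 sm0] := order_small k0 v8.
pose c := Num.min c2 (Num.min cb c0).
have cp : 0 < c by rewrite !lt_min c20 cb0 c00.
pose S3 : set (nat * R) := [set i | S2 i /\ ai i <= c].
have S32 : S3 `<=` S2 by move=> i [].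
have small3 i : S3 i -> [/\ `|K 2 (hi i) - v| <= v / 8,
    `|curv K (hi i) (bi i) - v| <= v / 8 & `|curv K (hi i) e0 - v| <= v / 8].
  move=> [Si]; rewrite !le_min => /and3P[? ? ?].
  by split; [exact: sm2 (a2 i Si) _|exact: smb (a2 i Si) _|exact: sm0 (a2 i Si) _].
have [M M0 HM] := directed_expansion rho0 dK K4B v0
  (fun i Si => a2 i (S32 i Si)) (fun i Si => h2 i (S32 i Si))
  (order_subset S32 ox2) (order_subset S32 oy2)
  (fun i Si => hb2 i (S32 i Si)) (fun i Si => bb2 i (S32 i Si)) small3.
exists M; near=> n => y yX yn.
have n0 : (0 < n)%N by near: n; exact: nbhs_infty_gt.
have S1n : S1 n.
  split; last by near: n; exact: root_scale_small.
  by split=> //; near: n; exact: bnP.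
have anc : a n <= c by near: n; exact: root_scale_small.
have /andP[an0 _] := root_scale n0.
have yeta : `|y - K 1 e0| < eta.
  apply: (le_lt_trans yX); apply: (@le_lt_trans _ _ (`|X| * a n)).
    by rewrite ler_wpM2r ?ler_norm// ltW.
  have an : a n <= eta / (`|X| + 1).
    by near: n; apply: root_scale_small; rewrite divr_gt0// ltr_wpDl.
  have X1 : 0 < `|X| + 1 by rewrite ltr_wpDl.
  rewrite ler_pdivlMr// in an; rewrite (lt_le_trans _ an)// [ltRHS]mulrC ltr_pM2r//.
  by rewrite ltrDl.
have [Ny Ky yb yl] := gP yeta.
have [Nb Kb _ _] := gP (S1eta n S1n).
have gn : g y != e0 by apply: contra_neq yn => gy; rewrite -Ky gy.
have S3i : S3 (n, g y).
  split; last exact: anc.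
  split=> //=; apply: (le_trans yl); rewrite -[leRHS]mulrA ler_wpM2l//.
    by rewrite divr_ge0// ltW.
  by rewrite (le_trans yX)// ler_wpM2r ?ler_norm// ltW.
have := HM _ S3i; rewrite /ai /hi /bi /= root_scale_sqr invrK => H.
have [_ + +] := small3 _ S3i; rewrite /hi/bi/= !ler_norml => /andP[cb1 _] /andP[c01 _].
have E := DE n0 Nb Ny gn; rewrite Kb Ky in E.
by rewrite E; [rewrite -ler_norml; exact: H|lra|lra].
Unshelve. all: by end_near. Qed.

End asymptotics.

Section sample_mean.
Context {R : realType} {d : measure_display} {Omega : measurableType d}.
Variables (F : expfam R) (X : nat -> {mfun Omega >-> R}).

Lemma partial_sum_thetahat (c : R) n w : (0 < n)%N ->
  partial_sum X (fun x => stat F x - c) n w = n%:R * (thetahat F X n w - c).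
Proof.
move=> n0; rewrite /partial_sum sumrB sumr_const card_ord mulrBr /thetahat.
by rewrite mulrC divfK ?pnatr_eq0 -?lt0n// mulr_natl.
Qed.

Lemma measurable_thetahat n : measurable_fun setT (thetahat F X n).
Proof.
apply: measurable_funM => //; apply: measurable_sum => i.
exact: (measurable_stat_comp F (X i)).
Qed.

End sample_mean.

Unset Implicit Arguments.
Set Strict Implicit.
Set Printing Implicit Defensive.

Theorem theorem3 (R : realType) (F : expfam R)
  (d : measure_display) (Omega : measurableType d)
  (P : R -> probability Omega R) (X : nat -> {mfun Omega >-> R})
  (b : nat -> R -> R)
  (F_regular : regular F)
  (F_continuous : continuous_family F)
  (* P th is the distribution under the mean value th = psibar' e *)
  (X_iid : forall e : R, nat_space F e ->
     iid_density (P (derive1 (psibar F) e)) X (density F e))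
  (G_continuous_y : forall (n : nat) (th : R), (0 < n)%N -> mean_space F th ->
     continuous (fun y => G F P X n y th))
  (G_continuous_th : forall (n : nat) (y : R), (0 < n)%N ->
     {within mean_space F, continuous (G F P X n y)})
  (G_nonincreasing : forall (n : nat) (y : R), (0 < n)%N ->
     {in mean_space F &, {homo G F P X n y : th1 th2 /~ th1 <= th2}})
  (b_median : forall (n : nat) (th : R), (0 < n)%N -> mean_space F th ->
     G F P X n (b n th) th = 2^-1)
  (b_continuous : forall n : nat, (0 < n)%N ->
     {within mean_space F, continuous (b n)})
  (b_increasing : forall n : nat, (0 < n)%N ->
     {in mean_space F &, {homo b n : th1 th2 / th1 < th2}})
  (th : R) (th_mean : mean_space F th)
  (normal_region : Op (P th)
     (fun n w => (th - thetahat F X n w) / sigma F n th) (fun=> 1)) :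
  Op (P th)
    (fun n w => r F n (b n th) (thetahat F X n w) -
                rstar F n th (thetahat F X n w))
    (fun n => n%:R^-1).
Proof.
have [e0 ne0 e0th] := th_mean.
pose K k := derive1n k (psibar F).
have smooth e : nat_space F e -> exists2 rho : R, 0 < rho & exists B : R,
    forall e1, `|e1 - e| < rho -> [/\ nat_space F e1,
      forall k, (k < 4)%N -> is_derive e1 1 (K k) (K k.+1 e1) & `|K 4%N e1| <= B].
  move=> ne; have [_ dens] := X_iid e ne.
  by have [rho rho0 [B [H _]]] := psibar_smooth F_regular (dens 0%N) ne; exists rho => //; exists B.
have K2_gt0 e : nat_space F e -> 0 < K 2%N e.
  move=> ne; have [_ dens] := X_iid e ne.
  exact: (psibar2_gt0 F_regular F_continuous (dens 0%N) ne).
have [indep dens] := X_iid e0 ne0.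
rewrite e0th in indep dens.
have v0 := K2_gt0 e0 ne0.
have [i4 m1 m2 m3] := central_moments F_regular (dens 0%N) ne0.
have Tac := stat_null_translate F_continuous (dens 0%N).
have mtau : measurable_fun setT (fun x => stat F x - th).
  by apply: measurable_funB => //; exact: measurable_stat.
have ident i (A : set R) : measurable A ->
    P th (X i @^-1` A) = P th (X 0%N @^-1` A).
  by move=> mA; rewrite (dens i A mA) (dens 0%N A mA).
have c1 : derive1n 1 (psibar F) e0 = th by exact: e0th.
rewrite c1 in i4 m1 m2 m3.
have [C C0 med] := median_expansion indep ident mtau i4 m1 m2 m3 v0 (Tac th).
have [rho rho0 [B H]] := smooth e0 ne0.
have dK e k : `|e - e0| < rho -> (k < 4)%N -> is_derive e 1 (K k) (K k.+1 e).
  by move=> er k4; have [_ + _] := H e er; exact.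
have K4B e : `|e - e0| < rho -> `|K 4%N e| <= B by move=> er; have [] := H e er.
have [|g [eta eta0 gP]] := mean_parametrization smooth K2_gt0 (eps := rho / 4) ne0.
  by rewrite divr_gt0.
(* The event that the centred sum is at most n (b - th) is the event thetahat <= b, so [med] applies
   with m = n (b - th). *)
have bnP : \forall n \near \oo,
    `|n%:R * (b n th - K 1%N e0) + K 3%N e0 / (6 * K 2%N e0)| <= C / Num.sqrt n%:R.
  have n_gt0 : \forall n \near \oo, (0 < n)%N by exact: nbhs_infty_gt.
  move: n_gt0 med; apply: filterS2 => n n0 medn.
  have := b_median n th n0 th_mean; rewrite /G => bn.
  rewrite [K 1%N e0]c1; apply: medn.
  rewrite -bn; congr (fine (P th _)); apply/seteqP; split=> w /=.
    by rewrite partial_sum_thetahat// ler_pM2l ?ltr0n// lerD2r.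
  by rewrite partial_sum_thetahat// ler_pM2l ?ltr0n// lerD2r.
have DE n b0 h : (0 < n)%N -> nat_space F b0 -> nat_space F h -> h != e0 ->
    0 <= curv K h b0 -> 0 < curv K h e0 ->
    r F n (K 1%N b0) (K 1%N h) - rstar F n th (K 1%N h) =
    Num.sqrt n%:R * ((h - b0) * Num.sqrt (curv K h b0) - (h - e0) * Num.sqrt (curv K h e0)) +
    (Num.sqrt n%:R * ((h - e0) * Num.sqrt (curv K h e0)))^-1 *
      ln (Num.sqrt (curv K h e0) / Num.sqrt (K 2%N h)).
  move=> n0 nb nh he cb ce.
  have E := directed_difference smooth K2_gt0 n0 nb ne0 nh he cb ce.
  exact: (eq_trans (congr1 (fun z => r F n (K 1%N b0) (K 1%N h) -
    rstar F n z (K 1%N h)) (esym e0th)) E).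
(* The standard error is sqrt(v / n), so [M0] standard errors amount to the radius [M0] sqrt v in
   units of n^(-1/2). *)
move=> eps eps0; have [M0 nr] := normal_region eps eps0.
have [M HM] := difference_bound rho0 dK K4B v0 eta0 gP
  (D := fun n bb y => r F n bb y - rstar F n th y) DE (M0 * Num.sqrt (K 2%N e0)) C0 bnP.
exists M; have n_gt0 : \forall n \near \oo, (0 < n)%N by exact: nbhs_infty_gt.
move: n_gt0 nr HM; apply: filterS3 => n n0 [E [mE PE sub]] HM.
have K1th : K 1%N e0 = th by exact: e0th.
rewrite K1th in HM.
have sg : sigma F n th = Num.sqrt (K 2%N e0) / Num.sqrt n%:R.
  apply: (eq_trans (congr1 (sigma F n) (esym e0th))).
  rewrite (sigma_psibar1 smooth K2_gt0 n0 ne0) sqrtrM ?(ltW v0)//.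
  by rewrite sqrtrV.
have sg0 : 0 < sigma F n th by rewrite sg divr_gt0 ?sqrtr_gt0 ?ltr0n.
have mth := measurable_thetahat F X n.
(* On [Z] the value of [rstar] results from the conventions for division by 0 and [difference_bound]
   is silent, so this null event is added to the exceptional one. *)
pose Z := [set w | thetahat F X n w = th].
have null : P th Z = 0%E.
  by apply: (null_level mth); exact: (G_continuous_y n th n0 th_mean).
have mnull : measurable Z.
  by rewrite -[Z]setTI; exact: (mth measurableT [set th] (measurable_set1 th)).
exists (E `|` Z); split.
- exact: measurableU.
- apply: (le_trans (measureU2 (P th) mE mnull)).
  have Z0 : (P th Z <= 0)%E by rewrite null.
  by rewrite -[eps%:E]adde0; apply: leeD.
move=> w /= Mw; have [wth|wth] := pselect (thetahat F X n w = th); [by right|left].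
apply: sub => /=; rewrite mulr1 ltNge; apply/negP => wM.
have : `|r F n (b n th) (thetahat F X n w) - rstar F n th (thetahat F X n w)| <= M * n%:R^-1.
  apply: HM; last exact/eqP.
  rewrite distrC; move: wM; rewrite normrM normfV (gtr0_norm sg0) ler_pdivrMr// sg.
  by rewrite mulrA.
by rewrite leNgt Mw.
Qed.
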